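(* Let $X$ be the Cantor space, let $\Gamma,\Lambda\le\mathrm{Homeo}(X)$ be two minimal ample groups over $X$, let $K\subseteq X$ be a $\Gamma$-malleable subset and $L\subseteq X$ a $\Lambda$-malleable subset. Assume also that $\Gamma$ and $\Lambda$ induce isomorphic relations on $\mathrm{Clopen}(X)$. Then every homeomorphism $h\colon K\to L$ such that $h\Gamma_K h^{-1}=\Lambda_L$ extends to a homeomorphism $h$ of $X$ such that $h\Gamma h^{-1}=\Lambda$.
   Context: Conventions. For a compact metrizable $0$-dimensional space $Z$, $\mathrm{Homeo}(Z)$ is its homeomorphism group and $\mathrm{Clopen}(Z)$ the Boolean algebra of its clopen subsets. A subgroup $G\le \mathrm{Homeo}(Z)$ is a full group if every $g\in\mathrm{Homeo}(Z)$ for which there are a finite clopen partition $Z=\bigsqcup_{i=1}^n U_i$ and $g_1,\dots,g_n\in G$ with $g(x)=g_i(x)$ for all $x\in U_i$ belongs to $G$. An ample group over $Z$ is a countable, locally finite full group $G\le\mathrm{Homeo}(Z)$ such that for every $g\in G$ the set $\{x\in Z: g(x)=x\}$ is clopen in $Z$. A group over $X$ is minimal if all of its orbits on $X$ are dense. $M(\Gamma)$ is the set of $\Gamma$-invariant Borel probability measures on $X$. For $A,B\in\mathrm{Clopen}(X)$, $A\sim_\Gamma B$ means that there is $\gamma\in\Gamma$ with $\gamma(A)=B$. Two ample groups $\Gamma,\Lambda$ over $X$ induce isomorphic relations on $\mathrm{Clopen}(X)$ if there is $g\in\mathrm{Homeo}(X)$ such that for all clopen $A,B$ one has $(A\sim_\Gamma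 B)\Leftrightarrow(g(A)\sim_\Lambda g(B))$. A closed set $K\subseteq X$ is $\Gamma$-thin if $\mu(K)=0$ for all $\mu\in M(\Gamma)$; it is $\Gamma$-étale if for every $\gamma\in\Gamma$ and every clopen subset $A$ of $K$ the set $\gamma A\cap K$ is clopen in $K$; it is $\Gamma$-malleable if it is closed, $\Gamma$-thin and $\Gamma$-étale. An involution is an element $\gamma$ with $\gamma^2=\mathrm{id}$. If $K$ is $\Gamma$-étale and $\gamma\in\Gamma$ is an involution, $\gamma_K\colon K\to K$ is the homeomorphism given by $\gamma_K(x)=\gamma(x)$ if $\gamma(x)\in K$ and $\gamma_K(x)=x$ otherwise. $\Gamma_K$ is the smallest full subgroup of $\mathrm{Homeo}(K)$ containing $\gamma_K$ for every involution $\gamma\in\Gamma$. The same definitions apply to $\Lambda$ and $L$. *)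

(* Defs.v *)
From HB Require Import structures.
From mathcomp Require Import all_boot all_order all_algebra.
From mathcomp Require Import all_classical all_reals all_analysis.

Set Implicit Arguments.
Unset Strict Implicit.
Unset Printing Implicit Defensive.

Local Open Scope classical_set_scope.

Definition inverse_homeos (Y Z : topologicalType) (f : Y -> Z) (g : Z -> Y) :=
  [/\ continuous f, continuous g, cancel f g & cancel g f].

Definition homeomorphism (Y Z : topologicalType) (f : Y -> Z) :=
  exists g : Z -> Y, inverse_homeos f g.

Section groups_of_homeomorphisms.
Context {Z : topologicalType}.
Implicit Types (G F : set (Z -> Z)) (A B : set Z).

Definition homeo_subgroup G :=
  [/\ G `<=` @homeomorphism Z Z,
      G idfun,
      forall f g, G f -> G g -> G (f \o g) &
      forall f g, G f -> inverse_homeos f g -> G g].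

Definition full_group G :=
  homeo_subgroup G /\
  forall g : Z -> Z, homeomorphism g ->
    (exists (n : nat) (U : 'I_n -> set Z) (g_ : 'I_n -> Z -> Z),
      [/\ partition [set: 'I_n] U [set: Z],
          forall i, clopen (U i),
          forall i, G (g_ i) &
          forall i x, U i x -> g x = g_ i x]) ->
    G g.

Definition locally_finite G :=
  forall F, finite_set F -> F `<=` G -> finite_set (smallest homeo_subgroup F).

Definition ample_group G :=
  [/\ full_group G, countable G, locally_finite G &
      forall g, G g -> clopen [set x | g x = x]].

Definition minimal_group G := forall x : Z, dense [set g x | g in G].

Definition clopen_equiv G A B := exists2 g, G g & g @` A = B.

End groups_of_homeomorphisms.

Definition isomorphic_clopen_relations (X : topologicalType)
    (G H : set (X -> X)) :=
  exists2 g : X -> X, homeomorphism g &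
    forall A B : set X, clopen A -> clopen B ->
      (clopen_equiv G A B <-> clopen_equiv H (g @` A) (g @` B)).

(* [g] is meant to be the inverse of [f]: this is the group f G f^-1. *)
Definition conj_group (Y Z : Type) (f : Y -> Z) (g : Z -> Y)
    (G : set (Y -> Y)) : set (Z -> Z) :=
  [set f \o u \o g | u in G].

Notation borelType X := (g_sigma_algebraType (@open X)).

Definition invariant_probability (R : realType) (X : ptopologicalType)
    (G : set (X -> X)) (mu : probability (borelType X) R) :=
  forall g, G g ->
    forall A : set (borelType X), measurable A -> mu (g @^-1` A) = mu A.

Definition thin (R : realType) (X : ptopologicalType) (G : set (X -> X))
    (K : set X) :=
  forall mu : probability (borelType X) R,
    invariant_probability G mu -> mu K = 0%E.

(* Here and below [K] is also used, via the coercion [set_type], as the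
   topological space {x : X | x \in K}; subsets of K are sets on this type. *)
Definition etale (X : topologicalType) (G : set (X -> X)) (K : set X) :=
  forall g, G g -> forall A : set K, clopen A ->
    clopen [set y : K | (g @` (set_val @` A)) (set_val y)].

Definition malleable (R : realType) (X : ptopologicalType) (G : set (X -> X))
    (K : set X) :=
  [/\ closed K, thin R G K & etale G K].

(* [insubd x y] is [y] seen as a point of [K] if [y \in K], and [x] otherwise. *)
Definition trace_map (X : topologicalType) (K : set X) (g : X -> X) : K -> K :=
  fun x => insubd x (g (set_val x)).

Arguments trace_map {X} K g _.

Definition trace_group (X : topologicalType) (G : set (X -> X)) (K : set X) :
    set (K -> K) :=
  smallest full_group [set trace_map K g | g in [set g | G g /\ involutive g]].

Arguments trace_group {X} G K _.

(* Main.v *)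
Require Import Defs.
From HB Require Import structures.
From mathcomp Require Import finmap.
From mathcomp Require Import all_boot all_order all_algebra.
From mathcomp Require Import all_classical all_reals all_analysis.

(* The conjugacy is the limit of a back-and-forth. An ample group is an
   increasing union of groups generated by unit systems (finite clopen partitions
   together with compatible homeomorphisms between equivalent atoms), encoded
   here by a retraction [r] onto a clopen base which is locally given by elements
   of the group. The two groups are pulled back to an intermediate copy of the
   Cantor space on which they share a unit system compatible with [h]; refining
   this system, or merging two atoms of the base by an element of one group, is
   done at the price of conjugating the other group by a homeomorphism that
   respects the current system, so that the successive corrections converge.

   A merge requires an element of the second group which sends one clopen set to
   another, extends the partial map prescribed by [h], and sends the rest of [L]
   away from [L]. It exists because cancellation holds for the relation on clopen
   sets (orbits of finite subgroups can be counted), and because a closed thin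
   set has neighbourhoods equivalent to parts of any given nonempty clopen set
   (otherwise an invariant measure would charge it). *)

Import Order.TTheory GRing.Theory Num.Theory numFieldNormedType.Exports.
Local Open Scope classical_set_scope.
Set Implicit Arguments.
Unset Strict Implicit.
Unset Printing Implicit Defensive.

(** A correction is a homeomorphism [u] that preserves every atom and commutes with [r]; conjugating
    one group by it keeps the tower for both. Since stabilizers decrease from stage to stage and
    atoms shrink on all three spaces, the composed corrections and their inverses are Cauchy. An
    element [g] is caught once some retraction satisfies [r (g x) = r x]: this survives in the
    limit, and a homeomorphism preserving the fibres of a map locally in the other group is locally
    in that group, hence in it by fullness. So images of group elements are recognized at the end
    rather than built.

    The obstacle is [K]: the trace groups control only germs along [K], yet each stage must keep
    [h x] in the atom of [x] and keep [r x = r y] equivalent to [r (h x) = r (h y)]. Refining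
    threatens the first condition, merging the second. Thinness gives the room for repairs, because
    the offending points of [L] can be pushed into small clopen sets. *)

Local Notation X := cantor_space.

(** * Cylinders of the Cantor space *)

Definition agree (N : nat) (x y : X) := forall i, (i < N)%N -> x i = y i.

Lemma agree_sym N x y : agree N x y -> agree N y x.
Proof. by move=> xy i iN; rewrite xy. Qed.

Lemma agree_trans N x y z : agree N x y -> agree N y z -> agree N x z.
Proof. by move=> xy yz i iN; rewrite xy ?yz. Qed.

Lemma agreeW M N x y : (M <= N)%N -> agree N x y -> agree M x y.
Proof. by move=> MN xy i iM; apply: xy; exact: leq_trans iM MN. Qed.

Lemma agree_all x y : (forall N, agree N x y) -> x = y.
Proof. by move=> xy; apply/funext => i; exact: (xy i.+1). Qed.

Lemma nbhs_agree N x : \forall y \near x, agree N x y.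
Proof.
elim: N => [|N IH]; first by apply: (@filterE X (nbhs x)) => y i.
have xN : nbhs x [set y : X | y N = x N].
  apply: (@proj_continuous nat (fun=> bool) N x [set x N]).
  by apply: open_nbhs_nbhs; split=> //; exact: discrete_open.
apply: (@filterS2 X (nbhs x) _ _ _ _ _ IH xN) => y xy yN i.
rewrite ltnS leq_eqVlt => /orP[/eqP->//|].
exact: xy.
Qed.

(** The product topology is a supremum of initial topologies, so the filter generated by the
    cylinders around [x] converges to [x] as soon as every coordinate does. *)
Lemma near_agree x (P : X -> Prop) :
  (\forall y \near x, P y) <-> exists N, forall y, agree N x y -> P y.
Proof.
split=> [|[N NP]]; last by apply: filterS NP _; exact: nbhs_agree.
pose F : set_system X := filter_from setT (fun N => [set y | agree N x y]).
have FF : ProperFilter F.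
  apply: filter_from_proper; last by move=> N _; exists x.
  apply: filter_from_filter; first by exists 0%N.
  move=> i j _ _; exists (maxn i j) => // y xy; split.
    exact: agreeW (leq_maxl _ _) xy.
  exact: agreeW (leq_maxr _ _) xy.
have Fx : F --> x.
  apply/cvg_sup => i; apply/cvg_image; first by apply/seteqP; split=> // b _; exists (fun=> b).
  move=> W /= Wx; exists [set y : X | W (y i)].
    exists i.+1 => // y /(_ i (ltnSn i)) /= <-; exact: nbhs_singleton.
  apply/seteqP; split=> [b [y /= Wy <-]//|b Wb]; by exists (fun=> b).
by move=> /Fx [N _ NP]; exists N.
Qed.

Lemma open_agree (A : set X) :
  open A <-> forall x, A x -> exists N, forall y, agree N x y -> A y.
Proof.
rewrite openE; split=> oA x Ax; first by apply/near_agree; exact: oA.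
by apply/near_agree; exact: oA.
Qed.

(** Compactness in its near-covering form, with the levels filtered by [\oo]. It replaces finite
    subcovers wherever one cylinder length has to serve all points. *)
Lemma uniform_level (P : nat -> X -> Prop) :
  (forall M N x, (M <= N)%N -> P M x -> P N x) ->
  (forall x, exists N, forall y, agree N x y -> P N y) ->
  exists N, forall x, P N x.
Proof.
move=> Pmono Ploc.
have /compact_near_coveringP := cantor_space_compact.
move=> /(_ nat \oo P _) [].
  move=> x _; have [N NP] := Ploc x.
  exists ([set y | agree N x y], [set m | (N <= m)%N]) => /=.
    split; first exact: nbhs_agree.
    by exists N.
  by move=> [y m] /= [xy Nm]; apply: Pmono Nm _; exact: NP.
by move=> N _ NP; exists N => x; apply: (NP N) => /=.
Qed.

Lemma continuous_agree (f : X -> X) :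
  continuous f <->
  forall x N, exists M, forall y, agree M x y -> agree N (f x) (f y).
Proof.
split=> [cf x N|cf x W /near_agree[N NW]].
  by apply/near_agree; apply: cf; exact: nbhs_agree.
by have [M Mf] := cf x N; apply/near_agree; exists M => y /Mf; exact: NW.
Qed.

Lemma clopen_agree (A : set X) :
  clopen A <-> exists N, forall x y, agree N x y -> A x -> A y.
Proof.
split=> [[/open_agree oA /closed_openC/open_agree oCA]|[N NA]].
  suff [N NP] : exists N, forall x, (fun N x => forall y, agree N x y -> A x -> A y) N x.
    by exists N => x y xy; apply: NP.
  apply: uniform_level => [M N x MN H y /(agreeW MN)|x]; first exact: H.
  have [Ax|nAx] := pselect (A x).
    have [N NA] := oA x Ax; exists N => y xy z yz _; apply: NA.
    exact: agree_trans xy yz.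
  by have [N NA] := oCA x nAx; exists N => y xy z yz Ay; have := NA y xy.
split; first by apply/open_agree => x Ax; exists N => y xy; exact: NA Ax.
rewrite -openC; apply/open_agree => x nAx; exists N => y /agree_sym xy Ay.
by apply: nAx; exact: NA Ay.
Qed.

Lemma clopen_preimage (Y Z : topologicalType) (f : Y -> Z) (A : set Z) :
  continuous f -> clopen A -> clopen (f @^-1` A).
Proof.
by move=> cf [oA cA]; split; [apply: open_comp|apply: closed_comp] => // x _; apply: cf.
Qed.

Section inverse_homeos.
Variables Y Z W : topologicalType.

Lemma inverse_homeos_sym (f : Y -> Z) g :
  inverse_homeos f g -> inverse_homeos g f.
Proof. by case. Qed.

Lemma inverse_homeos_comp (f : Y -> Z) f' (g : Z -> W) g' :
  inverse_homeos f f' -> inverse_homeos g g' ->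
  inverse_homeos (g \o f) (f' \o g').
Proof.
move=> [cf cf' fK f'K] [cg cg' gK g'K]; split.
- by move=> x; apply: continuous_comp; [exact: cf|exact: cg].
- by move=> x; apply: continuous_comp; [exact: cg'|exact: cf'].
- exact: can_comp.
- exact: can_comp.
Qed.

Lemma inverse_homeos_id : inverse_homeos (@id Y) id.
Proof. by split=> // x; exact: cvg_id. Qed.

Lemma inverse_homeos_uniq (f : Y -> Z) g g' :
  inverse_homeos f g -> inverse_homeos f g' -> g = g'.
Proof.
by move=> [_ _ _ gK] [_ _ fK' _]; apply/funext => x; rewrite -{2}(gK x) fK'.
Qed.

Lemma image_inverse (f : Y -> Z) g A :
  inverse_homeos f g -> f @` A = g @^-1` A.
Proof.
move=> [_ _ fK gK]; apply/seteqP; split=> [_ [x Ax <-]|x Ax] /=.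
  by rewrite fK.
by exists (g x).
Qed.

Lemma clopen_image (f : Y -> Z) g A :
  inverse_homeos f g -> clopen A -> clopen (f @` A).
Proof.
move=> fg cA; rewrite (image_inverse _ fg); apply: clopen_preimage cA.
by case: fg.
Qed.

Lemma closed_image (f : Y -> Z) g A :
  inverse_homeos f g -> closed A -> closed (f @` A).
Proof.
move=> fg cA; rewrite (image_inverse _ fg).
by apply: closed_comp => // x _; case: fg => _ cg _ _; apply: cg.
Qed.

End inverse_homeos.

(** * Groups of homeomorphisms described by germs *)

Definition locally_in (G : set (X -> X)) (r : X -> X) :=
  forall x, exists N, exists2 g, G g & forall y, agree N x y -> r y = g y.

(** Fullness stated by germs instead of finite clopen partitions; this form passes directly to
    conjugates. *)
Definition local_group (G : set (X -> X)) :=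
  homeo_subgroup G /\ (forall f, homeomorphism f -> locally_in G f -> G f).

Lemma uniformly_in (G : set (X -> X)) r :
  locally_in G r ->
  exists N, forall x, exists2 g, G g & forall y, agree N x y -> r y = g y.
Proof.
move=> rG; apply: uniform_level => [M N x MN [g Gg rg]|x].
  by exists g => // y /(agreeW MN); exact: rg.
have [N [g Gg rg]] := rG x; exists N => y xy; exists g => // z yz.
by apply: rg; exact: agree_trans xy yz.
Qed.

(** By compactness one length [N] serves all points, and the [2^N] cylinders of that length form the
    partition required by fullness. *)
Lemma full_local_group (G : set (X -> X)) : full_group G -> local_group G.
Proof.
move=> [Ggrp Gfull]; split=> // f fh /uniformly_in [N NG].
pose code (x : X) : N.-tuple bool := [tuple x i | i < N].
have codeP x y : code x = code y <-> agree N x y.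
  split=> [/eqP|xy]; last first.
    by apply/eq_from_tnth => i; rewrite !tnth_mktuple; apply: xy.
  move=> /eqP xy i iN; have := congr1 (fun t => tnth t (Ordinal iN)) xy.
  by rewrite !tnth_mktuple.
pose x_ (i : 'I_#|{: N.-tuple bool}|) : X := nth false (enum_val i).
have codeK i : code (x_ i) = enum_val i.
  by apply/eq_from_tnth => j; rewrite !tnth_mktuple /x_ (tnth_nth false).
have /choice[g_ g_P] : forall i, exists g, G g /\ forall y, agree N (x_ i) y -> f y = g y.
  by move=> i; have [g Gg fg] := NG (x_ i); exists g.
apply: Gfull => //.
exists #|{: N.-tuple bool}|, (fun i => [set x | code x = enum_val i]), g_; split.
- split=> [|i j _ _ [x [/= -> /enum_val_inj//]]|i _]; last by exists (x_ i) => /=.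
  apply/seteqP; split=> // x _; exists (enum_rank (code x)) => //=.
  by rewrite enum_rankK.
- move=> i; apply/clopen_agree; exists N => x y /= /codeP <- //.
- by move=> i; case: (g_P i).
- move=> i x /= xi; have [_] := g_P i; apply; apply/codeP.
  by rewrite codeK.
Qed.

Lemma group_inv (G : set (X -> X)) g :
  homeo_subgroup G -> G g -> exists2 g', G g' & inverse_homeos g g'.
Proof.
move=> [Gh _ _ Ginv] Gg; have [g' gg'] := Gh _ Gg.
by exists g' => //; exact: Ginv gg'.
Qed.

Lemma locally_in_continuous (G : set (X -> X)) r :
  homeo_subgroup G -> locally_in G r -> continuous r.
Proof.
move=> Ggrp rG; apply/continuous_agree => x N; have [M [h Gh rh]] := rG x.
have [h' _ [/continuous_agree ch _ _ _]] := group_inv Ggrp Gh.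
have [M' M'h] := ch x N; exists (maxn M M') => y xy.
rewrite (rh x) ?(rh y) //; first by apply: M'h; exact: agreeW (leq_maxr _ _) xy.
exact: agreeW (leq_maxl _ _) xy.
Qed.

Section clopen_equiv.
Variables (G : set (X -> X)) (Ggrp : homeo_subgroup G).

Lemma clopen_equiv_refl A : clopen_equiv G A A.
Proof. by exists idfun; [case: Ggrp|rewrite image_id]. Qed.

Lemma clopen_equiv_sym A B : clopen_equiv G A B -> clopen_equiv G B A.
Proof.
move=> [g Gg <-]; have [g' Gg' gg'] := group_inv Ggrp Gg.
exists g' => //; rewrite (image_inverse _ (inverse_homeos_sym gg')).
by apply/funext => x; rewrite (image_inverse _ gg') /preimage /=; case: gg' => _ _ ->.
Qed.

Lemma clopen_equiv_trans A B C :
  clopen_equiv G A B -> clopen_equiv G B C -> clopen_equiv G A C.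
Proof.
move=> [g Gg <-] [k Gk <-]; exists (k \o g); last by rewrite image_comp.
by case: Ggrp => _ _ + _; apply.
Qed.

Lemma clopen_equiv_clopen A B : clopen_equiv G A B -> clopen A -> clopen B.
Proof.
by move=> [g Gg <-]; have [g' _ gg'] := group_inv Ggrp Gg; exact: (clopen_image gg').
Qed.

Lemma clopen_equiv_setC A B : clopen_equiv G A B -> clopen_equiv G (~` A) (~` B).
Proof.
move=> [g Gg <-]; have [g' _ gg'] := group_inv Ggrp Gg.
by exists g => //; rewrite !(image_inverse _ gg').
Qed.

End clopen_equiv.

Lemma clopen_D (A B : set X) : clopen A -> clopen B -> clopen (A `\` B).
Proof. by move=> cA cB; rewrite setDE; apply: clopenI => //; exact: clopenC. Qed.

(** * Counting points in orbits of finite groups *)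

Lemma swap (G : set (X -> X)) g C :
  local_group G -> G g -> clopen C -> C `&` g @` C = set0 ->
  exists t, [/\ G t, involutive t, forall x, C x -> t x = g x,
    forall x, (g @` C) x -> C (t x) & forall x, ~ C x -> ~ (g @` C) x -> t x = x].
Proof.
move=> [Ggrp Gloc] Gg cC; have [k Gk gk] := group_inv Ggrp Gg.
rewrite (image_inverse _ gk) => CgC.
have CgCP x : C x -> C (k x) -> (set0 x).
  by move=> Cx Ckx; rewrite -CgC.
pose t x := if pselect (C x) then g x else if pselect (C (k x)) then k x else x.
have tC x : C x -> t x = g x by rewrite /t; case: pselect.
have tgC x : C (k x) -> t x = k x.
  by move=> Ckx; rewrite /t; case: pselect => [Cx|nCx]; [case: (CgCP _ Cx Ckx)|case: pselect].
have tN x : ~ C x -> ~ C (k x) -> t x = x.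
  by rewrite /t; case: pselect => // ?; case: pselect.
have [_ ck gK kK] := gk.
have tt : involutive t.
  move=> x; have [Cx|nCx] := pselect (C x).
    by rewrite (tC x)// tgC ?gK.
  have [Ckx|nCkx] := pselect (C (k x)); first by rewrite (tgC x)// tC// kK.
  by rewrite (tN x)// tN.
have tloc : locally_in G t.
  have /clopen_agree[N NC] := cC.
  have /clopen_agree[M MC] : clopen (k @^-1` C) by exact: clopen_preimage.
  move=> x; exists (maxn N M).
  have CE y : agree (maxn N M) x y -> C y <-> C x.
    by move=> /(agreeW (leq_maxl _ _)) xy; split; apply: NC => //; apply: agree_sym.
  have CkE y : agree (maxn N M) x y -> C (k y) <-> C (k x).
    by move=> /(agreeW (leq_maxr _ _)) xy; split; apply: MC => //; apply: agree_sym.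
  have [Cx|nCx] := pselect (C x).
    by exists g => // y xy; rewrite tC//; apply/(CE y xy).
  have [Ckx|nCkx] := pselect (C (k x)).
    by exists k => // y xy; rewrite tgC//; apply/(CkE y xy).
  exists idfun; first by case: Ggrp.
  by move=> y xy; rewrite tN// => [/(CE y xy)|/(CkE y xy)].
have ct := locally_in_continuous Ggrp tloc.
exists t; split=> // [|x Ckx]; last by rewrite tgC.
by apply: Gloc => //; exists t; split.
Qed.

Definition nb (S : set X) : nat := #|` fset_set S|.

Lemma nb_image (f : X -> X) S : injective f -> finite_set S -> nb (f @` S) = nb S.
Proof. by move=> f_inj fS; rewrite /nb fset_set_image// card_imfset. Qed.

Lemma nb_sub S T : S `<=` T -> finite_set T -> (nb S <= nb T)%N.
Proof.
move=> ST fT; apply: fsubset_leq_card; rewrite -fset_set_sub//.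
exact: sub_finite_set ST fT.
Qed.

Lemma nbU S T : finite_set S -> finite_set T -> S `&` T = set0 ->
  nb (S `|` T) = (nb S + nb T)%N.
Proof.
move=> fS fT ST; rewrite /nb fset_setU// cardfsU -fset_setI// ST fset_set0.
by rewrite cardfs0 subn0.
Qed.

Lemma nb_set1 x : nb [set x] = 1%N.
Proof. by rewrite /nb fset_set1 cardfs1. Qed.

Definition orbit (G : set (X -> X)) x := [set g x | g in G].

Lemma orbit_trans (G : set (X -> X)) x y z : homeo_subgroup G ->
  orbit G x y -> orbit G y z -> orbit G x z.
Proof.
move=> [_ _ Gc _] [g Gg <-] [k Gk <-]; exists (k \o g) => //; exact: Gc.
Qed.

Lemma orbit_sym (G : set (X -> X)) x y : homeo_subgroup G ->
  orbit G x y -> orbit G y x.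
Proof.
move=> Ggrp [g Gg <-]; have [k Gk [_ _ gK _]] := group_inv Ggrp Gg.
by exists k.
Qed.

Section counting.
Variables (G G0 : set (X -> X)).
Hypotheses (Gloc : local_group G) (G0grp : homeo_subgroup G0)
  (G0G : G0 `<=` G) (G0fin : finite_set G0).

Lemma orbit_finite x S : finite_set (orbit G0 x `&` S).
Proof. by apply: finite_setIl; exact: finite_image. Qed.

(** A bijection that moves points inside their [G0]-orbits permutes each of these finite orbits.
    Taking [g] in [G] admits maps patched from several elements of [G0]. *)
Lemma orbit_image g x S : G g -> (forall y, orbit G0 y (g y)) ->
  nb (orbit G0 x `&` g @` S) = nb (orbit G0 x `&` S).
Proof.
move=> Gg gorb; have [k Gk gk] := group_inv Gloc.1 Gg.
rewrite -(@nb_image g (orbit G0 x `&` S)); last 2 first.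
  - by case: gk => _ _ gK _; exact: can_inj gK.
  - exact: orbit_finite.
congr nb; apply/seteqP; split=> [z [xz [y Sy yz]]|_ [y [xy Sy] <-]].
  exists y => //; split=> //; apply: (orbit_trans G0grp xz); rewrite -yz.
  exact/orbit_sym.
split; last by exists y.
exact: (orbit_trans G0grp xy).
Qed.

(* Each step swaps by [g] the part of the current image of [A] outside [B]
   that [g] sends into [B] minus that image. *)
Lemma greedy_transport A B (l : seq (X -> X)) : clopen A -> clopen B ->
  {in l, forall g, G0 g} ->
  exists s, [/\ G s, forall x, orbit G0 x (s x) &
    forall g x, g \in l -> (s @` A) x -> ~ B x -> B (g x) -> (s @` A) (g x)].
Proof.
move=> cA cB; elim: l => [_|g l IH lG0].
  exists idfun; split=> [|x|g x]; [by case: Gloc.1| |by []].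
  by exists idfun => //; case: G0grp.
have [|s [Gs sorb sl]] := IH; first by move=> k kl; apply: lG0; rewrite inE kl orbT.
have G0g : G0 g by apply: lG0; rewrite inE eqxx.
have Gg := G0G G0g.
have [k Gk gk] := group_inv Gloc.1 Gg.
have [s' Gs' ss'] := group_inv Gloc.1 Gs.
have [_ ck gK kK] := gk; have [cg _ _ _] := gk.
pose A1 := s @` A; pose C := (A1 `\` B) `&` g @^-1` (B `\` A1).
have cA1 : clopen A1 by exact: clopen_image ss' cA.
have cC : clopen C.
  by apply: clopenI; [exact: clopen_D|apply: clopen_preimage => //; exact: clopen_D].
have CgC : C `&` g @` C = set0.
  rewrite (image_inverse _ gk) -subset0 => x [[[_ nBx] _] [_ [+ _]]].
  by rewrite kK.
have [t [Gt tt tC tgC tN]] := swap Gloc Gg cC CgC.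
have torb x : orbit G0 x (t x).
  have [Cx|nCx] := pselect (C x); first by rewrite tC//; exists g.
  have [gCx|ngCx] := pselect ((g @` C) x); last first.
    by rewrite tN//; exists idfun => //; case: G0grp.
  apply: orbit_sym => //; exists g => //; rewrite -tC ?tt//; exact: tgC.
have tA1 x : (t @` A1) x <-> (A1 x /\ ~ C x) \/ (g @` C) x.
  split=> [[y A1y <-]|].
    have [Cy|nCy] := pselect (C y); first by rewrite tC//; right; exists y.
    have [gCy|ngCy] := pselect ((g @` C) y).
      by case: gCy A1y => z [_ [_ nA1]] <-.
    by rewrite tN//; left.
  move=> [[A1x nCx]|[z Cz <-]]; last by exists z; [case: Cz => [[]]|rewrite tC].
  exists x => //; rewrite tN// => -[z [_ [_ nA1]]] zx; apply: nA1.
  by rewrite zx.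
exists (t \o s); split.
- by case: Gloc.1 => _ _ + _; apply.
- move=> x; exact: (orbit_trans G0grp (sorb x)).
- rewrite -image_comp => g1 x; rewrite -[s @` A]/A1 inE => g1l /tA1 tA1x nBx Bgx.
  apply/tA1; case: tA1x => [[A1x nCx]|[z [_ [Bgz _]] gzx]]; last first.
    by case: nBx; rewrite -gzx.
  have [A1gx|nA1gx] := pselect (A1 (g1 x)).
    by left; split=> // -[[]].
  move: g1l => /orP[/eqP g1g|g1l]; last by case: nA1gx; exact: sl.
  by case: nCx; rewrite g1g in nA1gx Bgx.
Qed.

(** Once the greedy process has run through all of [G0], a point [x] of the image of [A] outside [B]
    has no free place of [B] left in its orbit. The image then contains every point of [B] in that
    orbit and [x] besides, against the inequality. *)
Lemma count_le A B : clopen A -> clopen B ->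
  (forall x, (nb (orbit G0 x `&` A) <= nb (orbit G0 x `&` B))%N) ->
  exists s, [/\ G s, forall x, orbit G0 x (s x) & s @` A `<=` B].
Proof.
move=> cA cB AB; have /finite_seqP[l lG0] := G0fin.
have [|s [Gs sorb sl]] := @greedy_transport A B l cA cB.
  by move=> g; rewrite lG0.
exists s; split=> // x A1x; apply: contrapT => nBx.
have := AB x; rewrite -(orbit_image x A Gs sorb) leqNgt => /negP; apply.
have xx : orbit G0 x x by exists idfun => //; case: G0grp.
have sub : orbit G0 x `&` B `<=` (orbit G0 x `&` s @` A) `\ x.
  move=> y [[g G0g <-] Bgx]; split; first split.
  - by exists g.
  - by apply: sl => //; move: G0g; rewrite lG0.
  - by move=> gx; apply: nBx; rewrite -gx.
apply: (@leq_ltn_trans (nb ((orbit G0 x `&` s @` A) `\ x))).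
  by apply: nb_sub => //; apply: finite_setD; exact: orbit_finite.
set T := _ `&` _.
have fT : finite_set (T `\ x) by apply: finite_setD; exact: orbit_finite.
rewrite -[in ltnRHS](@setD1K _ x T); last by split.
rewrite nbU ?nb_set1 ?add1n//.
by rewrite setDE setICA setICr setI0.
Qed.

Lemma count_eq A B : clopen A -> clopen B ->
  (forall x, nb (orbit G0 x `&` A) = nb (orbit G0 x `&` B)) ->
  clopen_equiv G A B.
Proof.
move=> cA cB AB; have [|s [Gs sorb sAB]] := count_le cA cB.
  by move=> x; rewrite AB.
exists s => //; apply/seteqP; split=> // x Bx; apply: contrapT => nAx.
have := AB x; rewrite -(orbit_image x A Gs sorb) => e.
have xx : orbit G0 x x by exists idfun => //; case: G0grp.
have : (nb ((orbit G0 x `&` s @` A) `|` [set x]) <= nb (orbit G0 x `&` B))%N.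
  apply: nb_sub; last exact: orbit_finite.
  by move=> y [[xy Ay]|->//]; split=> //; exact: sAB.
rewrite nbU ?nb_set1 ?e ?addn1 ?ltnn//; first exact: orbit_finite.
by rewrite -subset0 => y [[_ sAy] yx]; apply: nAx; rewrite -yx.
Qed.

End counting.

(** Subtraction in the type semigroup of clopen sets. As a property of the relation alone, it passes
    to any group inducing the same relation, as in [matched_sym]. *)
Definition cancellative (G : set (X -> X)) :=
  forall P Q A B, clopen A -> clopen P -> A `<=` P -> B `<=` Q ->
  clopen_equiv G P Q -> clopen_equiv G A B -> clopen_equiv G (P `\` A) (Q `\` B).

Lemma smallest_subgroup (G F : set (X -> X)) :
  homeo_subgroup G -> F `<=` G ->
  [/\ homeo_subgroup (smallest homeo_subgroup F), F `<=` smallest homeo_subgroup F &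
      smallest homeo_subgroup F `<=` G].
Proof.
move=> Ggrp FG; split; last 2 first.
- exact: sub_gen_smallest.
- by apply: smallest_sub.
split.
- by move=> g Fg; case: (Ggrp) => + _ _ _; apply; apply: Fg.
- by move=> M [[_ + _ _] _].
- by move=> f g Ff Fg M MF; case: (MF) => -[_ _ Mc _] _; apply: Mc; [exact: Ff|exact: Fg].
- by move=> f g Ff fg M MF; case: (MF) => -[_ _ _ Mi] _; apply: Mi fg; exact: Ff.
Qed.

Lemma nb_orbitD (G0 : set (X -> X)) x (P A : set X) : finite_set G0 -> A `<=` P ->
  nb (orbit G0 x `&` (P `\` A)) = (nb (orbit G0 x `&` P) - nb (orbit G0 x `&` A))%N.
Proof.
move=> G0fin AP.
have -> : orbit G0 x `&` P = (orbit G0 x `&` (P `\` A)) `|` (orbit G0 x `&` A).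
  by rewrite -setIUr (setUC (P `\` A)) setDUK.
rewrite nbU ?addnK//; try exact: orbit_finite.
by rewrite -subset0 => y [[_ [_ nAy]] [_ Ay]].
Qed.

(** The two witnesses [g] and [k] generate a finite group, by local finiteness, and preserve its
    orbits. On each orbit [P] and [Q], and likewise [A] and [B], have equally many points; the
    counts can be subtracted. *)
Lemma ample_cancellative (G : set (X -> X)) : ample_group G -> cancellative G.
Proof.
move=> [Gfull _ Gfin _] P Q A B cA cP AP BQ [g Gg gPQ] [k Gk kAB].
have Gloc := full_local_group Gfull.
pose F : set (X -> X) := [set g] `|` [set k].
have FG : F `<=` G by move=> _ [->|->].
have [G0grp FG0 G0G] := smallest_subgroup Gloc.1 FG.
set G0 := smallest homeo_subgroup F in G0grp FG0 G0G.
have G0fin : finite_set G0 by apply: Gfin => //; rewrite finite_setU; split; exact: finite_set1.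
have gorb x : orbit G0 x (g x) by exists g => //; apply: FG0; left.
have korb x : orbit G0 x (k x) by exists k => //; apply: FG0; right.
have cB : clopen B by apply: (clopen_equiv_clopen Gloc.1 _ cA); exists k.
have cQ : clopen Q by apply: (clopen_equiv_clopen Gloc.1 _ cP); exists g.
apply: (count_eq Gloc G0grp G0G G0fin); try exact: clopen_D.
move=> x; rewrite !nb_orbitD// -gPQ -kAB.
by rewrite !(orbit_image Gloc G0grp G0fin).
Qed.

(** * Thin sets are small *)

(* An alias of the Cantor space whose measurable sets are the clopen sets, so
   that Caratheodory's extension applies to contents on clopen sets. *)
Definition clopen_algebra : Type := X.

HB.instance Definition _ := Pointed.on clopen_algebra.

Definition clopen_display : measure_display.
Proof. exact: (sigma_display (@clopen X)). Qed.

Lemma clopen_setC_closed : setC_closed (@clopen X).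
Proof. by move=> A; exact: clopenC. Qed.

Lemma clopen_setU_closed : setU_closed (@clopen X).
Proof. by move=> A B; exact: clopenU. Qed.

HB.instance Definition _ := @isAlgebraOfSets.Build clopen_display
  clopen_algebra (@clopen X) (@clopen0 X) clopen_setU_closed clopen_setC_closed.

Lemma borel_clopen : <<s @clopen X >> = <<s @open X >>.
Proof.
apply/seteqP; split.
  by apply: sub_smallest2r; [exact: smallest_sigma_algebra|move=> A []].
apply: smallest_sub; first exact: smallest_sigma_algebra.
move=> A oA.
have -> : A = \bigcup_N [set x | forall y, agree N x y -> A y].
  apply/seteqP; split=> x; last by move=> [N _]; apply.
  by move: oA => /open_agree/[apply] -[N NA]; exists N.
apply: sigma_algebra_bigcup => N; apply: sub_sigma_algebra.
apply/clopen_agree; exists N => x y xy xA z yz; apply: xA.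
exact: agree_trans xy yz.
Qed.

Section probability_of_clopen_content.
Variables (R : realType) (m : set X -> R).
Hypotheses (m_setT : m setT = 1%R) (m_ge0 : forall A, (0 <= m A)%R)
  (m_additive : forall A B, A `&` B = set0 -> m (A `|` B) = (m A + m B)%R).

Let content (A : set clopen_algebra) : \bar R := (m A)%:E.

Let m0 : m set0 = 0%R.
Proof.
by apply/eqP; rewrite -(inj_eq (addrI (m set0))) -m_additive ?set0U ?addr0// setI0.
Qed.

Let content0 : content set0 = 0%E.
Proof. by rewrite /content m0. Qed.

Let content_ge0 A : (0 <= content A)%E.
Proof. by rewrite lee_fin. Qed.

Let content_sigma_additive : semi_sigma_additive content.
Proof.
move=> F cF tF cUF.
(* A clopen union of clopen sets is compact, so finitely many of them cover it and the partial sums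
   are eventually constant. *)
have [n0 UFn0] : exists N, forall x, (\bigcup_n F n) x -> exists2 i, (i < N)%N & F i x.
  apply: (@uniform_level (fun N x => (\bigcup_n F n) x -> exists2 i, (i < N)%N & F i x)).
    move=> M N x MN h /h[i iM Fi]; exists i => //; exact: leq_trans MN.
  move=> x; have [[i _ Fi]|nUF] := pselect ((\bigcup_n F n) x).
    have /clopen_agree[N FN] := cF i.
    exists (maxn N i.+1) => y /(agreeW (leq_maxl _ _)) xy _.
    by exists i; [exact: leq_maxr|exact: FN xy Fi].
  have /clopen_agree[N UFN] := cUF.
  by exists N => y xy UFy; case: nUF; exact: UFN (agree_sym xy) UFy.
have sumE n : (\sum_(0 <= i < n) content (F i) = (m (\bigcup_(i < n) F i))%:E)%E.
  elim: n => [|n IH]; first by rewrite big_geq// bigcup_mkord big_ord0 m0.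
  rewrite big_nat_recr//= IH /content -EFinD -m_additive ?bigcup_mkord ?big_ord_recr//=.
  rewrite -bigcup_mkord -subset0 => x [[i /= iN Fi] Fn].
  by move: iN; rewrite (tF i n) ?ltnn//; exists x.
apply: cvg_near_cst; exists n0 => // n /= n0n.
rewrite sumE /content; congr (m _)%:E; apply/seteqP; split=> x.
  by case=> i _ Fi; exists i.
by move=> /UFn0[i iN Fi]; exists i => //=; exact: leq_trans n0n.
Qed.

HB.instance Definition _ := isMeasure.Build _ _ _ content
  content0 content_ge0 content_sigma_additive.

(** Caratheodory's extension is a measure on the sigma-algebra generated by the clopen sets; through
    [borel_clopen] the same function is read on the Borel sets. *)
Let nu (A : set (borelType X)) : \bar R := measure_extension content A.

Let nu0 : nu set0 = 0%E.
Proof. by rewrite /nu measure0. Qed.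

Let nu_ge0 A : (0 <= nu A)%E.
Proof. by rewrite /nu measure_ge0. Qed.

Let nu_sigma_additive : semi_sigma_additive nu.
Proof.
move=> F mF tF mUF.
have mE (A : set X) : <<s @open X >> A -> <<s @clopen X >> A by rewrite borel_clopen.
by apply: (@measure_semi_sigma_additive _ _ _ (measure_extension content)) => // [i|];
  apply: mE; [exact: mF|exact: mUF].
Qed.

HB.instance Definition _ := isMeasure.Build _ _ _ nu nu0 nu_ge0 nu_sigma_additive.

Let nuE A : clopen A -> nu A = (m A)%:E.
Proof. by move=> cA; rewrite /nu /measure_extension measurable_mu_extE. Qed.

Let nu_setT : nu setT = 1%E.
Proof. by rewrite nuE ?m_setT//; exact: clopenT. Qed.

HB.instance Definition _ := Measure_isProbability.Build _ _ _ nu nu_setT.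

Lemma probability_of_clopen_content :
  exists mu : probability (borelType X) R, forall A, clopen A -> mu A = (m A)%:E.
Proof. by exists nu. Qed.

End probability_of_clopen_content.

Lemma finite_net N : exists s : seq X, forall x, exists2 y, y \in s & agree N y x.
Proof.
exists [seq (nth false (t : N.-tuple bool) : X) | t : N.-tuple bool] => x.
exists (nth false [tuple x i | i < N] : X); first by apply: map_f; rewrite mem_enum.
by move=> i iN; rewrite -(tnth_nth false _ (Ordinal iN)) tnth_mktuple.
Qed.

Lemma finite_choice (T : eqType) (G : set T) (Q : T -> X -> Prop) N :
  (forall x, exists2 g, G g & forall y, agree N x y -> Q g y) ->
  exists l : seq T, {in l, forall g, G g} /\ forall y, exists2 g, g \in l & Q g y.
Proof.
move=> GQ; have [s sN] := finite_net N.
have /choice[f fP] : forall x, exists g, G g /\ forall y, agree N x y -> Q g y.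
  by move=> x; have [g Gg gQ] := GQ x; exists g.
exists [seq f x | x <- s]; split=> [_ /mapP[x _ ->]|y]; first by case: (fP x).
have [x xs xy] := sN y; exists (f x); first exact: map_f.
by have [_] := fP x; apply.
Qed.

Lemma ultralimit (R : realType) (U : set_system nat) (f : nat -> R) :
  UltraFilter U -> (forall n, (0 <= f n <= 1)%R) -> exists l : R, f @ U --> l.
Proof.
move=> UU f01.
have [|l [_ fl]] := @segment_compact R 0%R 1%R (f @ U).
  by apply: (@filterE _ U) => n; rewrite /= in_itv /=.
exists l => B Bl; have [//|nB] := in_ultra_setVsetC (f @^-1` B) UU.
by have [y []] := fl (~` B) B nB Bl.
Qed.

(** The measure-free consequence of thinness on which all later avoidance arguments rely. *)
Definition small (G : set (X -> X)) (K : set X) :=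
  forall A, clopen A -> A !=set0 ->
  exists V, [/\ clopen V, K `<=` V & exists2 B, B `<=` A & clopen_equiv G V B].

Lemma measurable_homeo (g : X -> X) : continuous g ->
  measurable_fun setT (g : borelType X -> borelType X).
Proof.
move=> cg; apply: (@measurability _ _ (borelType X) (borelType X) setT g (@open X)) => // _ [A oA <-].
rewrite setTI; apply: sub_sigma_algebra; apply: open_comp => // x _; exact: cg.
Qed.

Lemma invariant_on_clopen (R : realType) (G : set (X -> X))
    (mu : probability (borelType X) R) : homeo_subgroup G ->
  (forall g A, G g -> clopen A -> mu (g @^-1` A) = mu A) ->
  invariant_probability G mu.
Proof.
move=> Ggrp muG g Gg A mA; have [k _ [cg _ _ _]] := group_inv Ggrp Gg.
pose mu' := pushforward mu (g : borelType X -> borelType X).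
pose f : {mfun borelType X >-> borelType X} :=
  HB.pack (g : borelType X -> borelType X) (isMeasurableFun.Build _ _ _ _ _ (measurable_homeo cg)).
have nu_clopen A0 : clopen A0 -> pushforward mu f A0 = mu A0 by exact: muG.
apply: (@measure_unique _ R (borelType X) (@clopen X) (fun=> setT) _ _ _ _ (pushforward mu f) mu) => //.
- by rewrite borel_clopen.
- by move=> B C; exact: clopenI.
- by move=> _; exact: clopenT.
- by rewrite bigcup_const.
- by move=> _; rewrite [X in (X < _)%E]nu_clopen ?probability_setT ?ltry//; exact: clopenT.
Qed.

Lemma countable_enum (T : Type) (G : set T) g0 : G g0 -> countable G ->
  exists e : nat -> T, (forall n, G (e n)) /\ forall g, G g -> exists n, e n = g.
Proof.
move=> Gg0 /countable_injP[f f_inj].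
have /choice[e eP] : forall n, exists g, G g /\ forall k, G k -> f k = n -> k = g.
  move=> n; have [[g [Gg fg]]|nG] := pselect (exists g, G g /\ f g = n).
    by exists g; split=> // k Gk fk; apply: f_inj; rewrite ?inE// fg.
  by exists g0; split=> // k Gk fk; case: nG; exists k.
exists e; split=> [n|g Gg]; first by case: (eP n).
by exists (f g); have [_ /(_ g Gg erefl)] := eP (f g).
Qed.

Lemma nb_setU_le S T : finite_set S -> finite_set T ->
  (nb (S `|` T) <= nb S + nb T)%N.
Proof. by move=> fS fT; rewrite /nb fset_setU// cardfsU leq_subr. Qed.

(** Each point of the orbit is sent into [A] by some [g] in [l], and for each [g] the orbit has as
    many points sent into [A] as it has in [A]. So [A] fills at least the fraction [1 / size l] of
    every orbit. *)
Lemma nb_orbit_cover (G G0 : set (X -> X)) (A : set X) x (l : seq (X -> X)) :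
  local_group G -> homeo_subgroup G0 -> G0 `<=` G -> finite_set G0 ->
  {in l, forall g, G0 g} -> (forall y, exists2 g, g \in l & A (g y)) ->
  (nb (orbit G0 x `&` setT) <= size l * nb (orbit G0 x `&` A))%N.
Proof.
move=> Gloc G0grp G0G G0fin lG0 lA.
have -> : orbit G0 x `&` setT = orbit G0 x `&` [set y | exists2 g, g \in l & A (g y)].
  by congr (_ `&` _); apply/seteqP; split=> y // _; exact: lA.
elim: l lG0 {lA} => [_|g l IH lG0].
  rewrite (_ : [set y | _] = set0) ?setI0 /nb ?fset_set0//.
  by rewrite -subset0 => y [].
rewrite (_ : [set y | _] = g @^-1` A `|` [set y | exists2 g, g \in l & A (g y)]).
  have /IH IHl : {in l, forall g, G0 g} by move=> k kl; apply: lG0; rewrite inE kl orbT.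
  have G0g : G0 g by apply: lG0; rewrite inE eqxx.
  rewrite setIUr; apply: leq_trans (nb_setU_le _ _) _; try exact: orbit_finite.
  rewrite mulSn leq_add// -(@orbit_image G G0 Gloc G0grp G0fin g) ?nb_sub//.
  - by apply: setIS; exact: image_preimage_subset.
  - exact: orbit_finite.
  - exact: G0G.
  - by move=> y; exists g.
apply/seteqP; split=> [y [k]|y [Agy|[k kl Aky]]].
- by rewrite inE => /orP[/eqP->|kl Aky]; [left|right; exists k].
- by exists g; rewrite ?inE ?eqxx.
- by exists k; rewrite // inE kl orbT.
Qed.

Lemma minimal_cover (G : set (X -> X)) (A : set X) :
  homeo_subgroup G -> minimal_group G -> clopen A -> A !=set0 ->
  exists l : seq (X -> X), {in l, forall g, G g} /\
    forall y, exists2 g, g \in l & A (g y).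
Proof.
move=> Ggrp Gmin cA A0.
have [N NG] : exists N, forall x, exists2 g, G g & forall y, agree N x y -> A (g y).
  apply: uniform_level => [M N x MN [g Gg Ag]|x].
    by exists g => // y /(agreeW MN); exact: Ag.
  have [z [Agx [g Gg gx]]] := Gmin x A A0 cA.1; rewrite -gx in Agx.
  have [k _ [cg _ _ _]] := group_inv Ggrp Gg.
  have /clopen_agree[N NA] : clopen (g @^-1` A) by exact: clopen_preimage.
  exists N => y xy; exists g => // w yw.
  by apply: NA Agx; exact: agree_trans xy yw.
exact: finite_choice NG.
Qed.

Section orbit_frequency.
Variables (R : realType) (U : set_system nat) (O : nat -> set X).
Hypotheses (UU : UltraFilter U) (Ofin : forall n, finite_set (O n))
  (O0 : forall n, O n !=set0).

Let freq (A : set X) n : R := ((nb (O n `&` A))%:R / (nb (O n))%:R)%R.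

Let nbO_gt0 n : (0 < (nb (O n))%:R :> R)%R.
Proof.
rewrite ltr0n; have [x Ox] := O0 n.
apply: (@leq_trans (nb [set x])); first by rewrite nb_set1.
by apply: nb_sub => // _ ->.
Qed.

Let freq_cvg A : exists l : R, freq A @ U --> l.
Proof.
apply: ultralimit => n; rewrite /freq divr_ge0 ?ler0n//= ler_pdivrMr// mul1r ler_nat.
by apply: nb_sub => // x [].
Qed.

(** The limit of the uniform measures on the finite sets [O n]. Along an ultrafilter it exists for
    all sets at once, which replaces a diagonal extraction. *)
Definition orbit_frequency (A : set X) : R := lim (freq A @ U).

Lemma orbit_frequencyE A : freq A @ U --> orbit_frequency A.
Proof. by have [l ul] := freq_cvg A; rewrite /orbit_frequency (cvg_lim _ ul). Qed.

Lemma orbit_frequency_setT : orbit_frequency setT = 1%R.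
Proof.
rewrite /orbit_frequency (_ : freq setT = fun=> 1%R) ?lim_cst//.
by apply/funext => n; rewrite /freq setIT divff// gt_eqF.
Qed.

Lemma orbit_frequency_ge A c :
  (\forall n \near U, c * (nb (O n))%:R <= (nb (O n `&` A))%:R)%R ->
  (c <= orbit_frequency A)%R.
Proof.
move=> cA; rewrite /orbit_frequency; apply: limr_ge.
  by apply/cvg_ex; exact: freq_cvg.
by apply: filterS cA => n; rewrite /freq ler_pdivlMr.
Qed.

Lemma orbit_frequency_ge0 A : (0 <= orbit_frequency A)%R.
Proof. by apply: orbit_frequency_ge; apply: filterE => n; rewrite mul0r ler0n. Qed.

Lemma orbit_frequency_additive A B : A `&` B = set0 ->
  orbit_frequency (A `|` B) = (orbit_frequency A + orbit_frequency B)%R.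
Proof.
move=> AB; rewrite {1}/orbit_frequency; apply: (cvg_lim (@Rhausdorff R)).
rewrite (_ : freq (A `|` B) = (freq A + freq B)%R).
  by apply: cvgD; exact: orbit_frequencyE.
apply/funext => n; rewrite -[RHS]/(freq A n + freq B n)%R /freq -mulrDl -natrD.
rewrite -nbU ?setIUr//.
- by apply: finite_setIl.
- by apply: finite_setIl.
- by rewrite setIACA AB setI0.
Qed.

Lemma eq_orbit_frequency A B :
  (\forall n \near U, nb (O n `&` A) = nb (O n `&` B)) ->
  orbit_frequency A = orbit_frequency B.
Proof.
move=> AB; rewrite {1}/orbit_frequency; apply: (cvg_lim (@Rhausdorff R)).
apply: cvg_trans (@orbit_frequencyE B).
by apply: near_eq_cvg; apply: filterS AB => n; rewrite /freq => ->.
Qed.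

End orbit_frequency.

Lemma ample_exhaustion (G : set (X -> X)) : ample_group G ->
  exists G_ : nat -> set (X -> X),
    [/\ forall n, [/\ homeo_subgroup (G_ n), G_ n `<=` G & finite_set (G_ n)],
        forall m n, (m <= n)%N -> G_ m `<=` G_ n &
        forall g, G g -> exists n, G_ n g].
Proof.
move=> [[Ggrp _] Gcnt Gfin _].
have [e [Ge eG]] : exists e : nat -> X -> X, (forall n, G (e n)) /\ forall g, G g -> exists n, e n = g.
  by apply: (countable_enum (g0 := idfun)) Gcnt; case: Ggrp.
pose F n := e @` `I_n; have FG n : F n `<=` G by move=> _ [k _ <-].
exists (fun n => smallest homeo_subgroup (F n)); split.
- move=> n; have [G0 _ G0G] := smallest_subgroup Ggrp (FG n); split=> //.
  by apply: Gfin => //; apply: finite_image; exact: finite_II.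
- move=> m n mn; have [G0 FG0 _] := smallest_subgroup Ggrp (FG n).
  apply: smallest_sub => //; apply: subset_trans FG0; apply: image_subset => k /=.
  by move/leq_trans; apply.
- move=> g /eG[n <-]; exists n.+1; apply: sub_gen_smallest.
  by exists n => /=.
Qed.

(* If no neighbourhood [V n] of [K] is equivalent to a part of [A], then for each
   [n] some orbit of the [n]-th finite subgroup has more points in [V n] than
   in [A]; the uniform measures on these orbits accumulate at an invariant
   measure charging [K]. *)
Lemma thin_small (R : realType) (G : set (X -> X)) (K : set X) :
  ample_group G -> minimal_group G -> closed K -> thin R G K -> small G K.
Proof.
move=> Gample Gmin cK thinK A cA A0; apply: contrapT => nV.
have Gloc : local_group G by case: Gample => /full_local_group.
have [G_ [G_P G_mono G_G]] := ample_exhaustion Gample.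
pose V n := [set x | exists2 y, K y & agree n x y].
have cV n : clopen (V n).
  apply/clopen_agree; exists n => x y xy [z Kz xz]; exists z => //.
  exact: agree_trans (agree_sym xy) xz.
have KV n : K `<=` V n by move=> x Kx; exists x.
have V_mono m n : (m <= n)%N -> V n `<=` V m.
  by move=> mn x [y Ky xy]; exists y => //; exact: agreeW mn xy.
have VK : \bigcap_n V n = K.
  apply/seteqP; split=> x; last by move=> Kx n _; exact: KV.
  move=> Vx; apply: contrapT => nKx.
  have /open_agree/(_ x nKx)[n nK] := closed_openC cK.
  by have [y Ky xy] := Vx n I; exact: nK Ky.
have /choice[x_ x_P] : forall n, exists x,
    (nb (orbit (G_ n) x `&` A) < nb (orbit (G_ n) x `&` V n))%N.
  move=> n; apply: contrapT => nx; apply: nV; exists (V n); split=> //.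
  have [G0grp G0G G0fin] := G_P n.
  have [|s [Gs _ sVA]] := @count_le G (G_ n) Gloc G0grp G0G G0fin (V n) A (cV n) cA.
    by move=> x; rewrite leqNgt; apply/negP => Ax; apply: nx; exists x.
  by exists (s @` V n) => //; exists s.
pose O n := orbit (G_ n) (x_ n).
have Ofin n : finite_set (O n) by apply: finite_image; case: (G_P n).
have O0 n : O n !=set0.
  by exists (x_ n), idfun => //; case: (G_P n) => -[].
have [U [UU ooU]] := @ultraFilterLemma nat \oo _.
have nearU N (P : nat -> Prop) : (forall n, (N <= n)%N -> P n) -> \forall n \near U, P n.
  by move=> NP; apply: ooU; exists N.
pose m := orbit_frequency R U O.
have [mu muE] := @probability_of_clopen_content R m (orbit_frequency_setT R UU Ofin O0)
  (orbit_frequency_ge0 R UU Ofin O0) (orbit_frequency_additive R UU Ofin O0).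
have mu_inv : invariant_probability G mu.
  apply: invariant_on_clopen Gloc.1 _ => g B Gg cB.
  have [k Gk gk] := group_inv Gloc.1 Gg.
  rewrite !muE//; last by apply: clopen_preimage cB; case: gk.
  congr (_%:E); apply: eq_orbit_frequency => //.
  have [N GNk] := G_G k Gk.
  apply: (nearU N) => n Nn; have [G0grp G0G G0fin] := G_P n.
  rewrite -(image_inverse _ (inverse_homeos_sym gk)).
  apply: (orbit_image Gloc G0grp G0fin _ _ Gk) => y.
  by exists k => //; exact: G_mono Nn _ GNk.
have [l [lG lA]] := minimal_cover Gloc.1 Gmin cA A0.
have [N lN] : exists N, forall g, g \in l -> G_ N g.
  elim: l lG {lA} => [_|g l IH lG]; first by exists 0%N.
  have [|N lN] := IH; first by move=> k kl; apply: lG; rewrite inE kl orbT.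
  have [M gM] : exists M, G_ M g by apply: G_G; apply: lG; rewrite inE eqxx.
  exists (maxn N M) => k; rewrite inE => /orP[/eqP->|/lN].
    exact: G_mono (leq_maxr _ _) _ gM.
  by apply: G_mono; exact: leq_maxl.
(* As [l] sweeps [X] into [A], the set [A] fills at least this fraction of each late orbit, and
   [V k] even more by the choice of [x_ k]. The bound is uniform and passes to [K] by continuity
   from above. *)
pose c : R := ((size l)%:R^-1)%R.
have l0 : (0 < (size l)%:R :> R)%R.
  by rewrite ltr0n lt0n size_eq0; apply/eqP => l0; have [x _] := A0; have [g] := lA x; rewrite l0.
have c0 : (0 < c)%R by rewrite invr_gt0.
have mV n : (c%:E <= mu (V n))%E.
  rewrite muE// lee_fin; apply: orbit_frequency_ge => //.
  apply: (nearU (maxn N n)) => k; rewrite geq_max => /andP[Nk nk].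
  have [G0grp G0G G0fin] := G_P k.
  rewrite /c mulrC ler_pdivrMr// -natrM ler_nat mulnC.
  rewrite -{1}(setIT (O k)).
  apply: leq_trans (@nb_orbit_cover G (G_ k) A (x_ k) l Gloc G0grp G0G G0fin _ lA) _.
    by move=> g /lN; exact: G_mono.
  rewrite leq_mul2l; apply/orP; right; apply: leq_trans (ltnW (x_P k)) _.
  apply: nb_sub; last exact: finite_setIl.
  by apply: setIS; exact: V_mono.
have mV' n : measurable (V n : set (borelType X)).
  by apply: sub_sigma_algebra; case: (cV n).
have mVK : measurable (\bigcap_n V n : set (borelType X)).
  rewrite VK -[K]setCK; apply: (@measurableC _ (borelType X)).
  by apply: sub_sigma_algebra; rewrite openC.
have muV0 : (mu (V 0%N) < +oo)%E by rewrite muE// ltry.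
have V_ni : nonincreasing_seq V by move=> i j ij; apply/subsetPset; exact: V_mono.
have muV_cvg := @nonincreasing_cvg_mu _ (borelType X) R mu V muV0 mV' mVK V_ni.
have : (c%:E <= mu K)%E.
  rewrite -VK -(cvg_lim _ muV_cvg)//; apply: lime_ge; last by apply: nearW => n; exact: mV.
  by apply/cvg_ex; exists (mu (\bigcap_n V n)).
by rewrite thinK// lee_fin leNgt c0.
Qed.

(** * Retractions onto clopen transversals *)

Lemma clopen_local (A : set X) :
  (forall x, exists N, forall y, agree N x y -> A x <-> A y) -> clopen A.
Proof.
move=> Aloc; split; first by apply/open_agree => x Ax; have [N NA] := Aloc x; exists N => y /NA <-.
rewrite -openC; apply/open_agree => x nAx; have [N NA] := Aloc x.
by exists N => y /NA AE Ay; apply: nAx; apply/AE.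
Qed.

Lemma clopen_near (A : set X) x : clopen A -> exists N, forall y, agree N x y -> A x <-> A y.
Proof.
move=> /clopen_agree[N NA]; exists N => y xy; split; first exact: NA.
by apply: NA; exact: agree_sym.
Qed.

Lemma agree_seq (T : eqType) (l : seq T) x (P : T -> X -> Prop) :
  {in l, forall g, exists N, forall y, agree N x y -> P g y} ->
  exists N, forall y, agree N x y -> {in l, forall g, P g y}.
Proof.
elim: l => [_|g l IH lP]; first by exists 0%N.
have [|N NP] := IH; first by move=> k kl; apply: lP; rewrite inE kl orbT.
have [M MP] := lP g (mem_head _ _).
exists (maxn N M) => y xy k; rewrite inE => /orP[/eqP->|kl].
  by apply: MP; exact: agreeW (leq_maxr _ _) xy.
by apply: NP kl; exact: agreeW (leq_maxl _ _) xy.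
Qed.

(** The strict lexicographic order. It is total and open as a relation, so a strict minimum persists
    under small perturbations. *)
Definition lex_lt (x y : X) := exists N, [/\ agree N x y, x N = false & y N = true].

Lemma lex_lt_total x y : x <> y -> lex_lt x y \/ lex_lt y x.
Proof.
move=> xy; have [N xyN] : exists N, x N != y N.
  by apply: contrapT => h; apply: xy; apply/funext => i; apply/eqP; apply: contrapT => /negP ?; apply: h; exists i.
case: (ex_minnP (ex_intro (fun n => x n != y n) N xyN)) => {xyN}N xyN Nmin.
have ag : agree N x y.
  by move=> i iN; apply/eqP; apply: contraTT iN => /Nmin; rewrite leqNgt.
case xN : (x N) xyN; case yN : (y N) => // _; last by left; exists N.
by right; exists N; split=> //; exact: agree_sym.
Qed.

Lemma lex_lt_trans x y z : lex_lt x y -> lex_lt y z -> lex_lt x z.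
Proof.
move=> [N [xyN xN yN]] [M [yzM yM zM]].
have [NM|MN|NM] := ltngtP N M.
- exists N; split=> //; last by rewrite -yzM.
  by apply: agree_trans xyN _; exact: agreeW (ltnW NM) yzM.
- exists M; split=> //; last by rewrite xyN.
  by apply: agree_trans (agreeW (ltnW MN) xyN) _.
- by rewrite -NM yN in yM.
Qed.

Lemma lex_lt_irr x : ~ lex_lt x x.
Proof. by move=> [N [_ ->]]. Qed.

Lemma lex_lt_near x y : lex_lt x y ->
  exists N, forall x' y', agree N x x' -> agree N y y' -> lex_lt x' y'.
Proof.
move=> [N [xy xN yN]]; exists N.+1 => x' y' xx' yy'; exists N; split.
- apply: agree_trans (agree_trans (agree_sym (agreeW (leqnSn N) xx')) xy) _.
  exact: agreeW yy'.
- by rewrite -xx'.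
- by rewrite -yy'.
Qed.

Lemma lex_min (A : set X) : finite_set A -> A !=set0 ->
  exists y, A y /\ forall z, A z -> z <> y -> lex_lt y z.
Proof.
move=> /finite_seqP[s ->]; elim: s => [[x]//|a s IH _].
have [[x xs]|s0] := pselect ([set` s] !=set0); last first.
  exists a; split=> [|z]; first by rewrite /= inE eqxx.
  rewrite /= inE => /orP[/eqP->//|zs]; by case: s0; exists z.
have [|y [ys ymin]] := IH; first by exists x.
have [->|ay] := pselect (a = y).
  exists y; split=> [|z]; first by rewrite /= inE eqxx.
  by rewrite /= inE => /orP[/eqP->//|zs]; exact: ymin.
have [lt_ay|lt_ya] := lex_lt_total ay.
  exists a; split=> [|z]; first by rewrite /= inE eqxx.
  rewrite /= inE => /orP[/eqP->//|zs] za.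
  have [->//|zy] := pselect (z = y).
  by apply: lex_lt_trans lt_ay _; exact: ymin.
exists y; split=> [|z]; first by rewrite /= inE ys orbT.
by rewrite /= inE => /orP[/eqP->//|zs]; exact: ymin.
Qed.

(** What the back-and-forth takes from ample groups, in a form stable under conjugation. In
    [tame_retract] the equations say that [r'] has its base inside that of [r] and that its fibres
    are unions of fibres of [r], invariant under [g]. *)
Record tame (G : set (X -> X)) : Prop := Tame {
  tame_local : local_group G ;
  tame_fix : forall g, G g -> clopen [set x | g x = x] ;
  tame_retract : forall r g, (forall x, r (r x) = r x) -> locally_in G r -> G g ->
    exists r', [/\ forall x, r' (r' x) = r' x, locally_in G r',
      forall x, r (r' x) = r' x, forall x, r' (r x) = r' x &
      forall x, r' (g x) = r' x] }.

(** Near a point both maps are group elements [g] and [k], and they agree at [z] when [k^-1 g] fixes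
    [z], a clopen condition. *)
Lemma equalizer_clopen (G : set (X -> X)) r s : local_group G ->
  (forall g, G g -> clopen [set x | g x = x]) ->
  locally_in G r -> locally_in G s -> clopen [set x | r x = s x].
Proof.
move=> Gloc Gfix rG sG; apply: clopen_local => x.
have [N [g Gg rg]] := rG x; have [M [k Gk sk]] := sG x.
have [k' Gk' [_ _ kK k'K]] := group_inv Gloc.1 Gk.
have [L LP] := clopen_near x (Gfix (k' \o g) (let: And4 _ _ Gc _ := Gloc.1 in Gc _ _ Gk' Gg)).
exists (maxn (maxn N M) L) => y xy.
have xyNM := agreeW (leq_maxl _ _) xy; have xyL := agreeW (leq_maxr _ _) xy.
have xyN := agreeW (leq_maxl _ _) xyNM; have xyM := agreeW (leq_maxr _ _) xyNM.
rewrite /= (rg x)// (rg y)// (sk x)// (sk y)//.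
have E z : (g z = k z) <-> (k' \o g) z = z.
  by split=> /= [->|e]; [rewrite kK|rewrite -[in RHS]e k'K].
by rewrite !E; exact: LP.
Qed.

(* The new retraction sends a point to the lexicographically least point of its
   orbit in the base; clopen fixed-point sets make it locally an element of [G]. *)
Lemma ample_tame (G : set (X -> X)) : ample_group G -> tame G.
Proof.
move=> [Gfull Gcnt Gfin Gfix]; have Gloc := full_local_group Gfull.
split=> // r g rr rG Gg.
have [N rN] := uniformly_in rG.
have [l [lG lr]] := finite_choice rN.
pose F : set (X -> X) := [set` l] `|` [set g].
have FG : F `<=` G by move=> k [/lG|->].
have [G0grp FG0 G0G] := smallest_subgroup Gloc.1 FG.
set G0 := smallest homeo_subgroup F in G0grp FG0 G0G.
have G0fin : finite_set G0.
  by apply: Gfin => //; rewrite finite_setU; split; [exact: finite_seq|exact: finite_set1].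
have cont k : G0 k -> continuous k.
  by move=> /G0G Gk; have [k' _ []] := group_inv Gloc.1 Gk.
have rorb x : orbit G0 x (r x).
  by have [k kl ->] := lr x; exists k => //; apply: FG0; left.
have cD : clopen [set x | r x = x].
  apply: (equalizer_clopen Gloc Gfix rG (s := id)) => x; exists 0%N, idfun => //.
  by case: Gloc.1.
pose S x := orbit G0 x `&` [set x | r x = x].
have /choice[r' r'P] : forall x, exists y, S x y /\ forall z, S x z -> z <> y -> lex_lt y z.
  move=> x; apply: lex_min; first exact: orbit_finite.
  by exists (r x); split.
have SE x y : orbit G0 x y -> S x = S y.
  move=> xy; apply/seteqP; split=> z [xz rz]; split=> //.
    exact: orbit_trans (orbit_sym G0grp xy) xz.
  exact: orbit_trans xy xz.
have r'E x y : orbit G0 x y -> r' y = r' x.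
  move=> xy; have [Sx xmin] := r'P x; have [Sy ymin] := r'P y.
  apply: contrapT => ne; apply: (@lex_lt_irr (r' x)); apply: (@lex_lt_trans _ (r' y)).
    by apply: xmin => //; rewrite (SE _ _ xy).
  by apply: ymin => [|e]; [rewrite -(SE _ _ xy)|rewrite e in ne].
exists r'; split.
- by move=> x; apply: r'E; case: (r'P x) => -[].
- move=> x; have [[[k G0k kx] rr'x] xmin] := r'P x.
  have /finite_seqP[s sG0] := G0fin.
  (* [k] realizes the minimum at [x]. A competitor [j] stays harmless nearby for one of three
     reasons: [j x] is off the clopen base, [j] and [k] coincide on a clopen set around [x], or
     [k x] is strictly smaller, an open condition. *)
  have [M MP] : exists M, forall y, agree M x y -> {in s, forall j, r (j y) = j y -> j y <> k y -> lex_lt (k y) (j y)}.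
    apply: agree_seq => j js.
    have G0j : G0 j by rewrite sG0.
    have [rj|nrj] := pselect (r (j x) = j x); last first.
      have [M MP] := clopen_near x (clopen_preimage (cont j G0j) cD).
      by exists M => y /MP e rjy; case: nrj; apply/e.
    have [jk|njk] := pselect (j x = k x).
      have [M MP] := clopen_near x (equalizer_clopen Gloc Gfix (r := j) (s := k)
        (fun z => ex_intro _ 0%N (ex_intro2 _ _ j (G0G _ G0j) (fun _ _ => erefl)))
        (fun z => ex_intro _ 0%N (ex_intro2 _ _ k (G0G _ G0k) (fun _ _ => erefl)))).
      by exists M => y /MP/= e _; case; apply/e.
    have [|M MP] := @lex_lt_near (k x) (j x).
      rewrite kx; apply: xmin; last by rewrite -kx.
      by split=> //; exists j.
    have [M1 M1P] := (continuous_agree k).1 (cont k G0k) x M.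
    have [M2 M2P] := (continuous_agree j).1 (cont j G0j) x M.
    exists (maxn M1 M2) => y xy _ _; apply: MP; [apply: M1P|apply: M2P].
      exact: agreeW (leq_maxl _ _) xy.
    exact: agreeW (leq_maxr _ _) xy.
  have [M' M'P] := clopen_near x (clopen_preimage (cont k G0k) cD).
  exists (maxn M M'); exists k; first exact: G0G.
  move=> y xy; apply: contrapT => ne; have [[[j G0j jy] rr'y] ymin] := r'P y.
  apply: (@lex_lt_irr (k y)); apply: (@lex_lt_trans _ (r' y)).
    rewrite -jy; apply: (MP y (agreeW (leq_maxl _ _) xy)); rewrite ?jy//.
    by move: G0j; rewrite sG0.
  apply: ymin => [|e]; last by apply: ne.
  split; first by exists k.
  by apply/(M'P y (agreeW (leq_maxr _ _) xy)); rewrite /= kx.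
- by move=> x; case: (r'P x) => -[].
- by move=> x; exact: r'E.
- by move=> x; apply: r'E; exists g => //; apply: FG0; right.
Qed.

(** * Germs of the trace groups *)

Lemma near_set_type (K : set X) (z : K) (U : set K) :
  nbhs z U <-> exists N, forall y : K, agree N (set_val z) (set_val y) -> U y.
Proof.
split=> [[_ [[W oW <-] /= Wz WU]]|[N NU]].
  have /open_agree/(_ _ Wz)[N NW] := oW.
  by exists N => y zy; apply: WU; exact: NW.
have /= := @initial_continuous K X set_val z [set y | agree N (set_val z) y] (nbhs_agree N _).
by apply: (@filterS K (nbhs z)).
Qed.

Lemma continuous_set_type (K L : set X) (f : K -> L) : continuous f <->
  forall (z : K) N, exists M, forall y : K, agree M (set_val z) (set_val y) ->
    agree N (set_val (f z)) (set_val (f y)).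
Proof.
split=> [cf z N|cf z U /near_set_type[N NU]].
  apply/near_set_type.
  apply: (cf z [set w | agree N (set_val (f z)) (set_val w)]).
  by apply/near_set_type; exists N.
by have [M Mf] := cf z N; apply/near_set_type; exists M => y /Mf; exact: NU.
Qed.

Lemma trace_mapE (K : set X) (g : X -> X) (z : K) :
  K (g (set_val z)) -> set_val (trace_map K g z) = g (set_val z).
Proof.
by move=> Kgz; rewrite /trace_map set_valE val_insubd -set_valE; case: ifPn => // /negP; rewrite inE.
Qed.

Lemma trace_map_id (K : set X) (g : X -> X) (z : K) :
  ~ K (g (set_val z)) -> trace_map K g z = z.
Proof.
move=> nKgz; apply: val_inj; rewrite /trace_map val_insubd; case: ifPn => // .
by rewrite inE.
Qed.

(** Etaleness is applied to the inverse of [g] and to the whole of [K]: the image of [K] under that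
    inverse meets [K] in a relatively open set. *)
Lemma etale_near (G : set (X -> X)) (K : set X) g (z : K) :
  homeo_subgroup G -> etale G K -> G g -> K (g (set_val z)) ->
  exists N, forall y : K, agree N (set_val z) (set_val y) -> K (g (set_val y)).
Proof.
move=> Ggrp etK Gg Kgz; have [k Gk [_ _ gK kK]] := group_inv Ggrp Gg.
have [oU _] := etK k Gk setT clopenT.
have [|N NU] := (near_set_type z _).1 (open_nbhs_nbhs (conj oU _)).
  exists (g (set_val z)); last exact: gK.
  by exists (SigSub (mem_set Kgz)).
by exists N => y /NU[_ [w _ <-] <-]; rewrite kK; exact: set_valP.
Qed.

(** An explicit upper bound for [trace_group]: a full group in which every germ visibly comes from
    [G]. *)
Definition traces (G : set (X -> X)) (K : set X) (f : K -> K) :=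
  homeomorphism f /\ forall z : K, exists N, exists2 g, G g &
    forall y : K, agree N (set_val z) (set_val y) -> set_val (f y) = g (set_val y).

Lemma traces_full (G : set (X -> X)) (K : set X) :
  homeo_subgroup G -> full_group (@traces G K).
Proof.
move=> Ggrp; split; last first.
  move=> g gh [n [U [g_ [Upart cU g_P gU]]]]; split=> // z.
  have [i _ Uiz] : cover setT U z by case: Upart => ->.
  have [M MU] := (near_set_type z _).1 (open_nbhs_nbhs (conj (cU i).1 Uiz)).
  have [_ /(_ z)[N [k Gk gk]]] := g_P i.
  exists (maxn N M), k => // y zy; rewrite (gU i) ?gk//.
    exact: agreeW (leq_maxl _ _) zy.
  by apply: MU; exact: agreeW (leq_maxr _ _) zy.
have [_ Gid Gc _] := Ggrp.
split.
- by move=> f [].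
- split; first by exists id; exact: inverse_homeos_id.
  by move=> z; exists 0%N, idfun.
- move=> f g [[f' ff'] fG] [[g' gg'] gG]; split.
    by exists (g' \o f'); exact: inverse_homeos_comp.
  move=> z; have [N [k Gk gk]] := gG z; have [M [j Gj fj]] := fG (g z).
  have [M' M'g] := (continuous_set_type g).1 (let: And4 c _ _ _ := gg' in c) z M.
  exists (maxn N M'), (j \o k); first exact: Gc.
  move=> y zy /=; have gzy := M'g y (agreeW (leq_maxr _ _) zy).
  by rewrite (fj _ gzy) (gk _ (agreeW (leq_maxl _ _) zy)).
- move=> f g [_ fG] fg; split; first by exists f; exact: inverse_homeos_sym.
  move=> z; have [N [k Gk fk]] := fG (g z).
  have [_ cg fK gK] := fg.
  have [k' Gk' [_ _ kK _]] := group_inv Ggrp Gk.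
  have [M Mg] := (continuous_set_type g).1 cg z N.
  exists M, k' => // y /Mg /fk; rewrite gK => ->.
  by rewrite kK.
Qed.

(** Near a point sent into [K] the trace of [t] is [t], by etaleness; near a point sent out of [K]
    it is the identity, as [K] is closed. *)
Lemma trace_group_traces (G : set (X -> X)) (K : set X) :
  homeo_subgroup G -> closed K -> etale G K -> trace_group G K `<=` @traces G K.
Proof.
move=> Ggrp cK etK; apply: smallest_sub; first exact: traces_full.
move=> _ [t [Gt tt] <-].
have [_ Gid _ _] := Ggrp.
have tloc (z : K) : exists N, exists2 g, G g & forall y : K,
    agree N (set_val z) (set_val y) -> set_val (trace_map K t y) = g (set_val y).
  have [Ktz|nKtz] := pselect (K (t (set_val z))).
    have [N NK] := etale_near Ggrp etK Gt Ktz.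
    by exists N, t => // y /NK Kty; rewrite trace_mapE.
  have [t' _ [ct _ _ _]] := group_inv Ggrp Gt.
  have oA : open (t @^-1` (~` K)).
    by apply: open_comp => [x _|]; [exact: ct|rewrite openC].
  have [N NK] := (open_agree _).1 oA (set_val z) nKtz.
  by exists N, idfun => // y /NK nKty; rewrite trace_map_id.
have ct : continuous (trace_map K t).
  apply/continuous_set_type => z N; have [M [g Gg tg]] := tloc z.
  have [g' _ [cg _ _ _]] := group_inv Ggrp Gg.
  have [M' M'g] := (continuous_agree g).1 cg (set_val z) N.
  exists (maxn M M') => y zy; rewrite !tg//; last exact: agreeW (leq_maxl _ _) zy.
  by apply: M'g; exact: agreeW (leq_maxr _ _) zy.
have ttr : cancel (trace_map K t) (trace_map K t).
  move=> z; have [Ktz|nKtz] := pselect (K (t (set_val z))).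
    apply: val_inj; rewrite -[LHS]/(set_val _) trace_mapE trace_mapE// tt//.
    exact: set_valP.
  by rewrite (trace_map_id nKtz) trace_map_id.
by split=> //; exists (trace_map K t).
Qed.

(** [trace_group] is generated by traces of involutions, whereas [g] is arbitrary. If [g] fixes the
    point, it is the identity nearby, by the clopen fixed-point set; otherwise it has the germ of
    the involution swapping a small cylinder with its image. The variable [w] stands for [g y] as a
    point of the type [K]. *)
Lemma germ_of_trace (G H : set (X -> X)) (K L : set X) (h : K -> L) h' g (z : K) :
  ample_group G -> homeo_subgroup H -> etale G K -> closed L -> etale H L ->
  inverse_homeos h h' ->
  conj_group h h' (trace_group G K) `<=` trace_group H L ->
  G g -> forall Kgz : K (g (set_val z)),
  exists N, exists2 k, H k & forall y w : K, agree N (set_val z) (set_val y) ->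
    K (g (set_val y)) /\
    (set_val w = g (set_val y) -> set_val (h w) = k (set_val (h y))).
Proof.
move=> Gample Hgrp etK cL etL [ch ch' hK h'K] conjGH Gg Kgz.
have [Gfull _ _ Gfix] := Gample; have Gloc := full_local_group Gfull.
set x := set_val z.
have [N NK] := etale_near Gloc.1 etK Gg Kgz.
have [gx|gx] := pselect (g x = x).
  have [M MP] := clopen_near x (Gfix g Gg).
  exists (maxn N M), idfun; first by case: Hgrp.
  move=> y w zy; split; first by apply: NK; exact: agreeW (leq_maxl _ _) zy.
  have -> : g (set_val y) = set_val y.
    exact: (MP _ (agreeW (leq_maxr _ _) zy)).1.
  by move=> wy; congr (set_val (h _)); exact: val_inj.
have [g' _ gg'] := group_inv Gloc.1 Gg; have [cg _ _ _] := gg'.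
(* The cylinder [C] will be small enough to freeze this coordinate on [C] and on its image, with
   different values. *)
have [i gxi] : exists i, g x i <> x i.
  by apply: contrapT => ne; apply: gx; apply/funext => i; apply: contrapT => ?; apply: ne; exists i.
have [M Mg] := (continuous_agree g).1 cg x i.+1.
pose C := [set y | agree (maxn i.+1 M) x y].
have cC : clopen C by apply/clopen_agree; exists (maxn i.+1 M) => y y' yy' xy; exact: agree_trans xy yy'.
have CgC : C `&` g @` C = set0.
  rewrite -subset0 => w [xw [y xy yw]]; apply: gxi.
  rewrite (Mg y (agreeW (leq_maxr _ _) xy) i (ltnSn i)).
  by rewrite yw -(xw i)// leq_max ltnSn.
have [t [Gt tt tC _ _]] := swap Gloc Gg cC CgC.
have trt : trace_group H L (h \o trace_map K t \o h').
  by apply: conjGH; exists (trace_map K t) => //; apply: sub_gen_smallest; exists t.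
have [_ /(_ (h z))[N' [k Hk hk]]] := trace_group_traces Hgrp cL etL trt.
have [N'' N''h] := (continuous_set_type h).1 ch z N'.
exists (maxn N (maxn (maxn i.+1 M) N'')), k => // y w zy.
have zyN := agreeW (leq_maxl _ _) zy; have zy' := agreeW (leq_maxr _ _) zy.
have Cy := agreeW (leq_maxl _ _) zy'; have zy'' := agreeW (leq_maxr _ _) zy'.
split; first exact: NK.
move=> wgy; rewrite -hk; last exact: N''h.
rewrite /= hK; congr (set_val (h _)); apply: val_inj.
by rewrite -![\val _]/(set_val _) trace_mapE tC//; exact: NK.
Qed.

(** * Gluing and avoidance *)

(** Near [y] the inverse agrees with the inverse of the group element representing [f] near [f' y],
    whence its continuity. *)
Lemma local_group_bij (G : set (X -> X)) f f' : local_group G ->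
  locally_in G f -> cancel f f' -> cancel f' f -> G f.
Proof.
move=> [Ggrp Gloc] fG fK f'K; apply: Gloc => //.
exists f'; split=> //; first exact: locally_in_continuous fG.
apply: (locally_in_continuous Ggrp) => y.
have [N [g Gg fg]] := fG (f' y).
have [k Gk [_ ck gK kK]] := group_inv Ggrp Gg.
have [M Mk] := (continuous_agree k).1 ck y N.
have ky : k y = f' y by rewrite -[in LHS](f'K y) fg ?gK.
exists M, k => // z /Mk; rewrite ky => yz.
by rewrite -[in LHS](kK z) -fg ?fK.
Qed.

(** Plays the role of finite clopen partitions: a clopen set is cut by finitely many cylinders of a
    uniform length, one at a time. *)
Lemma clopen_ind (Q : set X -> Prop) :
  (forall x, exists N, forall C, clopen C -> C `<=` agree N x -> Q C) ->
  (forall A B, clopen A -> clopen B -> A `&` B = set0 -> Q A -> Q B -> Q (A `|` B)) ->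
  forall C, clopen C -> Q C.
Proof.
move=> Qloc QU.
have [N NQ] : exists N, forall x C, clopen C -> C `<=` agree N x -> Q C.
  apply: uniform_level => [M N x MN QM C cC Cx|x].
    by apply: QM => // y /Cx; exact: agreeW.
  have [N NQ] := Qloc x; exists N => y xy C cC Cy; apply: NQ => // z /Cy.
  exact: agree_trans.
have [s sN] := finite_net N.
suff H (l : seq X) C : clopen C -> (forall x, C x -> exists2 y, y \in l & agree N y x) -> Q C.
  by move=> C cC; exact: (H s C cC (fun x _ => sN x)).
elim: l C => [|a l IH] C cC Cl.
  by apply: (NQ point) => // x /Cl[].
have ca : clopen (agree N a : set X).
  by apply/clopen_agree; exists N => x y xy ax; exact: agree_trans ax xy.
rewrite -(setUIDK C (agree N a)); apply: QU.
- exact: clopenI.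
- exact: clopen_D.
- by rewrite setDE setIACA setICr setI0.
- by apply: (NQ a) => [|x []//]; exact: clopenI.
- apply: IH => [|x [Cx nax]]; first exact: clopen_D.
  have [y] := Cl x Cx; rewrite inE => /orP[/eqP-> //|yl yx]; by exists y.
Qed.

Lemma closed_sep (F1 F2 : set X) : closed F1 -> closed F2 -> F1 `&` F2 = set0 ->
  exists O, [/\ clopen O, F1 `<=` O & forall x, F2 x -> ~ O x].
Proof.
move=> c1 c2 F12.
have [N NF] : exists N, forall x, F1 x -> forall y, agree N x y -> ~ F2 y.
  apply: uniform_level => [M N x MN H F1x y /(agreeW MN)|x]; first exact: H.
  have [F1x|nF1x] := pselect (F1 x).
    have nF2x : ~ F2 x by move=> F2x; rewrite -[False]/(set0 x) -F12.
    have [N NF] := (open_agree _).1 (closed_openC c2) x nF2x.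
    by exists N => y xy _ z yz; apply: NF; exact: agree_trans xy yz.
  have [N NF] := (open_agree _).1 (closed_openC c1) x nF1x.
  by exists N => y /NF nF1y /nF1y.
exists [set y | exists2 x, F1 x & agree N x y]; split.
- apply/clopen_agree; exists N => x y xy [z F1z zx]; exists z => //.
  exact: agree_trans zx xy.
- by move=> x F1x; exists x.
- by move=> y F2y [x F1x /(NF x F1x)].
Qed.

Section gluing.
Variable G : set (X -> X).
Hypotheses (Gloc : local_group G) (Gcan : cancellative G).

(** Cancellation, applied inside the complements of [A1] and of its image, provides [g3] between
    what remains of source and target. *)
Lemma glue2 A1 A2 g1 g2 : clopen A1 -> clopen A2 -> G g1 -> G g2 ->
  (forall x, A1 x -> ~ A2 x) -> (forall x y, A1 x -> A2 y -> g1 x <> g2 y) ->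
  exists g, [/\ G g, forall x, A1 x -> g x = g1 x & forall x, A2 x -> g x = g2 x].
Proof.
move=> c1 c2 Gg1 Gg2 A12 B12.
have Ggrp := Gloc.1.
have [k1 Gk1 [ck1 _ g1K k1K]] := group_inv Ggrp Gg1.
have [k2 Gk2 [ck2 _ g2K k2K]] := group_inv Ggrp Gg2.
have [g3 Gg3 g3A] : clopen_equiv G (~` A1 `\` A2) (~` (g1 @` A1) `\` (g2 @` A2)).
  apply: Gcan => //.
  - exact: clopenC.
  - by move=> x A2x /A12; apply.
  - by move=> _ [y A2y <-] [x A1x]; exact: B12.
  - by apply: clopen_equiv_setC => //; exists g1.
  - by exists g2.
have [k3 Gk3 [ck3 _ g3K k3K]] := group_inv Ggrp Gg3.
pose f x := if pselect (A1 x) then g1 x else if pselect (A2 x) then g2 x else g3 x.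
pose f' y := if pselect (A1 (k1 y)) then k1 y else if pselect (A2 (k2 y)) then k2 y else k3 y.
have fA1 x : A1 x -> f x = g1 x by rewrite /f; case: pselect.
have fA2 x : A2 x -> f x = g2 x.
  by move=> A2x; rewrite /f; case: pselect => [/A12//|?]; case: pselect.
have fA3 x : ~ A1 x -> ~ A2 x -> f x = g3 x by rewrite /f; case: pselect => // ?; case: pselect.
have f'A1 y : A1 (k1 y) -> f' y = k1 y by rewrite /f'; case: pselect.
have f'A2 y : A2 (k2 y) -> f' y = k2 y.
  move=> A2y; rewrite /f'; case: pselect => [A1y|?]; last by case: pselect.
  by case: (B12 (k1 y) (k2 y)); rewrite ?k1K ?k2K.
have f'A3 y : ~ A1 (k1 y) -> ~ A2 (k2 y) -> f' y = k3 y by rewrite /f'; case: pselect => // ?; case: pselect.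
exists f; split=> //; apply: (@local_group_bij G f f' Gloc).
- move=> x; have [N1 E1] := clopen_near x c1; have [N2 E2] := clopen_near x c2.
  exists (maxn N1 N2).
  have {}E1 y : agree (maxn N1 N2) x y -> A1 x <-> A1 y.
    by move=> xy; apply: E1; exact: agreeW (leq_maxl _ _) xy.
  have {}E2 y : agree (maxn N1 N2) x y -> A2 x <-> A2 y.
    by move=> xy; apply: E2; exact: agreeW (leq_maxr _ _) xy.
  have [A1x|nA1x] := pselect (A1 x).
    by exists g1 => // y /E1[A1y _]; rewrite fA1//; exact: A1y.
  have [A2x|nA2x] := pselect (A2 x).
    by exists g2 => // y /E2[A2y _]; rewrite fA2//; exact: A2y.
  by exists g3 => // y xy; rewrite fA3// => [/(E1 y xy)|/(E2 y xy)].
- move=> x; have [A1x|nA1x] := pselect (A1 x).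
    by rewrite fA1// f'A1 g1K.
  have [A2x|nA2x] := pselect (A2 x); first by rewrite fA2// f'A2 g2K.
  have [nB1 nB2] : (~` (g1 @` A1) `\` (g2 @` A2)) (g3 x) by rewrite -g3A; exists x.
  rewrite fA3// f'A3 ?g3K// => ?; [apply: nB1|apply: nB2].
    by exists (k1 (g3 x)).
  by exists (k2 (g3 x)).
- move=> y; have [A1y|nA1y] := pselect (A1 (k1 y)).
    by rewrite f'A1// fA1// k1K.
  have [A2y|nA2y] := pselect (A2 (k2 y)); first by rewrite f'A2// fA2// k2K.
  have [x [nA1x nA2x] xy] : (g3 @` (~` A1 `\` A2)) y.
    by rewrite g3A; split=> [[z Az zy]|[z Az zy]]; [apply: nA1y|apply: nA2y]; rewrite -zy ?g1K ?g2K.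
  by rewrite f'A3// -xy g3K fA3.
Qed.

Lemma clopen_equivU A1 A2 B1 B2 : clopen A1 -> clopen A2 ->
  A1 `&` A2 = set0 -> B1 `&` B2 = set0 ->
  clopen_equiv G A1 B1 -> clopen_equiv G A2 B2 ->
  clopen_equiv G (A1 `|` A2) (B1 `|` B2).
Proof.
move=> c1 c2 A12 B12 [g1 Gg1 g1A] [g2 Gg2 g2A].
have [||g [Gg gA1 gA2]] := @glue2 A1 A2 g1 g2 c1 c2 Gg1 Gg2.
- by move=> x A1x A2x; rewrite -[False]/(set0 x) -A12.
- move=> x y A1x A2y e; rewrite -[False]/(set0 (g1 x)) -B12 -g1A -g2A; split; first by exists x.
  by rewrite e; exists y.
exists g => //; rewrite image_setU -g1A -g2A; congr (_ `|` _); exact: eq_imagel.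
Qed.

Lemma glue_pair P Q V g1 g2 : clopen P -> clopen V -> V `<=` P -> G g1 -> G g2 ->
  g1 @` V `<=` Q -> g2 @` (P `\` V) = Q `\` (g1 @` V) ->
  exists g, [/\ G g, g @` P = Q, forall x, V x -> g x = g1 x &
    forall x, (P `\` V) x -> g x = g2 x].
Proof.
move=> cP cV VP Gg1 Gg2 g1V g2V.
have [|||g [Gg gV gPV]] := @glue2 V (P `\` V) g1 g2 cV _ Gg1 Gg2.
- exact: clopen_D.
- by move=> x Vx [].
- move=> x y Vx PVy e; have [_ []] : (Q `\` g1 @` V) (g2 y) by rewrite -g2V; exists y.
  by rewrite -e; exists x.
exists g; split=> //; rewrite -(setDUK VP) image_setU (eq_imagel gV) (eq_imagel gPV).
by rewrite g2V setDUK.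
Qed.

Lemma glue_equiv P Q V g1 : clopen P -> clopen V -> V `<=` P -> G g1 ->
  g1 @` V `<=` Q -> clopen_equiv G P Q ->
  exists g, [/\ G g, g @` P = Q & forall x, V x -> g x = g1 x].
Proof.
move=> cP cV VP Gg1 g1V PQ.
have [|g2 Gg2 g2V] := Gcan cV cP VP g1V PQ; first by exists g1.
by have [g [Gg gP gV _]] := glue_pair cP cV VP Gg1 Gg2 g1V g2V; exists g.
Qed.

(* On each piece of a fine clopen partition [f] agrees with an element of [G];
   the pieces are absorbed one at a time, cancellation providing an element of
   [G] between what remains of [P] and of [Q]. *)
Lemma extend_partial Z f : closed Z ->
  (forall x, Z x -> exists N, exists2 g, G g & forall y, Z y -> agree N x y -> f y = g y) ->
  (forall x y, Z x -> Z y -> f x = f y -> x = y) ->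
  forall P Q, clopen P -> clopen_equiv G P Q -> Z `<=` P -> f @` Z `<=` Q ->
  exists g, [/\ G g, g @` P = Q & forall x, Z x -> g x = f x].
Proof.
move=> cZ floc finj.
pose ext W := forall P Q, clopen P -> clopen_equiv G P Q -> Z `&` W `<=` P ->
  f @` (Z `&` W) `<=` Q ->
  exists g, [/\ G g, g @` P = Q & forall x, (Z `&` W) x -> g x = f x].
suff H : ext setT.
  by move=> P Q cP PQ ZP ZQ; have := H P Q cP PQ; rewrite setIT; apply.
apply: (clopen_ind (Q := ext)); last exact: clopenT.
  move=> x; have [Zx|nZx] := pselect (Z x); last first.
    have [N NZ] := (open_agree _).1 (closed_openC cZ) x nZx.
    exists N => C cC Cx P Q cP [g Gg gP] _ _; exists g; split=> // y [Zy /Cx /NZ].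
    by [].
  have [N [g Gg fg]] := floc x Zx.
  exists N => C cC Cx P Q cP PQ ZP ZQ.
  have [k _ [cg _ _ _]] := group_inv Gloc.1 Gg.
  have cQ := clopen_equiv_clopen Gloc.1 PQ cP.
  have [||||k' [Gk' k'P k'V]] := @glue_equiv P Q (P `&` g @^-1` Q) g cP _ _ Gg.
  - by apply: clopenI => //; exact: clopen_preimage.
  - by move=> y [].
  - by move=> _ [y [_ Qgy] <-].
  - exact: PQ.
  exists k'; split=> // y ZCy; have [Zy Cy] := ZCy.
  have fy : f y = g y by apply: fg => //; exact: Cx.
  rewrite k'V//; split; first exact: ZP.
  by rewrite /= -fy; apply: ZQ; exists y.
move=> A B cA cB AB extA extB P Q cP PQ ZP ZQ.
have [|| g1 [Gg1 g1P g1A]] := extA P Q cP PQ.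
- by move=> x [Zx Ax]; apply: ZP; split=> //; left.
- by move=> _ [x [Zx Ax] <-]; apply: ZQ; exists x => //; split=> //; left.
have [|| g2 [Gg2 g2P g2B]] := extB P Q cP PQ.
- by move=> x [Zx Bx]; apply: ZP; split=> //; right.
- by move=> _ [x [Zx Bx] <-]; apply: ZQ; exists x => //; split=> //; right.
have [k1 _ gk1] := group_inv Gloc.1 Gg1; have [k2 _ gk2] := group_inv Gloc.1 Gg2.
have cZI C : clopen C -> closed (Z `&` C) by move=> [_ cC]; exact: closedI.
have ABN x : A x -> B x -> False.
  by move=> Ax Bx; rewrite -[False]/(set0 x) -AB.
(* Injectivity makes the two closed images disjoint. Restricting [g1] to points sent into [O] leaves
   free the values that [f] takes on [B], so [extB] still applies to what remains. *)
have [|||O [cO ZO nZO]] := @closed_sep (g1 @` (Z `&` A)) (g2 @` (Z `&` B)).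
- by apply: closed_image gk1 _; exact: cZI.
- by apply: closed_image gk2 _; exact: cZI.
- rewrite -subset0 => _ [[x [Zx Ax] <-] [y [Zy By]]].
  rewrite g1A// g2B// => /esym/(finj _ _ Zx Zy) xy.
  by apply: (ABN x) => //; rewrite xy.
pose V := P `&` (A `&` g1 @^-1` O).
have cV : clopen V.
  apply: clopenI => //; apply: clopenI => //; apply: clopen_preimage cO; by case: gk1.
have VP : V `<=` P by move=> x [].
have VQ : g1 @` V `<=` Q by move=> _ [x [Px _] <-]; rewrite -g1P; exists x.
have PVQ : clopen_equiv G (P `\` V) (Q `\` g1 @` V) by apply: Gcan => //; exists g1.
have [|||g3 [Gg3 g3P g3B]] := extB _ _ _ PVQ.
- exact: clopen_D.
- move=> x [Zx Bx]; split; first by apply: ZP; split=> //; right.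
  by move=> [_ [Ax _]]; exact: ABN Bx.
- move=> _ [x [Zx Bx] <-]; split; first by apply: ZQ; exists x => //; split=> //; right.
  move=> [y [_ [_ Oy]] yx]; apply: (nZO (f x)); last by rewrite -yx.
  by rewrite -g2B//; exists x.
have [g [Gg gP gV gPV]] := glue_pair cP cV VP Gg1 Gg3 VQ g3P.
exists g; split=> // x [Zx [Ax|Bx]].
  rewrite gV ?g1A//; split; first by apply: ZP; split=> //; left.
  by split=> //; apply: ZO; exists x.
rewrite gPV ?g3B//; split; first by apply: ZP; split=> //; right.
by move=> [_ [Ax _]]; exact: ABN Bx.
Qed.

End gluing.

Lemma clopen_split (A : set X) : clopen A -> A !=set0 ->
  exists A1 A2, [/\ clopen A1 /\ clopen A2, A1 !=set0 /\ A2 !=set0,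
    A1 `&` A2 = set0, A1 `<=` A & A2 `<=` A].
Proof.
move=> cA [x Ax]; have [N NA] := clopen_near x cA.
have cB : clopen [set y : X | y N = x N].
  by apply/clopen_agree; exists N.+1 => y z yz /= <-; rewrite yz.
exists (A `&` [set y | y N = x N]), (A `\` [set y | y N = x N]); split.
- by split; [exact: clopenI|exact: clopen_D].
- split; first by exists x.
  (* The cylinder deciding membership in [A] uses the coordinates below [N], so flipping coordinate
     [N] stays in [A]. *)
  exists (fun i => if i == N then ~~ x N else x i); split; last by rewrite /= eqxx; case: (x N).
  by apply/NA => // i; case: eqP => // ->; rewrite ltnn.
- by rewrite setDE setIACA setICr setI0.
- by move=> y [].
- by move=> y [].
Qed.

Lemma small_sub (G : set (X -> X)) K K' : K' `<=` K -> small G K -> small G K'.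
Proof.
move=> K'K Ksm A cA A0; have [V [cV KV VA]] := Ksm A cA A0.
by exists V; split=> //; exact: subset_trans KV.
Qed.

Lemma small_image (G : set (X -> X)) K g : homeo_subgroup G -> G g ->
  small G K -> small G (g @` K).
Proof.
move=> Ggrp Gg Ksm A cA A0; have [V [cV KV [B BA VB]]] := Ksm A cA A0.
have VgV : clopen_equiv G V (g @` V) by exists g.
exists (g @` V); split; first exact: (clopen_equiv_clopen Ggrp VgV cV).
  exact: image_subset.
exists B => //; apply: (clopen_equiv_trans Ggrp _ VB).
exact: clopen_equiv_sym.
Qed.

Section avoidance.
Variable G : set (X -> X).
Hypotheses (Gloc : local_group G) (Gcan : cancellative G).

(** The two sets are fitted into disjoint parts of the target. *)
Lemma small_setU K1 K2 : small G K1 -> small G K2 -> small G (K1 `|` K2).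
Proof.
move=> sm1 sm2 A cA A0.
have [A1 [A2 [[cA1 cA2] [A10 A20] A12 A1A A2A]]] := clopen_split cA A0.
have [V1 [cV1 KV1 [B1 BA1 VB1]]] := sm1 A1 cA1 A10.
have [V2 [cV2 KV2 [B2 BA2 [g2 Gg2 gV2]]]] := sm2 A2 cA2 A20.
exists (V1 `|` (V2 `\` V1)); split.
- by apply: clopenU => //; exact: clopen_D.
- rewrite setUDr setDv setD0; exact: setUSS.
- exists (B1 `|` g2 @` (V2 `\` V1)).
    move=> y [/BA1/A1A//|[x [V2x _] <-]]; apply/A2A/BA2; rewrite -gV2.
    by exists x.
  apply: (clopen_equivU Gloc Gcan) => //; first exact: clopen_D.
  - by rewrite setIC setDE setIAC -setIA setICr setI0.
  - rewrite -subset0 => y [/BA1 A1y [x [V2x _] xy]]; rewrite -A12; split=> //.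
    by apply: BA2; rewrite -gV2 -xy; exists x.
  - by exists g2.
Qed.

Lemma small_locally r L : locally_in G r -> small G L -> small G (r @` L).
Proof.
move=> rG Lsm; rewrite -(setIT L).
apply: (clopen_ind (Q := fun C => small G (r @` (L `&` C)))); last exact: clopenT.
  move=> x; have [N [g Gg rg]] := rG x; exists N => C cC Cx.
  apply: (@small_sub _ (g @` L)); last by apply: small_image => //; case: Gloc.
  by move=> _ [y [Ly /Cx xy] <-]; exists y => //; rewrite rg.
move=> A B cA cB AB smA smB.
by rewrite setIUr image_setU; exact: small_setU.
Qed.

(** Otherwise [Q] would be equivalent to a subset of its proper part [Q1], and cancellation would
    make a set containing [Q2] equivalent to the empty set. *)
Lemma small_neq Q M : clopen Q -> Q !=set0 -> small G M -> ~ Q `<=` M.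
Proof.
move=> cQ Q0 Msm QM.
have [Q1 [Q2 [[cQ1 cQ2] [Q10 [y Q2y]] Q12 Q1Q Q2Q]]] := clopen_split cQ Q0.
have [V [cV MV [B BQ1 [k Gk kV]]]] := Msm Q1 cQ1 Q10.
have kQ1 : k @` Q `<=` Q1.
  by move=> _ [x Qx <-]; apply: BQ1; rewrite -kV; exists x => //; apply/MV/QM.
have ckQ : clopen (k @` Q) by apply: (clopen_equiv_clopen Gloc.1 _ cQ); exists k.
have [||||g Gg] := @Gcan Q (k @` Q) (k @` Q) (k @` Q) ckQ cQ.
- exact: subset_trans Q1Q.
- by [].
- by exists k.
- exact: clopen_equiv_refl Gloc.1 _.
rewrite setDv => gQ; rewrite -[False]/(set0 (g y)) -gQ; exists y => //.
split; first exact: Q2Q.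
by move=> /kQ1 Q1y; rewrite -[False]/(set0 y) -Q12.
Qed.

(** By [small_neq] and closedness, some nonempty clopen part of [Q] misses [M']. A neighbourhood of
    [M] fits into it, and cancellation extends this to [P]. *)
Lemma avoid P Q M M' : clopen P -> clopen_equiv G P Q -> M `<=` P -> M' `<=` Q ->
  closed M' -> small G M -> small G M' ->
  exists g, [/\ G g, g @` P = Q & forall x, M x -> ~ M' (g x)].
Proof.
move=> cP PQ MP M'Q cM' smM smM'.
have cQ := clopen_equiv_clopen Gloc.1 PQ cP.
have [Q0|Q0] := pselect (Q !=set0); last first.
  have [g Gg gP] := PQ; exists g; split=> // x Mx M'x; apply: Q0.
  by exists (g x); exact: M'Q.
have [x Qx nM'x] : exists2 x, Q x & ~ M' x.
  apply: contrapT => h; apply: (small_neq cQ Q0 smM') => x Qx.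
  by apply: contrapT => nM'x; apply: h; exists x.
have [N NM'] := (open_agree _).1 (closed_openC cM') x nM'x.
pose A := Q `&` [set y | agree N x y].
have cA : clopen A.
  by apply: clopenI => //; apply/clopen_agree; exists N => y z yz xy; exact: agree_trans xy yz.
have [|V [cV MV [B BA [k Gk kV]]]] := smM A cA; first by exists x.
have [||||g [Gg gP gV]] := @glue_equiv G Gloc Gcan P Q (V `&` P) k cP _ _ Gk.
- exact: clopenI.
- by move=> y [].
- by move=> _ [y [Vy _] <-]; have [] : A (k y) by apply: BA; rewrite -kV; exists y.
- exact: PQ.
exists g; split=> // y My; rewrite gV; last by split; [exact: MV|exact: MP].
have [_ xky] : A (k y) by apply: BA; rewrite -kV; exists y => //; exact: MV.
exact: NM'.
Qed.

(** As [Z] is relatively clopen in [M], and its image in [M'], a neighbourhood [V] of [Z] can be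
    split off, on which an extension of [f] is kept; [avoid] treats the rest. *)
Lemma extend_avoid P Q M M' Z f : clopen P -> clopen_equiv G P Q ->
  M `<=` P -> M' `<=` Q -> closed M -> closed M' -> small G M -> small G M' ->
  Z `<=` M -> closed Z -> closed (M `\` Z) -> f @` Z `<=` M' ->
  closed (M' `\` f @` Z) ->
  (forall x, Z x -> exists N, exists2 g, G g & forall y, Z y -> agree N x y -> f y = g y) ->
  (forall x y, Z x -> Z y -> f x = f y -> x = y) ->
  exists g, [/\ G g, g @` P = Q, forall x, Z x -> g x = f x &
    forall x, M x -> ~ Z x -> ~ M' (g x)].
Proof.
move=> cP PQ MP M'Q cM cM' smM smM' ZM cZ cMZ fZ cM'Z floc finj.
have [||g0 [Gg0 g0P g0Z]] := extend_partial Gloc Gcan cZ floc finj cP PQ.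
- exact: subset_trans MP.
- exact: subset_trans M'Q.
have [k0 _ gk0] := group_inv Gloc.1 Gg0.
have [|O [cO ZO nO]] := closed_sep cZ cMZ.
  by rewrite setDE setICA setICr setI0.
have [||O' [cO' ZO' nO']] := @closed_sep (f @` Z) (M' `\` f @` Z) _ cM'Z.
- by rewrite -(eq_imagel g0Z); exact: closed_image gk0 cZ.
- by rewrite setDE setICA setICr setI0.
pose V := P `&` (O `&` g0 @^-1` O').
have cV : clopen V.
  by apply: clopenI => //; apply: clopenI => //; apply: clopen_preimage cO'; case: gk0.
have VP : V `<=` P by move=> x [].
have VQ : g0 @` V `<=` Q by move=> _ [x [Px _] <-]; rewrite -g0P; exists x.
have PVQ : clopen_equiv G (P `\` V) (Q `\` g0 @` V) by apply: Gcan => //; exists g0.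
have [||||||g1 [Gg1 g1P g1M]] := avoid (M := M `\` Z) (M' := M' `\` f @` Z) _ PVQ.
- exact: clopen_D.
- by move=> x MZx; split; [by apply: MP; case: MZx|case=> _ [Ox _]; exact: nO Ox].
- move=> y M'Zy; split; first by apply: M'Q; case: M'Zy.
  by move=> [x [_ [_ O'x]] xy]; apply: (nO' y) => //; rewrite -xy.
- exact: cM'Z.
- by apply: small_sub smM => x [].
- by apply: small_sub smM' => x [].
have [g [Gg gP gV gPV]] := glue_pair Gloc Gcan cP cV VP Gg0 Gg1 VQ g1P.
have ZV x : Z x -> V x.
  move=> Zx; split; first exact/MP/ZM.
  by split; [exact: ZO|rewrite /= g0Z//; apply: ZO'; exists x].
exists g; split=> // [x Zx|x Mx nZx M'gx]; first by rewrite gV ?g0Z//; exact: ZV.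
have PVx : (P `\` V) x.
  by split; [exact: MP|case=> _ [Ox _]; apply: nO Ox].
apply: (g1M x) => //; rewrite -gPV//; split=> // -[z Zz zgx].
have : (Q `\` g0 @` V) (g x) by rewrite gPV// -g1P; exists x.
by move=> [_]; apply; exists z; [exact: ZV|rewrite g0Z].
Qed.

(** Neighbourhoods of [M] and [M'] are shrunk into [C] and into its complement in [P]. The last two
    hypotheses settle the cases where one of these targets is empty. *)
Lemma split_avoid P C M M' : clopen P -> clopen C -> C `<=` P ->
  M `<=` P -> M' `<=` P -> closed M -> closed M' -> M `&` M' = set0 ->
  small G M -> small G M' ->
  (C = set0 -> M = set0) -> (P `\` C = set0 -> M' = set0) ->
  exists g, [/\ G g, g @` P = P, forall x, M x -> C (g x) & forall x, M' x -> ~ C (g x)].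
Proof.
move=> cP cC CP MP M'P cM cM' MM' smM smM' CM CM'.
have Gid : G idfun by case: Gloc.1.
have [C0|/eqP/set0P C0] := pselect (C = set0).
  exists idfun; split=> //; first by rewrite image_id.
    by rewrite (CM C0) => x [].
  by rewrite C0 => x _ [].
have [D0|/eqP/set0P D0] := pselect (P `\` C = set0).
  exists idfun; split=> //; first by rewrite image_id.
    by move=> x /MP Px; apply: contrapT => nCx; rewrite -[False]/(set0 x) -D0.
  by rewrite (CM' D0) => x [].
have cD : clopen (P `\` C) by exact: clopen_D.
have [V1 [cV1 MV1 [B1 B1C [k1 Gk1 kV1]]]] := smM C cC C0.
have [V2 [cV2 MV2 [B2 B2C [k2 Gk2 kV2]]]] := smM' _ cD D0.
have [U [cO MO nO]] := closed_sep cM cM' MM'.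
pose W1 := P `&` (V1 `&` U); pose W2 := P `&` (V2 `\` U).
have cW1 : clopen W1 by apply: clopenI => //; exact: clopenI.
have cW2 : clopen W2 by apply: clopenI => //; exact: clopen_D.
have k1W x : W1 x -> C (k1 x).
  by move=> [_ [V1x _]]; apply: B1C; rewrite -kV1; exists x.
have k2W x : W2 x -> (P `\` C) (k2 x).
  by move=> [_ [V2x _]]; apply: B2C; rewrite -kV2; exists x.
have [||k [Gk kW1 kW2]] := glue2 Gloc Gcan cW1 cW2 Gk1 Gk2.
- by move=> x [_ [_ Ox]] [_ [_ ]].
- move=> x y /k1W Cx /k2W [_ nCy] e; by rewrite e in Cx.
have [||||g [Gg gP gW]] := @glue_equiv G Gloc Gcan P P (W1 `|` W2) k cP _ _ Gk.
- exact: clopenU.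
- by move=> x [[]|[]].
- move=> _ [x [Wx|Wx] <-]; first by rewrite kW1//; apply: CP; exact: k1W.
  by rewrite kW2//; have [] := k2W _ Wx.
- exact: clopen_equiv_refl Gloc.1 _.
exists g; split=> // x Mx.
  have W1x : W1 x by split; [exact: MP|split; [exact: MV1|exact: MO]].
  by rewrite gW ?kW1//; [exact: k1W|left].
have W2x : W2 x by split; [exact: M'P|split; [exact: MV2|exact: nO]].
by rewrite gW ?kW2//; [have [] := k2W _ W2x|right].
Qed.

End avoidance.

(** * Coupled tower structures *)

(** For a full group this is its closure in the homeomorphism group. These are the admissible
    corrections: conjugating the other group by such a map keeps the common relation on clopen
    sets. *)
Definition type_preserving (G : set (X -> X)) : set (X -> X) :=
  [set u | homeomorphism u /\ forall C, clopen C -> clopen_equiv G C (u @` C)].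

Lemma type_preserving_sub (G : set (X -> X)) : homeo_subgroup G ->
  G `<=` type_preserving G.
Proof.
by move=> [Gh _ _ _] g Gg; split; [exact: Gh|move=> C cC; exists g].
Qed.

Lemma type_preserving_local (G : set (X -> X)) :
  local_group G -> cancellative G -> local_group (type_preserving G).
Proof.
move=> Gloc Gcan; have Ggrp := Gloc.1; split.
  split.
  - by move=> u [].
  - apply: type_preserving_sub => //; by case: Ggrp.
  - move=> u v [[u' uu'] uT] [[v' vv'] vT]; split.
      by exists (v' \o u'); exact: inverse_homeos_comp.
    move=> C cC; rewrite -image_comp.
    apply: (clopen_equiv_trans Ggrp (vT C cC)); apply: uT.
    exact: clopen_image vv' cC.
  - move=> u v [_ uT] uv; split; first by exists u; exact: inverse_homeos_sym.
    move=> C cC; apply: clopen_equiv_sym => //.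
    have cvC : clopen (v @` C) by exact: (clopen_image (inverse_homeos_sym uv)).
    have := uT _ cvC; rewrite image_comp (_ : u \o v = id) ?image_id//.
    by case: uv => _ _ _ vK; apply/funext.
move=> u [u' uu'] uloc; split; first by exists u'.
have [_ _ uK _] := uu'.
apply: clopen_ind => [x|A B cA cB AB uA uB].
  have [N [w [_ wT] uw]] := uloc x; exists N => C cC Cx.
  by rewrite (@eq_imagel _ _ C u w) => [|y /Cx/uw//]; exact: wT.
rewrite image_setU; apply: clopen_equivU => //.
rewrite -subset0 => z [[x Ax xz] [y By yz]].
have xy : x = y by rewrite -(uK x) -(uK y) xz yz.
by rewrite -[set0 z]/(set0 x) -AB; split; [exact: Ax|rewrite xy].
Qed.

Lemma clopen_equiv_type_preserving (G : set (X -> X)) u A B : homeo_subgroup G ->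
  type_preserving G u -> clopen A -> clopen B ->
  clopen_equiv G (u @` A) (u @` B) <-> clopen_equiv G A B.
Proof.
move=> Ggrp [_ uT] cA cB; split=> AB.
  apply: (clopen_equiv_trans Ggrp (uT A cA)); apply: (clopen_equiv_trans Ggrp AB).
  by apply: clopen_equiv_sym => //; exact: uT.
apply: (clopen_equiv_trans Ggrp (clopen_equiv_sym Ggrp (uT A cA))).
by apply: (clopen_equiv_trans Ggrp AB); exact: uT.
Qed.

Lemma inverse_homeos_conj (u u' g k : X -> X) : inverse_homeos u u' ->
  inverse_homeos g k -> inverse_homeos (u' \o g \o u) (u' \o k \o u).
Proof.
move=> uu' gk.
exact: (inverse_homeos_comp uu' (inverse_homeos_comp gk (inverse_homeos_sym uu'))).
Qed.

Section conjugation.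
Variables (u u' : X -> X) (uu' : inverse_homeos u u').

Let cu : continuous u. Proof. by case: uu'. Qed.
Let cu' : continuous u'. Proof. by case: uu'. Qed.
Let uK : cancel u u'. Proof. by case: uu'. Qed.
Let u'K : cancel u' u. Proof. by case: uu'. Qed.

Lemma locally_in_conj (G : set (X -> X)) r : locally_in G r ->
  locally_in (conj_group u' u G) (u' \o r \o u).
Proof.
move=> rG x; have [N [g Gg rg]] := rG (u x).
have [M Mu] := (continuous_agree u).1 cu x N.
exists M, (u' \o g \o u); first by exists g.
by move=> y /Mu/rg /= ->.
Qed.

Lemma conj_groupK (G : set (X -> X)) : conj_group u u' (conj_group u' u G) = G.
Proof.
have e (g : X -> X) : u \o (u' \o g \o u) \o u' = g.
  by apply/funext => x /=; rewrite !u'K.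
apply/seteqP; split=> [_ [_ [g Gg <-] <-]|g Gg]; first by rewrite e.
by exists (u' \o g \o u); [exists g|rewrite e].
Qed.

Lemma conj_subgroup (G : set (X -> X)) :
  homeo_subgroup G -> homeo_subgroup (conj_group u' u G).
Proof.
move=> Ggrp; have [Gh Gid Gc Gi] := Ggrp; split.
- move=> _ [g Gg <-]; have [k _ gk] := group_inv Ggrp Gg.
  by exists (u' \o k \o u); exact: inverse_homeos_conj.
- by exists idfun => //; apply/funext => x /=; rewrite uK.
- move=> _ _ [g Gg <-] [k Gk <-]; exists (g \o k); first exact: Gc.
  by apply/funext => x /=; rewrite u'K.
- move=> _ k [g Gg <-] gk; have [g' Gg' gg'] := group_inv Ggrp Gg.
  exists g' => //; apply: inverse_homeos_uniq gk.
  exact: inverse_homeos_conj.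
Qed.

Lemma clopen_equiv_conj (G : set (X -> X)) A B :
  clopen_equiv (conj_group u' u G) A B <-> clopen_equiv G (u @` A) (u @` B).
Proof.
split=> [[_ [g Gg <-] <-]|[g Gg gA]].
  exists g => //; rewrite !image_comp; apply: eq_imagel => x _ /=.
  by rewrite u'K.
exists (u' \o g \o u); first by exists g.
rewrite -image_comp -(image_comp g) gA image_comp (_ : u' \o u = id) ?image_id//.
by apply/funext.
Qed.

Lemma small_conj (G : set (X -> X)) K :
  small G K -> small (conj_group u' u G) (u @^-1` K).
Proof.
move=> Ksm A cA [a Aa].
have [||V [cV KV [B BA VB]]] := Ksm (u @` A).
- exact: clopen_image uu' cA.
- by exists (u a), a.
have uI C : u @` (u' @` C) = C.
  by rewrite image_comp (_ : u \o u' = id) ?image_id//; apply/funext.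
exists (u' @` V); split; first exact: (clopen_image (inverse_homeos_sym uu')).
  by move=> x /KV Vx; exists (u x).
exists (u' @` B); first by move=> _ [y /BA[x Ax <-] <-]; rewrite uK.
by apply/clopen_equiv_conj; rewrite !uI.
Qed.

Lemma tame_conj (G : set (X -> X)) : tame G -> tame (conj_group u' u G).
Proof.
move=> [[Ggrp Gloc] Gfix Gret]; split.
- split; first exact: conj_subgroup.
  move=> f [f' ff'] floc; exists (u \o f \o u'); last first.
    by apply/funext => x /=; rewrite !uK.
  apply: Gloc.
    exists (u \o f' \o u'); apply: inverse_homeos_conj ff'.
    exact: inverse_homeos_sym.
  move=> x; have [N [_ [g Gg <-] fg]] := floc (u' x).
  have [M Mu] := (continuous_agree u').1 cu' x N.
  by exists M, g => // y /Mu/fg /= ->; rewrite !u'K.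
- move=> _ [g Gg <-].
  rewrite (_ : [set x | _] = u @^-1` [set x | g x = x]).
    by apply: clopen_preimage => //; exact: Gfix.
  apply/seteqP; split=> x /= e; last by rewrite e uK.
  by rewrite -[in RHS]e u'K.
- move=> r _ rr rG [g Gg <-].
  have [|||r' [r'r' r'G rr' r'r r'g]] := Gret (u \o r \o u') g.
  + by move=> x /=; rewrite uK rr.
  + move=> x; have [N [_ [k Gk <-] rk]] := rG (u' x).
    have [M Mu] := (continuous_agree u').1 cu' x N.
    by exists M, k => // y /Mu/rk /= ->; rewrite !u'K.
  + by [].
  exists (u' \o r' \o u); split=> [x||x|x|x] /=.
  + by rewrite u'K r'r'.
  + exact: locally_in_conj.
  + by have := rr' (u x) => /= /(congr1 u'); rewrite uK.
  + by have := r'r (u x) => /=; rewrite uK => ->.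
  + by rewrite u'K r'g.
Qed.

End conjugation.

(* Only the values of [h] on [K] matter. *)
Record germ_matching (G : set (X -> X)) (K : set X) (H : set (X -> X)) (h : X -> X) : Prop := GermMatching {
  gm_tame : tame G ;
  gm_closed : closed K ;
  gm_small : small G K ;
  gm_continuous : forall x N, K x ->
    exists M, forall y, K y -> agree M x y -> agree N (h x) (h y) ;
  gm_germ : forall g x, G g -> K x -> K (g x) ->
    exists N, exists2 k, H k & forall y, K y -> agree N x y ->
      K (g y) /\ k (h y) = h (g y) }.

Lemma germ_matching_conj_target G K H h u u' : inverse_homeos u u' ->
  germ_matching G K H h -> germ_matching G K (conj_group u' u H) (u' \o h).
Proof.
move=> [cu cu' uK u'K] [Gt cK Ks hc hg]; split=> //.
- move=> x N Kx; have [M Mu] := (continuous_agree u').1 cu' (h x) N.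
  have [M' M'h] := hc x M Kx; exists M' => y Ky xy /=.
  by apply: Mu; exact: M'h.
- move=> g x Gg Kx Kgx; have [N [k Hk hk]] := hg g x Gg Kx Kgx.
  exists N, (u' \o k \o u); first by exists k.
  by move=> y Ky xy; have [Kgy e] := hk y Ky xy; split; rewrite //= u'K e.
Qed.

Lemma germ_matching_conj_source G K H h u u' : inverse_homeos u u' ->
  germ_matching G K H h -> germ_matching (conj_group u' u G) (u @^-1` K) H (h \o u).
Proof.
move=> uu' [Gt cK Ks hc hg]; have [cu cu' uK u'K] := uu'.
have uA x N := (continuous_agree u).1 cu x N.
split.
- exact: tame_conj.
- by apply: closed_comp => // x _; exact: cu.
- exact: small_conj.
- move=> x N Kx; have [M Mh] := hc (u x) N Kx; have [M' M'u] := uA x M.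
  by exists M' => y Ky /M'u; exact: Mh.
- move=> _ x [g Gg <-] Kx /=; rewrite /preimage /= u'K => Kgx.
  have [N [k Hk hk]] := hg g (u x) Gg Kx Kgx; have [M Mu] := uA x N.
  by exists M, k => // y Ky /Mu/(hk _ Ky)[]; rewrite !u'K.
Qed.

(** [mt_equiv] is an equality of relations on one space: the isomorphism of relations is absorbed in
    the choice of the intermediate copy. *)
Record matched (G H : set (X -> X)) (K L : set X) (h h' : X -> X) : Prop := Matched {
  mt_left : germ_matching G K H h ;
  mt_right : germ_matching H L G h' ;
  mt_equiv : forall A B, clopen A -> clopen B -> clopen_equiv G A B <-> clopen_equiv H A B ;
  mt_cancel : cancellative G ;
  mt_hK : forall x, K x -> L (h x) /\ h' (h x) = x ;
  mt_hL : forall y, L y -> K (h' y) /\ h (h' y) = y }.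

(* A unit system: the atoms are the [E]-classes, and
   [r] carries each atom onto a chosen atom of its orbit, the base being
   [{x | r x = x}]. *)
Record tower (G H : set (X -> X)) (r : X -> X) (E : X -> X -> Prop) : Prop := Tower {
  tw_idem : forall x, r (r x) = r x ;
  tw_refl : forall x, E x x ;
  tw_sym : forall x y, E x y -> E y x ;
  tw_trans : forall x y z, E x y -> E y z -> E x z ;
  tw_open : exists N, forall x y, agree N x y -> E x y ;
  tw_classG : forall x, exists2 g, G g & forall y, E x y -> r y = g y ;
  tw_classH : forall x, exists2 g, H g & forall y, E x y -> r y = g y ;
  tw_inv : forall x y x', E x y -> r x' = r x -> exists y', E x' y' /\ r y' = r y ;
  tw_dom : forall x y, E x y -> r x = x -> r y = y }.

(* [h] maps the trace of [K] on each atom to the trace of [L] on the same atom,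
   and identifies the equivalence relations induced by [r] on [K] and on [L]. *)
Record coupled G H K L h h' r E : Prop := Coupled {
  cp_matched : matched G H K L h h' ;
  cp_tower : tower G H r E ;
  cp_h : forall x, K x -> E x (h x) ;
  cp_r : forall x y, K x -> K y -> r x = r y <-> r (h x) = r (h y) }.

Lemma matched_sym G H K L h h' : matched G H K L h h' -> matched H G L K h' h.
Proof.
move=> [hl hr he hc hK hL]; split=> //; first by move=> A B cA cB; rewrite he.
have Hgrp := (tame_local (gm_tame hr)).1.
move=> P Q A B cA cP AP BQ PQ AB.
have cQ := clopen_equiv_clopen Hgrp PQ cP; have cB := clopen_equiv_clopen Hgrp AB cA.
by apply/he; [exact: clopen_D|exact: clopen_D|apply: hc => //; apply/he].
Qed.

Lemma tower_sym G H r E : tower G H r E -> tower H G r E.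
Proof. by case. Qed.

Lemma coupled_sym G H K L h h' r E :
  coupled G H K L h h' r E -> coupled H G L K h' h r E.
Proof.
move=> [mt tw hE hr]; have [_ _ _ _ hK hL] := mt; split.
- exact: matched_sym.
- exact: tower_sym.
- by move=> y Ly; have [Kh'y e] := hL y Ly; rewrite -{1}e; apply: (tw_sym tw); exact: hE.
- move=> x y Lx Ly; have [Kx ex] := hL x Lx; have [Ky ey] := hL y Ly.
  by rewrite (hr _ _ Kx Ky) ex ey.
Qed.

Lemma matched_conj G H K L h h' u u' : inverse_homeos u u' -> type_preserving G u ->
  matched G H K L h h' ->
  matched G (conj_group u' u H) K (u @^-1` L) (u' \o h) (h' \o u).
Proof.
move=> uu' uT [hl hr he hc hK hL]; have [_ _ uK u'K] := uu'; split.
- exact: germ_matching_conj_target.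
- exact: germ_matching_conj_source.
- move=> A B cA cB; have Ggrp := (tame_local (gm_tame hl)).1.
  rewrite clopen_equiv_conj// -he; try exact: clopen_image uu' _.
  by rewrite clopen_equiv_type_preserving.
- exact: hc.
- by move=> x Kx; have [Lx e] := hK x Kx; rewrite /preimage /= u'K.
- by move=> y /= Ly; have [Kx e] := hL _ Ly; rewrite e uK.
Qed.

(** * Lifting and patching maps along a unit system *)

Section towers.
Variables (G H : set (X -> X)) (r : X -> X) (E : X -> X -> Prop).
Hypotheses (Gloc : local_group G) (Gcan : cancellative G) (tw : tower G H r E).

Lemma tower_locally : locally_in G r.
Proof.
move=> x; have [N NE] := tw_open tw; have [g Gg rg] := tw_classG tw x.
by exists N, g => // y /NE; exact: rg.
Qed.

Lemma tower_inj x y : E x y -> r x = r y -> x = y.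
Proof.
have [g Gg rg] := tw_classG tw x => xy.
have [k _ [_ _ gK _]] := group_inv Gloc.1 Gg.
by rewrite rg ?rg//; [exact: (can_inj gK)|exact: tw_refl tw _].
Qed.

(** The atom of [r x] contains a point [z] over [r y]; as this atom lies in the base, [z] equals
    [r y]. *)
Lemma tower_r x y : E x y -> E (r x) (r y).
Proof.
move=> xy; have [z [Ez rz]] := tw_inv tw xy (tw_idem tw x).
by have := tw_dom tw Ez (tw_idem tw x); rewrite rz => e; rewrite e.
Qed.

Lemma class_clopen x : clopen [set y | E x y].
Proof.
have [N NE] := tw_open tw; apply/clopen_agree; exists N => y z yz xy.
by apply: (tw_trans tw) xy _; exact: NE.
Qed.

Lemma class_eq x y : E x y -> [set z | E x z] = [set z | E y z].
Proof.
move=> xy; apply/seteqP; split=> z; last exact: (tw_trans tw).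
by apply: (tw_trans tw); exact: (tw_sym tw).
Qed.

(** [u x] is the only point of the atom of [x] lying above [v (r x)]. This lift commutes with [r],
    so conjugating by it does not disturb the tower. *)
Lemma tower_lift v v' : inverse_homeos v v' -> type_preserving G v ->
  (forall z, E z (v z)) ->
  exists u u', [/\ inverse_homeos u u', type_preserving G u, forall x, E x (u x),
    forall x, r (u x) = u (r x) & forall x, r (u x) = v (r x)].
Proof.
move=> vv' vT Ev; have [cv cv' vK v'K] := vv'.
have Ev' z : E z (v' z) by apply: (tw_sym tw); rewrite -{2}(v'K z); exact: Ev.
have lift w : (forall z, E z (w z)) -> forall x, exists y, E x y /\ r y = w (r x).
  move=> Ew x; have [y [xy ry]] := tw_inv tw (Ew (r x)) (esym (tw_idem tw x)).
  by exists y; split=> //; rewrite ry; apply: (tw_dom tw (Ew (r x))); exact: tw_idem tw x.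
have /choice[u uP] := lift v Ev; have /choice[u' u'P] := lift v' Ev'.
have uK : cancel u u'.
  move=> x; have [xu ru] := uP x; have [uu ruu] := u'P (u x).
  apply/esym/tower_inj; first exact: (tw_trans tw) xu uu.
  by rewrite ruu ru vK.
have u'K : cancel u' u.
  move=> x; have [xu ru] := u'P x; have [uu ruu] := uP (u' x).
  apply/esym/tower_inj; first exact: (tw_trans tw) xu uu.
  by rewrite ruu ru v'K.
have Tloc := type_preserving_local Gloc Gcan.
have [_ _ Tcomp _] := Tloc.1.
have GT := type_preserving_sub Gloc.1.
have uloc : locally_in (type_preserving G) u.
  move=> x; have [N NE] := tw_open tw; have [g Gg rg] := tw_classG tw x.
  have [k Gk [_ _ gK _]] := group_inv Gloc.1 Gg.
  exists N, (k \o (v \o g)); first by apply: (Tcomp); [exact: GT|apply: (Tcomp) => //; exact: GT].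
  move=> y /NE xy /=; have [yu ru] := uP y.
  by rewrite -rg// -ru rg ?gK//; exact: (tw_trans tw) xy yu.
have uT : type_preserving G u by exact: local_group_bij uloc uK u'K.
exists u, u'; split=> //.
- have [k Tk kk] := group_inv Tloc.1 uT.
  suff -> : u' = k by [].
  by apply/funext => x; case: kk => _ _ _ kK; rewrite -{1}(kK x) uK.
- by move=> x; case: (uP x).
- move=> x; have [_ ru] := uP x; have [rxu rru] := uP (r x).
  rewrite ru -[RHS](tw_dom tw rxu (tw_idem tw x)) rru.
  by rewrite (tw_idem tw).
- by move=> x; case: (uP x).
Qed.

(** One problem per atom of [D], solved independently. The solution is chosen for the atom as a set,
    not for its points, so that the same one serves throughout the atom. *)
Lemma tower_patch (F : set (X -> X)) (D : set X) (R : set X -> (X -> X) -> Prop) :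
  local_group F -> (forall x y, E x y -> D x -> D y) ->
  (forall z, D z -> exists g, [/\ F g, g @` [set y | E z y] = [set y | E z y] &
     R [set y | E z y] g]) ->
  exists v v', [/\ inverse_homeos v v', F v, forall z, E z (v z),
    forall z, ~ D z -> v z = z &
    forall z, D z -> exists2 g, R [set y | E z y] g & forall w, E z w -> v w = g w].
Proof.
move=> Floc DE Fz.
pose good P g := [/\ F g, g @` P = P & R P g].
have /choice[V V_P] : forall P : set X, exists g, (exists k, good P k) -> good P g.
  move=> P; have [[k gk]|nk] := pselect (exists k, good P k); first by exists k.
  by exists id => /nk.
pose cls z := [set y | E z y].
have clsE x y : E x y -> cls x = cls y by exact: class_eq.
have VP z : D z -> good (cls z) (V (cls z)) by move=> /Fz gz; exact: V_P.
pose v z := if pselect (D z) then V (cls z) z else z.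
have vD z : D z -> v z = V (cls z) z by rewrite /v; case: pselect.
have vN z : ~ D z -> v z = z by rewrite /v; case: pselect.
have Ev z : E z (v z).
  have [Dz|nDz] := pselect (D z); last by rewrite vN//; exact: (tw_refl tw).
  rewrite vD//; have [_ VE _] := VP z Dz.
  have : (V (cls z) @` cls z) (V (cls z) z) by exists z => //; exact: (tw_refl tw).
  by rewrite VE.
have v_inj : injective v.
  move=> x y xy; have Exy : E x y.
    by apply: (tw_trans tw (Ev x)); rewrite xy; apply: (tw_sym tw).
  have [Dx|nDx] := pselect (D x).
    have Dy := DE x y Exy Dx; move: xy; rewrite !vD// -(clsE _ _ Exy).
    have [FV _ _] := VP x Dx; have [k _ [_ _ VK _]] := group_inv Floc.1 FV.
    exact: can_inj VK _ _.
  have nDy : ~ D y by move=> Dy; apply: nDx; apply: DE Dy; exact: (tw_sym tw).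
  by move: xy; rewrite !vN.
have v_surj y : exists x, v x = y.
  have [Dy|nDy] := pselect (D y); last by exists y; rewrite vN.
  have [_ VE _] := VP y Dy.
  have [x Ex xy] : (V (cls y) @` cls y) y by rewrite VE; exact: (tw_refl tw).
  by exists x; rewrite vD; [rewrite -(clsE _ _ Ex)|exact: DE Ex Dy].
have /choice[v' v'K] := v_surj.
have vK : cancel v v' by move=> x; apply: v_inj; rewrite v'K.
have vloc : locally_in F v.
  move=> x; have [N NE] := tw_open tw; exists N.
  have [Dx|nDx] := pselect (D x).
    have [FV _ _] := VP x Dx; exists (V (cls x)) => // y /NE xy.
    by rewrite vD -?(clsE _ _ xy)//; exact: DE xy Dx.
  exists idfun; first by case: Floc.1.
  by move=> y /NE xy; rewrite vN// => Dy; apply: nDx; apply: DE Dy; exact: (tw_sym tw).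
have Fv : F v by exact: local_group_bij vloc vK v'K.
exists v, v'; split=> //.
  have [k Fk kk] := group_inv Floc.1 Fv.
  suff -> : v' = k by [].
  by apply/funext => x; case: kk => _ _ _ kK; rewrite -{1}(kK x) vK.
move=> z Dz; have [FV _ RV] := VP z Dz; exists (V (cls z)) => // w zw.
by rewrite vD -?(clsE _ _ zw)//; exact: DE zw Dz.
Qed.

End towers.

Lemma closed_image_continuous (r : X -> X) S : continuous r -> closed S -> closed (r @` S).
Proof.
move=> cr cS; apply: compact_closed; first exact: cantor_space_hausdorff.
apply: continuous_compact; first exact: continuous_subspaceT.
by apply: (subclosed_compact cS cantor_space_compact).
Qed.

(* The point [r x1] may be close to [r x] through another sheet of [r]; an
   element of [G] then moves [x1] close to [x], and keeps it in [K]. *)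
Lemma near_sheet G H K L h h' r E x M : coupled G H K L h h' r E -> K x ->
  exists N, forall x1, K x1 -> agree N (r x) (r x1) ->
    exists x2, [/\ K x2, r x2 = r x1 & agree M x x2].
Proof.
move=> [[hl _ _ _ _ _] tw _ _] Kx.
have Gloc := tame_local (gm_tame hl).
suff [N NP] : exists N, forall x1, K x1 -> agree N (r x) (r x1) ->
    exists x2, [/\ K x2, r x2 = r x1 & agree M x x2] by exists N.
apply: uniform_level => [N1 N2 x1 N12 NP Kx1 /(agreeW N12)|x0]; first exact: NP.
have [Kx0|nKx0] := pselect (K x0); last first.
  have [N NK] := (open_agree _).1 (closed_openC (gm_closed hl)) x0 nKx0.
  by exists N => y /NK.
have cr : continuous r := locally_in_continuous Gloc.1 (tower_locally tw).
have [e|ne] := pselect (r x0 = r x); last first.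
  have [i nei] : exists i, r x0 i <> r x i.
    by apply: contrapT => h0; apply: ne; apply/funext => i; apply: contrapT => ?; apply: h0; exists i.
  have [N Nr] := (continuous_agree r).1 cr x0 i.+1.
  exists (maxn N i.+1) => y xy _ xy'; case: nei.
  rewrite (Nr y (agreeW (leq_maxl _ _) xy) i (ltnSn i)) (xy' i)//.
  by rewrite leq_max ltnSn orbT.
have [g0 Gg0 rg0] := tw_classG tw x0; have [g1 Gg1 rg1] := tw_classG tw x.
have [k1 Gk1 [_ _ g1K k1K]] := group_inv Gloc.1 Gg1.
have [_ _ Gc _] := Gloc.1.
pose j := k1 \o g0; have Gj : G j by exact: Gc.
have jx0 : j x0 = x.
  by rewrite /j /= -rg0 ?e ?rg1 ?g1K//; exact: (tw_refl tw).
have [|N1 [k Hk N1P]] := gm_germ hl Gj Kx0; first by rewrite jx0.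
have [N2 NE] := tw_open tw.
have [_ _ [cj _ _ _]] := group_inv Gloc.1 Gj.
have [N3 N3j] := (continuous_agree j).1 cj x0 (maxn M N2).
exists (maxn N1 (maxn N2 N3)) => y xy Ky _.
have xy1 := agreeW (leq_maxl _ _) xy; have xy' := agreeW (leq_maxr _ _) xy.
have := N3j y (agreeW (leq_maxr _ _) xy'); rewrite jx0 => xjy.
have [Kjy _] := N1P y Ky xy1.
exists (j y); split=> //; last exact: agreeW (leq_maxl _ _) xjy.
rewrite rg1; last by apply: NE; exact: agreeW (leq_maxr _ _) xjy.
rewrite /j /= k1K rg0//; apply: NE; exact: agreeW (leq_maxl _ _) xy'.
Qed.

Section coupled.
Variables (G H : set (X -> X)) (K L : set X) (h h' r : X -> X) (E : X -> X -> Prop).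
Hypothesis cp : coupled G H K L h h' r E.

Let mt := cp_matched cp.
Let tw := cp_tower cp.
Let hl := mt_left mt.
Let hr := mt_right mt.
Let Gloc := tame_local (gm_tame hl).
Let Hloc := tame_local (gm_tame hr).
Let cr : continuous r := locally_in_continuous Gloc.1 (tower_locally tw).

Lemma near_sheet_image x M : K x ->
  exists N, forall x1, K x1 -> agree N (r (h x)) (r (h x1)) ->
    exists x2, [/\ K x2, r x2 = r x1 & agree M x x2].
Proof.
move=> Kx; have [Lhx hhx] := mt_hK mt Kx.
have [M' M'h] := gm_continuous hr M Lhx.
have [N NP] := near_sheet M' (coupled_sym cp) Lhx.
exists N => x1 Kx1 xx1; have [Lhx1 hhx1] := mt_hK mt Kx1.
have [y [Ly ry xy]] := NP _ Lhx1 xx1; have [Kh'y hh'y] := mt_hL mt Ly.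
exists (h' y); split=> //; first by apply/(cp_r cp Kh'y Kx1); rewrite hh'y.
by have := M'h y Ly xy; rewrite hhx.
Qed.

(** [g] is lifted from the base to [j = k2 g g1], which takes [x] to [x']; germ matching turns [j]
    into [k] in [H], and [d = d2 k e1] brings [k] down to the base. *)
Lemma base_germ g x x' : G g -> K x -> K x' -> g (r x) = r x' ->
  exists M, exists2 d, H d & forall y, K y -> agree M x y ->
    exists y', [/\ K y', g (r y) = r y' & d (r (h y)) = r (h y')].
Proof.
move=> Gg Kx Kx' gx.
have [g1 Gg1 rg1] := tw_classG tw x; have [g2 Gg2 rg2] := tw_classG tw x'.
have [k2 Gk2 [_ _ g2K k2K]] := group_inv Gloc.1 Gg2.
have [d1 Hd1 rd1] := tw_classH tw (h x); have [d2 Hd2 rd2] := tw_classH tw (h x').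
have [e1 He1 [_ _ d1K e1K]] := group_inv Hloc.1 Hd1.
have [_ _ Gc _] := Gloc.1; have [_ _ Hc _] := Hloc.1.
pose j := k2 \o (g \o g1); have Gj : G j by apply: (Gc) => //; apply: (Gc).
have jx : j x = x'.
  by rewrite /j /= -rg1 ?gx ?rg2 ?g2K//; exact: (tw_refl tw).
have [|N1 [k Hk N1P]] := gm_germ hl Gj Kx; first by rewrite jx.
have [N2 NE] := tw_open tw.
have [_ _ [cj _ _ _]] := group_inv Gloc.1 Gj.
have [N3 N3j] := (continuous_agree j).1 cj x N2.
have Eh a b : K a -> K b -> E a b -> E (h a) (h b).
  move=> Ka Kb ab; apply: (tw_trans tw) (cp_h cp Kb).
  by apply: (tw_trans tw) ab; apply: (tw_sym tw); exact: (cp_h cp Ka).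
exists (maxn N1 (maxn N2 N3)), (d2 \o (k \o e1)).
  by apply: (Hc) => //; apply: (Hc).
move=> y Ky xy; have xy1 := agreeW (leq_maxl _ _) xy; have xy' := agreeW (leq_maxr _ _) xy.
have := N3j y (agreeW (leq_maxr _ _) xy'); rewrite jx => /NE Exjy.
have Exy := NE _ _ (agreeW (leq_maxl _ _) xy').
have [Kjy khy] := N1P y Ky xy1.
exists (j y); split=> //; first by rewrite (rg2 _ Exjy) /j /= k2K rg1.
rewrite /= rd1; last exact: Eh.
by rewrite d1K khy rd2//; exact: Eh.
Qed.

(** Closeness is now measured at [r (h y)], which may approach [r (h x)] through another sheet;
    [near_sheet_image] first replaces [y] by a point near [x] in the same fibre. This is the local
    form that [extend_partial] demands. *)
Lemma base_germ_image g x x' : G g -> K x -> K x' -> g (r x) = r x' ->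
  exists N, exists2 d, H d & forall y y', K y -> K y' ->
    agree N (r (h x)) (r (h y)) -> g (r y) = r y' -> d (r (h y)) = r (h y').
Proof.
move=> Gg Kx Kx' gx; have [M [d Hd MP]] := base_germ Gg Kx Kx' gx.
have [N NP] := near_sheet_image M Kx.
exists N, d => // y y' Ky Ky' xy gy.
have [x2 [Kx2 rx2 xx2]] := NP y Ky xy.
have [y2 [Ky2 gx2 dx2]] := MP x2 Kx2 xx2.
have <- : r (h x2) = r (h y) by exact: (cp_r cp Kx2 Ky).1.
by rewrite dx2; apply: (cp_r cp Ky2 Ky').1; rewrite -gx2 rx2.
Qed.

Lemma closed_base_image F : closed F -> F `<=` K -> closed [set r (h x) | x in F].
Proof.
move=> cF FK; rewrite -(image_comp h r); apply: closed_image_continuous => //.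
rewrite -openC; apply/open_agree => y nFy.
have [Ly|nLy] := pselect (L y); last first.
  have [N NL] := (open_agree _).1 (closed_openC (gm_closed hr)) y nLy.
  by exists N => z /NL nLz [x Fx xz]; apply: nLz; rewrite -xz; case: (mt_hK mt (FK _ Fx)).
have [Kh'y hh'y] := mt_hL mt Ly.
have nF : ~ F (h' y) by move=> Fh'y; apply: nFy; exists (h' y).
have [N NF] := (open_agree _).1 (closed_openC cF) _ nF.
have [M Mh'] := gm_continuous hr N Ly.
exists M => z yz [x Fx xz]; have [Lhx hhx] := mt_hK mt (FK _ Fx).
by apply: (NF x) => //; rewrite -hhx; apply: Mh' => //; rewrite xz.
Qed.

Lemma small_base_image F : F `<=` K -> small H [set r (h x) | x in F].
Proof.
move=> FK; apply: (@small_sub _ (r @` L)).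
  by move=> _ [x Fx <-]; exists (h x) => //; case: (mt_hK mt (FK _ Fx)).
apply: small_locally => //; last exact: gm_small hr.
- exact: mt_cancel (matched_sym mt).
- exact: tower_locally (tower_sym tw).
Qed.

Lemma base_class x : K x -> E (r x) (r (h x)).
Proof. by move=> Kx; apply: (tower_r tw); exact: cp_h cp _ Kx. Qed.

End coupled.

(** * Refining and merging a coupled unit system *)

Lemma tower_conj G H r E u u' : inverse_homeos u u' ->
  (forall x, E x (u x)) -> (forall x, r (u x) = u (r x)) ->
  tower G H r E -> tower G (conj_group u' u H) r E.
Proof.
move=> [_ _ uK _] Eu ru [t1 t2 t3 t4 t5 t6 t7 t8 t9]; split=> // x.
have [k Hk rk] := t7 (u x); exists (u' \o k \o u); first by exists k.
move=> y xy /=; rewrite -rk ?ru ?uK//.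
by apply: ((t4) _ _ _ _ (Eu y)); apply: ((t4) _ _ _ _ xy); exact: t3.
Qed.

(** [C] is tested at [r x], so that all atoms over one base atom are cut alike. *)
Definition refine (r : X -> X) (E : X -> X -> Prop) (C : set X) : X -> X -> Prop :=
  fun x y => E x y /\ (C (r x) <-> C (r y)).

Lemma tower_refine G H r E C : homeo_subgroup G -> clopen C ->
  tower G H r E -> tower G H r (refine r E C).
Proof.
move=> Ggrp cC tw.
have cCr : clopen (r @^-1` C).
  exact: clopen_preimage (locally_in_continuous Ggrp (tower_locally tw)) cC.
move: tw => [t1 t2 t3 t4 t5 t6 t7 t8 t9]; split=> //.
- by move=> x y [xy Cxy]; split; [exact: t3|exact: iff_sym].
- by move=> x y z [xy Cxy] [yz Cyz]; split; [exact: t4 yz|exact: iff_trans Cyz].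
- have [N NE] := t5; have /clopen_agree[M MC] := cCr.
  exists (maxn N M) => x y xy; split; first by apply: NE; exact: agreeW (leq_maxl _ _) xy.
  have {}xy := agreeW (leq_maxr _ _) xy.
  by split; apply: MC => //; exact: agree_sym.
- by move=> x; have [g Gg rg] := t6 x; exists g => // y [/rg].
- by move=> x; have [g Gg rg] := t7 x; exists g => // y [/rg].
- move=> x y x' [xy Cxy] xx'; have [y' [xy' yy']] := t8 _ _ _ xy xx'.
  by exists y'; split=> //; split=> //; rewrite xx' yy'.
- by move=> x y [xy _]; exact: t9.
Qed.

(** The cut may separate [x] from [h x]. In each base atom [split_avoid] gives an element of [H]
    bringing [r (h x)] to the side of [C] where [r x] lies; lifting the inverse of the patched map
    gives the correction. *)
Lemma coupled_split G H K L h h' r E C : coupled G H K L h h' r E -> clopen C ->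
  exists u u', [/\ inverse_homeos u u', type_preserving G u, forall x, E x (u x),
    forall x, r (u x) = u (r x) &
    coupled G (conj_group u' u H) K (u @^-1` L) (u' \o h) (h' \o u) r (refine r E C)].
Proof.
move=> cp cC; have [mt tw hE hr] := cp.
have Gloc := tame_local (gm_tame (mt_left mt)).
have Hloc := tame_local (gm_tame (mt_right mt)).
have Gcan := mt_cancel mt; have Hcan := mt_cancel (matched_sym mt).
have cr := locally_in_continuous Gloc.1 (tower_locally tw).
have cK := gm_closed (mt_left mt).
pose R P (g : X -> X) := forall x, K x -> P (r x) -> C (r x) <-> C (g (r (h x))).
have RP z : r z = z -> exists g, [/\ H g, g @` [set y | E z y] = [set y | E z y] &
    R [set y | E z y] g].
  move=> rz; have cP := class_clopen tw z; set P := [set y | E z y] in cP *.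
  pose F1 := K `&` r @^-1` (P `&` C); pose F2 := K `&` r @^-1` (P `\` C).
  have F1K : F1 `<=` K by move=> x [].
  have F2K : F2 `<=` K by move=> x [].
  have cF1 : closed F1.
    by apply: closedI => //; apply: (clopen_preimage cr _).2; exact: clopenI.
  have cF2 : closed F2.
    by apply: closedI => //; apply: (clopen_preimage cr _).2; exact: clopen_D.
  have MP x : K x -> P (r x) -> P (r (h x)).
    by move=> Kx Px; apply: (tw_trans tw) Px _; exact: base_class cp _ Kx.
  have [|||||||||||g [Hg gP gF1 gF2]] := @split_avoid H Hloc Hcan P (P `&` C)
    [set r (h x) | x in F1] [set r (h x) | x in F2] cP.
  - exact: clopenI.
  - by move=> x [].
  - by move=> _ [x [Kx [Px _]] <-]; exact: MP.
  - by move=> _ [x [Kx [Px _]] <-]; exact: MP.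
  - exact: (closed_base_image cp).
  - exact: (closed_base_image cp).
  - rewrite -subset0 => z0 [[x [Kx [_ Cx]] xz] [y [Ky [_ nCy]] yz]].
    by apply: nCy; rewrite -((hr _ _ Kx Ky).2 _)// xz yz.
  - exact: (small_base_image cp).
  - exact: (small_base_image cp).
  - move=> PC; rewrite -subset0 => z0 [x [_ PCx] _].
    by rewrite -[set0 z0]/(set0 (r x)) -PC.
  - move=> PC; rewrite -subset0 => z0 [x [_ [Px nCx]] _].
    by rewrite -[set0 z0]/(set0 (r x)) -PC; split=> // -[].
  exists g; split=> // x Kx Px; split=> [Cx|Cgx].
    by have [] := gF1 (r (h x)); first by exists x.
  apply: contrapT => nCx; apply: (gF2 (r (h x))); first by exists x.
  split=> //; rewrite -gP; exists (r (h x)) => //; exact: MP.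
have [v [v' [vv' Hv Ev _ vR]]] := tower_patch tw Hloc (@tw_dom _ _ _ _ tw) RP.
have HT : H `<=` type_preserving G.
  move=> k Hk; split; first by case: Hloc.1 => + _ _ _; apply.
  by move=> B cB; apply/(mt_equiv mt) => //; [have [k' _ kk'] := group_inv Hloc.1 Hk; exact: clopen_image kk' cB|exists k].
have Tv' : type_preserving G v'.
  have [_ _ _ Ti] := (type_preserving_local Gloc Gcan).1.
  exact: Ti (HT _ Hv) vv'.
have Ev' z : E z (v' z).
  have := Ev (v' z); case: vv' => _ _ _ ->; exact: (tw_sym tw).
(* The inverse [v'] is lifted because [h] becomes [u' \o h], and [r (u' y)] is then [v (r y)]. *)
have [u [u' [uu' Tu Eu ru ruv]]] := tower_lift Gloc Gcan tw (inverse_homeos_sym vv') Tv' Ev'.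
have [_ _ vK v'K] := vv'; have [_ _ uK u'K] := uu'.
have ru' y : r (u' y) = v (r y) by rewrite -{2}(u'K y) ruv v'K.
exists u, u'; split=> //; split.
- exact: matched_conj.
- by apply: tower_refine => //; [exact: Gloc.1|exact: tower_conj].
- move=> x Kx; have Ex := hE x Kx; split.
    by apply: (tw_trans tw Ex); apply: (tw_sym tw); have := Eu (u' (h x)); rewrite u'K.
  rewrite /= ru'; have [g Rg vg] := vR (r x) (tw_idem tw x).
  rewrite vg; last exact: base_class cp _ Kx.
  by apply: Rg => //; exact: (tw_refl tw).
- move=> x y Kx Ky; rewrite /= !ru'; rewrite (hr x y Kx Ky).
  by split=> [->//|]; exact: (can_inj vK).
Qed.

Lemma matched_type_preserving G H K L h h' :
  matched G H K L h h' -> H `<=` type_preserving G.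
Proof.
move=> mt k Hk; have Hgrp := (tame_local (gm_tame (mt_right mt))).1.
have [k' _ kk'] := group_inv Hgrp Hk; split; first by exists k'.
by move=> B cB; apply/(mt_equiv mt) => //; [exact: clopen_image kk' cB|exists k].
Qed.

(** Whether [j] sends [r x] back into [r K] is a relatively clopen condition on [x] in [K]: closed
    since [r K] is compact, open by [base_germ]. *)
Lemma base_trace_closed G H K L h h' r E j S : coupled G H K L h h' r E ->
  G j -> clopen S ->
  closed (K `&` r @^-1` (S `&` j @^-1` (r @` K))) /\
  closed (K `&` r @^-1` (S `\` j @^-1` (r @` K))).
Proof.
move=> cp Gj cS; have [mt tw _ _] := cp.
have Gloc := tame_local (gm_tame (mt_left mt)).
have cr := locally_in_continuous Gloc.1 (tower_locally tw).
have cK := gm_closed (mt_left mt).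
have [_ _ [cj _ _ _]] := group_inv Gloc.1 Gj.
have cKD : closed (r @` K) by exact: closed_image_continuous.
split.
  apply: closedI => //; apply: closed_comp => [x _|]; first exact: cr.
  apply: closedI; first by case: cS.
  by apply: closed_comp => // x _; exact: cj.
rewrite -openC; apply/open_agree => x nx.
have [Kx|nKx] := pselect (K x); last first.
  have [N NK] := (open_agree _).1 (closed_openC cK) x nKx.
  by exists N => y /NK nKy [].
have [N NS] := clopen_near x (clopen_preimage cr cS).
have [Sx|nSx] := pselect (S (r x)); last first.
  by exists N => y /NS e [_ [Sy _]]; apply: nSx; apply/e.
have [x' Kx' jx] : (r @` K) (j (r x)) by apply: contrapT => h0; apply: nx.
have [M [d Hd MP]] := base_germ cp Gj Kx Kx' (esym jx).
exists M => y xy [Ky [_]]; apply.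
by have [y' [Ky' jy _]] := MP y Ky xy; exists y'.
Qed.

(** [B] is the part of the base to be removed; the fibres above it are redirected through [g].
    Below, [BE] and [gBE] say that [B] is a union of atoms which [g] carries onto atoms. *)
Definition merge (r : X -> X) (B : set X) (g : X -> X) : X -> X :=
  fun x => if pselect (B (r x)) then g (r x) else r x.

Section merge.
Variables (G H : set (X -> X)) (K L : set X) (h h' r : X -> X) (E : X -> X -> Prop).
Hypothesis cp : coupled G H K L h h' r E.
Variables (B : set X) (g : X -> X).
Hypotheses (Br : forall z, B z -> r z = z) (Gg : G g)
  (gBr : forall z, B z -> r (g z) = g z) (gBB : forall z, B z -> ~ B (g z))
  (BE : forall z w, B z -> E z w -> B w /\ E (g z) (g w))
  (gBE : forall z w, B z -> E (g z) w -> exists w', [/\ B w', E z w' & w = g w']).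

Let mt := cp_matched cp.
Let tw := cp_tower cp.
Let hl := mt_left mt.
Let hr := mt_right mt.
Let Gloc := tame_local (gm_tame hl).
Let Hloc := tame_local (gm_tame hr).
Let Gcan := mt_cancel mt.
Let Hcan := mt_cancel (matched_sym mt).

Let rB x : B (r x) -> merge r B g x = g (r x).
Proof. by rewrite /merge; case: pselect. Qed.

Let rN x : ~ B (r x) -> merge r B g x = r x.
Proof. by rewrite /merge; case: pselect. Qed.

Let BrE x y : E x y -> B (r x) -> B (r y).
Proof. by move=> /(tower_r tw) xy Bx; case: (BE Bx xy). Qed.

Let g_inj : injective g.
Proof. by have [k _ [_ _ gK _]] := group_inv Gloc.1 Gg; exact: can_inj gK. Qed.

(* [d] extends the map that [h] makes of [g] on the base points coming from
   [K], and avoids the base points coming from [L] everywhere else. *)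
Lemma merge_delta z : B z -> let P := [set y | E z y] in
  exists d, [/\ H d, d @` P = g @` P,
    forall x x', K x -> K x' -> P (r x) -> g (r x) = r x' -> d (r (h x)) = r (h x') &
    forall x x', K x -> K x' -> P (r x) -> d (r (h x)) = r (h x') -> g (r x) = r x'].
Proof.
move=> Bz; set P := [set y | _]; set Q := g @` P.
have [k Gk gk] := group_inv Gloc.1 Gg; have [cg ck gK kK] := gk.
have cP : clopen P := class_clopen tw z.
have QE : Q = [set y | E (g z) y].
  apply/seteqP; split=> [_ [y Ey <-]|y gzy]; first by case: (BE Bz Ey).
  by have [w [_ zw ->]] := gBE Bz gzy; exists w.
have cQ : clopen Q by rewrite QE; exact: class_clopen tw _.
pose KD := r @` K.
pose KP := K `&` r @^-1` P; pose KQ := K `&` r @^-1` Q.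
pose Z0 := K `&` r @^-1` (P `&` g @^-1` KD).
have [cZ0 cNZ0] := base_trace_closed cp Gg cP.
have [cZ1 cNZ1] := base_trace_closed cp Gk cQ.
have cr := locally_in_continuous Gloc.1 (tower_locally tw).
have cKP : closed KP.
  by apply: closedI (gm_closed hl) (clopen_preimage cr cP).2.
have cKQ : closed KQ.
  by apply: closedI (gm_closed hl) (clopen_preimage cr cQ).2.
have subK (S : set X) : K `&` S `<=` K by move=> x [].
pose M := [set r (h x) | x in KP]; pose M' := [set r (h x) | x in KQ].
pose Z := [set r (h x) | x in Z0].
(* The partial map that [h] makes of [g]; [cp_r] makes it single-valued. Where it is undefined, [f]
   takes the default value [y]. *)
pose rel y w := exists x x', [/\ K x /\ K x', P (r x), y = r (h x), g (r x) = r x' & w = r (h x')].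
have /choice[f f_P] : forall y, exists w, (exists w', rel y w') -> rel y w.
  by move=> y; have [[w yw]|nw] := pselect (exists w', rel y w'); [exists w|exists y => /nw].
have fE x x' : K x -> K x' -> P (r x) -> g (r x) = r x' -> f (r (h x)) = r (h x').
  move=> Kx Kx' Px gx.
  have [|x1 [x1' [[Kx1 Kx1'] _ e1 gx1 ->]]] := f_P (r (h x)).
    by exists (r (h x')), x, x'.
  apply: (cp_r cp Kx1' Kx').1; rewrite -gx1 -gx; congr g.
  by apply/(cp_r cp Kx1 Kx).
have Px_h x : K x -> P (r x) -> P (r (h x)).
  by move=> Kx Px; apply: (tw_trans tw Px); exact: base_class cp _ Kx.
have Qx_h x : K x -> Q (r x) <-> Q (r (h x)).
  move=> Kx; have e := base_class cp Kx; rewrite QE /=; split=> Qx.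
    exact: (tw_trans tw Qx e).
  exact: (tw_trans tw Qx (tw_sym tw e)).
have PQ : clopen_equiv H P Q by apply/(mt_equiv mt) => //; exists g.
have ZP x x' : K x -> K x' -> P (r x) -> g (r x) = r x' -> Z0 x.
  by move=> Kx Kx' Px gx; split=> //; split=> //; exists x'.
(* The complements are rewritten as images of sets that [base_trace_closed] shows to be closed;
   [MZ'] does this with the inverse [k]. *)
have MZ : M `\` Z = [set r (h x) | x in K `&` r @^-1` (P `\` g @^-1` KD)].
  apply/seteqP; split=> [_ [[x [Kx Px] <-] nZ]|_ [x [Kx [Px nKD]] <-]].
    exists x => //; split=> //; split=> // KDx; apply: nZ; exists x => //.
  split; first by exists x.
  by move=> [y [Ky [_ KDy]] /(cp_r cp Ky Kx).2 xy]; apply: nKD; rewrite /preimage /= -xy.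
have fZM : f @` Z `<=` M'.
  move=> _ [_ [x [Kx [Px [x' Kx' gx]]] <-] <-]; rewrite (fE x x')//.
  exists x' => //; split=> //; rewrite /preimage /= gx; by exists (r x).
have MZ' : M' `\` f @` Z = [set r (h x) | x in K `&` r @^-1` (Q `\` k @^-1` KD)].
  apply/seteqP; split=> [_ [[x' [Kx' Qx'] <-] nZ]|_ [x' [Kx' [Qx' nKD]] <-]].
    exists x' => //; split=> //; split=> // -[x Kx kx]; apply: nZ.
    have Px : P (r x) by case: Qx' => y Py gy; rewrite kx -gy gK.
    have gx : g (r x) = r x' by rewrite kx kK.
    by exists (r (h x)); [exists x => //; exact: ZP gx|exact: fE].
  split; first by exists x'.
  move=> [_ [x [Kx [Px [x1 Kx1 gx]]] <-]]; rewrite (fE x x1)// => /(cp_r cp Kx1 Kx').2 e.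
  by apply: nKD; exists x; rewrite // -e gx gK.
have [|||||||||||||d [Hd dP dZ dM]] := @extend_avoid H Hloc Hcan P Q M M' Z f cP PQ.
- by move=> _ [x [Kx Px] <-]; exact: Px_h.
- by move=> _ [x [Kx Qx] <-]; apply/(Qx_h x Kx).
- by apply: (closed_base_image cp) => //; exact: subK.
- by apply: (closed_base_image cp) => //; exact: subK.
- by apply: (small_base_image cp); exact: subK.
- by apply: (small_base_image cp); exact: subK.
- by move=> _ [x [Kx [Px _]] <-]; exists x.
- by apply: (closed_base_image cp) => //; exact: subK.
- by rewrite MZ; apply: (closed_base_image cp) => //; exact: subK.
- exact: fZM.
- by rewrite MZ'; apply: (closed_base_image cp) => //; exact: subK.
- move=> _ [x [Kx [Px [x' Kx' gx]]] <-].
  have [N [d Hd NP]] := base_germ_image cp Gg Kx Kx' (esym gx).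
  exists N, d => // _ [y [Ky [Py [y' Ky' gy]]] <-] xy.
  by rewrite (fE y y')// (NP y y').
- move=> _ _ [x [Kx [Px [x' Kx' gx]]] <-] [y [Ky [Py [y' Ky' gy]]] <-].
  rewrite (fE x x')// (fE y y')// => /(cp_r cp Kx' Ky').2; rewrite gx gy => /g_inj.
  exact: (cp_r cp Kx Ky).1.
exists d; split=> // x x' Kx Kx' Px.
  by move=> gx; rewrite dZ ?(fE x x')//; exists x => //; exact: ZP gx.
move=> dx; have [[x1 Kx1 gx1]|nKD] := pselect (KD (g (r x))).
  rewrite -gx1; apply/(cp_r cp Kx1 Kx'); rewrite -dx -(fE x x1)// dZ//.
  by exists x => //; exact: ZP (esym gx1).
(* Here [r (h x)] is in [M] but not in [Z], so [d] sends it off [M'], although [r (h x')] lies in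
   [M']. *)
exfalso; apply: (dM (r (h x))).
- by exists x.
- move=> [y [Ky [_ KDy]] /(cp_r cp Ky Kx).2 xy]; apply: nKD; by rewrite -xy.
- rewrite dx; exists x' => //; split=> //; apply/(Qx_h x' Kx').
  by rewrite -dx -dP; exists (r (h x)) => //; exact: Px_h.
Qed.

(** [H'] is left open because the second group realizes the merged retraction only after the
    conjugation made in [coupled_merge]. *)
Lemma tower_merge H' :
  (forall x, exists2 d, H' d & forall y, E x y -> merge r B g y = d y) ->
  tower G H' (merge r B g) E.
Proof.
move=> mH; have [t1 t2 t3 t4 t5 t6 t7 t8 t9] := tw; split=> //.
- move=> x; have [Bx|nBx] := pselect (B (r x)).
    by rewrite (rB Bx) rN gBr//; exact: gBB.
  by rewrite (rN nBx) rN t1.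
- move=> x; have [k Gk rk] := t6 x; have [Bx|nBx] := pselect (B (r x)).
    exists (g \o k); first by case: Gloc.1 => _ _ + _; apply.
    by move=> y xy; rewrite (rB (BrE xy Bx)) rk.
  exists k => // y xy; have nBy : ~ B (r y).
      by move=> By; apply: nBx; exact: (BrE (t3 _ _ xy) By).
    by rewrite rN// rk.
- move=> x y x' xy; have rxy := tower_r tw xy.
  have [Bx|nBx] := pselect (B (r x)); have [Bx'|nBx'] := pselect (B (r x')).
  + rewrite (rB Bx) (rB Bx') (rB (BrE xy Bx)) => /g_inj xx'.
    have [y' [xy' yy']] := t8 _ _ _ xy xx'.
    by exists y'; split=> //; rewrite rB yy'//; exact: (BrE xy Bx).
  + rewrite (rN nBx') (rB Bx) (rB (BrE xy Bx)) => xx'.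
    have [By gxy] := BE Bx rxy.
    have [y' [xy' yy']] := t8 _ _ x' gxy (etrans (esym (t1 x')) (congr1 r xx')).
    have e : r y' = g (r y) by rewrite yy' gBr.
    by exists y'; split=> //; rewrite rN e//; exact: gBB.
  + have nBy : ~ B (r y) by move=> By; apply: nBx; exact: (BrE (t3 _ _ xy) By).
    rewrite (rB Bx') (rN nBx) (rN nBy) => xx'.
    have [w [Bw x'w yw]] : exists w, [/\ B w, E (r x') w & r y = g w].
      by apply: gBE => //; rewrite xx'.
    have [y' [xy' yy']] := t8 _ _ x' x'w (esym (t1 x')).
    have e : r y' = w by rewrite yy' Br.
    by exists y'; split=> //; rewrite rB e.
  + have nBy : ~ B (r y) by move=> By; apply: nBx; exact: (BrE (t3 _ _ xy) By).
    rewrite (rN nBx) (rN nBx') (rN nBy) => xx'; have [y' [xy' yy']] := t8 _ _ _ xy xx'.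
    by exists y'; split=> //; rewrite rN yy'.
- move=> x y xy; have [Bx|nBx] := pselect (B (r x)).
    rewrite rB// => gx; exfalso; apply: (gBB Bx); rewrite gx.
    by have := gBr Bx; rewrite gx => e; rewrite -e.
  rewrite rN// => rx; rewrite rN; first exact: t9 xy rx.
  by move=> By; apply: nBx; exact: (BrE (t3 _ _ xy) By).
Qed.

(** [r (w x)] and [w (r x)] lie in one atom and have the same merged value, and the merged
    retraction is injective on atoms. Thus corrections made for the merged tower respect the earlier
    one. *)
Lemma merge_stab H' w :
  (forall x, exists2 d, H' d & forall y, E x y -> merge r B g y = d y) ->
  (forall x, E x (w x)) -> (forall x, merge r B g (w x) = w (merge r B g x)) ->
  forall x, r (w x) = w (r x).
Proof.
move=> mH Ew mw x; have tm := tower_merge mH.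
apply: (tower_inj Gloc tm).
  apply: (tw_trans tw _ (Ew (r x))); apply: (tw_sym tw).
  exact: tower_r tw _ _ (Ew x).
have mr y : merge r B g (r y) = merge r B g y by rewrite /merge (tw_idem tw).
by rewrite mr !mw mr.
Qed.

(** [H] need not contain [g], but has the [d] of [merge_delta] for each atom of [B]. Conjugating by
    a lift of [v = d^-1 g], the identity off [B], turns [d] into [g] on the base; the two
    implications on [d] then say that [h] respects the merged retraction. *)
Lemma coupled_merge : exists u u',
  [/\ inverse_homeos u u', type_preserving G u, forall x, E x (u x),
    forall x, r (u x) = u (r x) &
    coupled G (conj_group u' u H) K (u @^-1` L) (u' \o h) (h' \o u) (merge r B g) E].
Proof.
pose compat P d :=
  (forall x x', K x -> K x' -> P (r x) -> g (r x) = r x' -> d (r (h x)) = r (h x')) /\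
  (forall x x', K x -> K x' -> P (r x) -> d (r (h x)) = r (h x') -> g (r x) = r x').
pose R P f := exists d d', [/\ H d, inverse_homeos d d', f = d' \o g & compat P d].
have Tloc := type_preserving_local Gloc Gcan.
have GT := type_preserving_sub Gloc.1.
have HT := matched_type_preserving mt.
have [_ _ Tcomp _] := Tloc.1.
have RP z : B z -> exists f, [/\ type_preserving G f,
    f @` [set y | E z y] = [set y | E z y] & R [set y | E z y] f].
  move=> Bz; have [d [Hd dP d1 d2]] := merge_delta Bz.
  have [d' Hd' dd'] := group_inv Hloc.1 Hd.
  exists (d' \o g); split; last by exists d, d'.
  - by apply: (Tcomp); [exact: HT|exact: GT].
  - rewrite -image_comp -dP image_comp (_ : d' \o d = id) ?image_id//.
    by apply/funext => x; case: dd' => _ _ dK _; exact: dK.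
have BE' x y : E x y -> B x -> B y by move=> xy /BE/(_ xy)[].
have [v [v' [vv' Tv Ev vN vR]]] := tower_patch tw Tloc BE' RP.
have [u [u' [uu' Tu Eu ru ruv]]] := tower_lift Gloc Gcan tw vv' Tv Ev.
have [_ _ vK v'K] := vv'; have [_ _ uK u'K] := uu'.
have ru' y : r (u' y) = v' (r y) by rewrite -{2}(u'K y) ruv vK.
have Ev' z : E z (v' z) by have := Ev (v' z); rewrite v'K; exact: (tw_sym tw).
have BEv' z : B (v' z) <-> B z.
  by split; apply: BE'; [apply: (tw_sym tw)|]; exact: Ev'.
have v'N z : ~ B z -> v' z = z by move=> nBz; rewrite -{1}(vN z nBz) vK.
have u_base z : r z = z -> u z = v z by move=> rz; rewrite -rz -ru ruv.
have mH x : exists2 d, conj_group u' u H d & forall y, E x y -> merge r B g y = d y.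
  have [k Hk rk] := tw_classH tw (u x).
  have Eux y : E x y -> E (u x) (u y).
    move=> xy; apply: (tw_trans tw _ (Eu y)); apply: (tw_trans tw _ xy).
    exact: (tw_sym tw).
  have [Bx|nBx] := pselect (B (r x)).
    have [f [d [d' [Hd [_ _ dK d'K] fE _]]] vf] := vR (r x) Bx.
    exists (u' \o (d \o k) \o u).
      by exists (d \o k) => //; case: Hloc.1 => _ _ + _; apply.
    move=> y xy; have By := BrE xy Bx; rewrite (rB By) /=.
    rewrite -(rk _ (Eux y xy)) ruv vf; last exact: tower_r tw _ _ xy.
    rewrite fE /= d'K.
    (* [g (r y)] is a base point off [B], where [v], and so [u], is the identity. *)
    have e : u (g (r y)) = g (r y) by rewrite u_base ?gBr// vN//; exact: gBB.
    by rewrite -{2}e uK.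
  exists (u' \o k \o u); first by exists k.
  move=> y xy; rewrite rN; last by move=> By; apply: nBx; exact: (BrE (tw_sym tw xy) By).
  by rewrite /= -rk ?ru ?uK//; exact: Eux.
have BrK x : K x -> B (r (h x)) <-> B (r x).
  move=> Kx; have e := base_class cp Kx.
  by split; apply: BE' => //; exact: (tw_sym tw).
have cross x y : K x -> K y -> B (r x) -> ~ B (r y) ->
    g (r x) = r y <-> g (v' (r (h x))) = r (h y).
  move=> Kx Ky Bx nBy.
  have [f [d [d' [Hd [_ _ dK d'K] fE [c1 c2]]]] vf] := vR (r x) Bx.
  have -> : g (v' (r (h x))) = d (r (h x)).
    have := vf (v' (r (h x))) (tw_trans tw (base_class cp Kx) (Ev' _)).
    by rewrite v'K fE /= => e; rewrite [in RHS]e d'K.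
  by split; [apply: c1|apply: c2] => //; exact: (tw_refl tw).
exists u, u'; split=> //; split.
- exact: matched_conj.
- exact: tower_merge.
- move=> x Kx; apply: (tw_trans tw (cp_h cp Kx)); apply: (tw_sym tw).
  by have := Eu (u' (h x)); rewrite u'K.
- have mE x : K x -> merge r B g (u' (h x)) =
      if pselect (B (r x)) then g (v' (r (h x))) else r (h x).
    move=> Kx; case: pselect => Bx /=.
      by rewrite rB ru'//; apply/BEv'; apply/BrK.
    have nBh : ~ B (r (h x)) by move=> /(BrK x Kx).
    by rewrite rN ru' ?v'N// => /BEv'.
  move=> x y Kx Ky; rewrite /= !mE//.
  case: pselect => Bx /=; case: pselect => By /=.
  + rewrite (rB Bx) (rB By); split=> [/g_inj/(cp_r cp Kx Ky).1 -> //|/g_inj e].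
    by congr g; apply/(cp_r cp Kx Ky); exact: (can_inj v'K).
  + by rewrite (rB Bx) (rN By); exact: cross.
  + rewrite (rN Bx) (rB By).
    by split=> /esym/(cross y x Ky Kx By Bx) /esym.
  + by rewrite (rN Bx) (rN By); exact: cp_r cp _ _ Kx Ky.
Qed.

End merge.

(** * Steps of the back-and-forth *)

Definition stab (r : X -> X) (E : X -> X -> Prop) (w : X -> X) :=
  (forall x, E x (w x)) /\ (forall x, r (w x) = w (r x)).

(* Conjugating [H] by [u] turns the coupling along [(r, E)] into one along
   [(r1, E1)]; all later corrections [w] respect the structure [(r, E)]. *)
Definition reach G H K L h h' r E r1 E1 := exists u u',
  [/\ inverse_homeos u u', stab r E u, stab r1 E1 `<=` stab r E,
    forall x y, E1 x y -> E x y & coupled G (conj_group u' u H) K (u @^-1` L) (u' \o h) (h' \o u) r1 E1].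

Lemma conj_group_comp (H : set (X -> X)) (u1 u1' u2 u2' : X -> X) :
  conj_group u2' u2 (conj_group u1' u1 H) = conj_group (u2' \o u1') (u1 \o u2) H.
Proof.
apply/seteqP; split=> [_ [_ [k Hk <-] <-]|_ [k Hk <-]]; first by exists k.
by exists (u1' \o k \o u1) => //; exists k.
Qed.

Lemma conj_group_id (H : set (X -> X)) : conj_group id id H = H.
Proof. by apply/seteqP; split=> [_ [k Hk <-]|k Hk] //; exists k. Qed.

Lemma reach_refl G H K L h h' r E :
  coupled G H K L h h' r E -> reach G H K L h h' r E r E.
Proof.
move=> cp; exists id, id; split=> //; first exact: inverse_homeos_id.
  by split=> // x; exact: (tw_refl (cp_tower cp)).
by rewrite conj_group_id.
Qed.

Lemma reach_trans G H K L h h' r E r1 E1 r2 E2 :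
  coupled G H K L h h' r E -> reach G H K L h h' r E r1 E1 ->
  (forall H1 L1 h1 h1', coupled G H1 K L1 h1 h1' r1 E1 ->
    reach G H1 K L1 h1 h1' r1 E1 r2 E2) ->
  reach G H K L h h' r E r2 E2.
Proof.
move=> cp [u1 [u1' [uu1 st1 s1 sE1 cp1]]] /(_ _ _ _ _ cp1).
move=> [u2 [u2' [uu2 st2 s2 sE2 cp2]]].
exists (u1 \o u2), (u2' \o u1'); split.
- exact: inverse_homeos_comp.
- have [Eu2 ru2] := s1 _ st2; have [Eu1 ru1] := st1; split=> x /=.
    exact: (tw_trans (cp_tower cp) (Eu2 x) (Eu1 _)).
  by rewrite ru1 ru2.
- by move=> w /s2/s1.
- by move=> x y /sE2/sE1.
- by rewrite -conj_group_comp.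
Qed.

Lemma reach_split G H K L h h' r E C : coupled G H K L h h' r E -> clopen C ->
  reach G H K L h h' r E r (refine r E C).
Proof.
move=> cp cC; have [u [u' [uu' _ Eu ru cp']]] := coupled_split cp cC.
exists u, u'; split=> // [w [Ew rw]|x y [//]].
by split=> // x; case: (Ew x).
Qed.

(** [E1] is fixed before [H], [L] and [h] are given: each cut changes these, and the induction goes
    on with the changed ones. *)
Lemma reach_refine (T : eqType) (C : T -> set X) (l : seq T) G K r E :
  (forall t, clopen (C t)) ->
  exists E1, (forall x y, E1 x y <-> E x y /\ forall t, t \in l -> C t (r x) <-> C t (r y)) /\
  forall H L h h', coupled G H K L h h' r E -> reach G H K L h h' r E r E1.
Proof.
move=> cC; elim: l E => [|t l IH] E.
  by exists E; split=> [x y|H L h h' cp]; [split=> [|[]]|exact: reach_refl].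
have [E1 [E1P E1r]] := IH (refine r E (C t)); exists E1; split=> [x y|H L h h' cp].
  rewrite E1P /refine; split=> [[[xy ct] cl]|[xy cl]].
    by split=> // s; rewrite inE => /orP[/eqP->|/cl].
  split; first by split=> //; apply: cl; rewrite inE eqxx.
  by move=> s sl; apply: cl; rewrite inE sl orbT.
exact: reach_trans cp (reach_split cp (cC t)) E1r.
Qed.

Lemma reach_refine_rel G H K L h h' r E (F : X -> X -> Prop) :
  coupled G H K L h h' r E ->
  (forall x, F x x) -> (forall x y, F x y -> F y x) ->
  (forall x y z, F x y -> F y z -> F x z) ->
  (forall x, exists N, forall y, agree N x y -> F x y) ->
  exists E1, (forall x y, E1 x y <-> E x y /\ F (r x) (r y)) /\
  reach G H K L h h' r E r E1.
Proof.
move=> cp Fxx Fs Ft Floc.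
have [N NF] : exists N, forall x y, agree N x y -> F x y.
  apply: uniform_level => [M N x MN H0 y /(agreeW MN)|x]; first exact: H0.
  have [N NF] := Floc x; exists N => y xy z yz.
  apply: (Ft _ x); first exact/Fs/NF.
  by apply: NF; exact: agree_trans xy yz.
have [s sN] := finite_net N.
have cF t : clopen [set y | F t y].
  by apply/clopen_agree; exists N => x y /NF xy tx; exact: Ft tx xy.
have [E1 [E1P E1r]] := @reach_refine X (fun t => [set y | F t y]) s G K r E cF.
exists E1; split=> [x y|]; last exact: E1r.
rewrite E1P; split=> -[xy Fxy]; split=> //.
  have [t ts /NF trx] := sN (r x).
  by apply: (Ft _ t); [exact: Fs|apply/(Fxy t ts)].
by move=> t _; split=> tz; [exact: Ft tz Fxy|exact: Ft tz (Fs _ _ Fxy)].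
Qed.

(** Cuts are only seen through [r], so cylinders are replaced by their images under [r]. A point of
    the atom whose image lies in such a set is in the cylinder itself, because [r] is injective on
    atoms. *)
Lemma reach_fine G H K L h h' r E N : coupled G H K L h h' r E ->
  exists E1, (forall x y, E1 x y -> agree N x y) /\ reach G H K L h h' r E r E1.
Proof.
move=> cp; have tw := cp_tower cp; have [M ME] := tw_open tw.
have Gloc := tame_local (gm_tame (mt_left (cp_matched cp))).
pose m := maxn N M.
pose C t := r @` [set y | agree m t y].
have cC t : clopen (C t).
  have [g Gg rg] := tw_classG tw t; have [g' _ gg'] := group_inv Gloc.1 Gg.
  rewrite /C (@eq_imagel _ _ _ r g) => [|y /(agreeW (leq_maxr _ _))/ME/rg//].
  apply: clopen_image gg' _; apply/clopen_agree; exists m => x y xy tx.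
  exact: agree_trans tx xy.
have [s sm] := finite_net m.
have [E1 [E1P E1r]] := @reach_refine X C s G K r E cC.
exists E1; split=> [x y /E1P[xy Cxy]|]; last exact: E1r.
have [t ts tx] := sm x.
have [w tw' rw] : C t (r y) by apply/(Cxy t ts); exists x.
have Etw : E t w by apply: ME; exact: agreeW (leq_maxr _ _) tw'.
have Etx : E t x by apply: ME; exact: agreeW (leq_maxr _ _) tx.
suff <- : w = y by apply: agree_trans (agree_sym (agreeW (leq_maxl _ _) tx)) (agreeW (leq_maxl _ _) tw').
apply: (tower_inj Gloc tw) rw; apply: (tw_trans tw (tw_sym tw Etw)).
exact: (tw_trans tw Etx xy).
Qed.

(** [F] records what makes [g] carry atoms of [B] onto atoms: membership in [B] and in [g B], and
    the old atom of the image under [g] or its inverse. *)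
Lemma reach_merge G H K L h h' r E B g : coupled G H K L h h' r E ->
  clopen B -> G g -> (forall z, B z -> r z = z) -> (forall z, B z -> r (g z) = g z) ->
  (forall z, B z -> ~ B (g z)) ->
  exists E1, reach G H K L h h' r E (merge r B g) E1.
Proof.
move=> cp cB Gg Br gBr gBB.
have tw := cp_tower cp; have Gloc := tame_local (gm_tame (mt_left (cp_matched cp))).
have [k Gk [cg ck gK kK]] := group_inv Gloc.1 Gg.
pose F z w := [/\ B z <-> B w, B (k z) <-> B (k w), B z -> E (g z) (g w) & B (k z) -> E (k z) (k w)].
have Er := tw_refl tw; have Es := tw_sym tw; have Et := tw_trans tw.
have [||||E1 [E1P E1r]] := @reach_refine_rel G H K L h h' r E F cp.
- by move=> x; split.
- move=> x y [b1 b2 b3 b4]; split; [exact: iff_sym|exact: iff_sym| |].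
    by move=> By; apply: (Es); apply: b3; apply/b1.
  by move=> By; apply: (Es); apply: b4; apply/b2.
- move=> x y z [b1 b2 b3 b4] [c1 c2 c3 c4]; split.
  + exact: iff_trans b1 c1.
  + exact: iff_trans b2 c2.
  + by move=> Bx; apply: (Et) (b3 Bx) _; apply: c3; apply/b1.
  + by move=> Bx; apply: (Et) (b4 Bx) _; apply: c4; apply/b2.
- move=> x; have [N1 P1] := clopen_near x cB.
  have [N2 P2] := clopen_near x (clopen_preimage ck cB).
  have [M ME] := tw_open tw.
  have [N3 P3] := (continuous_agree g).1 cg x M; have [N4 P4] := (continuous_agree k).1 ck x M.
  exists (maxn (maxn N1 N2) (maxn N3 N4)) => y xy.
  have xy12 := agreeW (leq_maxl _ _) xy; have xy34 := agreeW (leq_maxr _ _) xy.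
  split.
  + exact: P1 (agreeW (leq_maxl _ _) xy12).
  + exact: P2 (agreeW (leq_maxr _ _) xy12).
  + by move=> _; apply: ME; exact: P3 (agreeW (leq_maxl _ _) xy34).
  + by move=> _; apply: ME; exact: P4 (agreeW (leq_maxr _ _) xy34).
exists E1; apply: (reach_trans cp E1r) => H1 L1 h1 h1' cp1.
have nBk z : B z -> ~ B (k z) by move=> Bz /gBB; rewrite kK.
have BE z w : B z -> E1 z w -> B w /\ E1 (g z) (g w).
  move=> Bz /E1P[zw]; rewrite (Br z Bz) (tw_dom tw zw (Br z Bz)) => -[b1 b2 b3 b4].
  have Bw : B w by apply/b1.
  split=> //; apply/E1P; split; first exact: b3.
  rewrite !gBr//; split; rewrite ?gK//.
  - by split=> Bg; [case: (gBB z Bz)|case: (gBB w Bw)].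
  - by move=> Bg; case: (gBB z Bz).
have gBE z w : B z -> E1 (g z) w -> exists w', [/\ B w', E1 z w' & w = g w'].
  move=> Bz /E1P[zw]; rewrite (gBr z Bz) (tw_dom tw zw (gBr z Bz)) => -[b1 b2 b3 b4].
  rewrite !gK in b2 b4; have Bkw : B (k w) by apply/b2.
  exists (k w); split=> //; apply/E1P; split; first exact: b4.
  rewrite (Br z Bz) (Br _ Bkw); split=> //.
  - by split=> Bk; [case: (nBk z Bz)|case: (nBk _ Bkw)].
  - by rewrite kK.
  - by move=> Bk; case: (nBk z Bz).
have [u [u' [uu' _ Eu ru cp2]]] := coupled_merge cp1 Br Gg gBr gBB BE gBE.
exists u, u'; split=> // w [Ew mw]; split=> //.
exact: (merge_stab cp1 Br Gg gBr gBB BE gBE (tw_classH (cp_tower cp2)) Ew mw).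
Qed.

(** [l] lists elements realizing [r'] on the base points it moves. A merge by its head [g] removes
    those with [r' x = g x], after which the tail suffices; with an empty list the retractions
    coincide. *)
Lemma reach_retract G K r' (l : seq (X -> X)) : tame G ->
  (forall x, r' (r' x) = r' x) -> locally_in G r' -> {in l, forall g, G g} ->
  forall H L h h' r E, coupled G H K L h h' r E ->
  (forall x, r (r' x) = r' x) -> (forall x, r' (r x) = r' x) ->
  (forall x, r x = x -> r' x = x \/ exists2 g, g \in l & r' x = g x) ->
  exists E1, reach G H K L h h' r E r' E1.
Proof.
move=> Gt r'r' r'G; have Gloc := tame_local Gt; have Gid : G idfun by case: Gloc.1.
have idG : locally_in G id by move=> x; exists 0%N, idfun.
elim: l => [_|g l IH lG] H L h h' r E cp rr' r'r lr.
  have -> : r' = r.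
    apply/funext => x; rewrite -r'r.
    by have [//|[]] := lr (r x) (tw_idem (cp_tower cp) x).
  by exists E; exact: reach_refl.
have Gg : G g by apply: lG; exact: mem_head.
have gG : locally_in G g by move=> x; exists 0%N, g.
have rG := tower_locally (cp_tower cp).
have eqc := equalizer_clopen Gloc (tame_fix Gt).
pose B := [set x | r x = x] `&` (~` [set x | r' x = x] `&` [set x | r' x = g x]).
have cr : clopen [set x | r x = x] by exact: (eqc _ _ rG idG).
have cr' : clopen [set x | r' x = x] by exact: (eqc _ _ r'G idG).
have cB : clopen B.
  exact: clopenI cr (clopenI (clopenC set0 cr') (eqc _ _ r'G gG)).
have [|||E1 rE1] := @reach_merge G H K L h h' r E B g cp cB Gg.
- by move=> z [].
- by move=> z [_ [_ /= <-]].
- by move=> z [_ [_ /= gz]] [_ [+ _]]; rewrite -gz; apply; exact: r'r'.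
have nBr' x : ~ B (r' x) by move=> [_ [+ _]]; apply; exact: r'r'.
have [u [u' [uu' st s sE cp1]]] := rE1.
have [||||E2 rE2] := IH _ _ _ _ _ _ _ cp1.
- by move=> k kl; apply: lG; rewrite inE kl orbT.
- by move=> x; rewrite /merge rr'; case: pselect => // Bx; case: (nBr' x Bx).
- move=> x; rewrite /merge; case: pselect => [Bx|nBx] /=; last exact: r'r.
  by have [_ [_ /= <-]] := Bx; rewrite r'r' r'r.
- move=> x; rewrite /merge; case: pselect => [Bx|nBx] /= mx.
    exfalso; have [_ [_ /= gx]] := Bx.
    by apply: (nBr' (r x)); rewrite gx mx; move: Bx; rewrite -{1}mx -gx r'r rr' => Bx; rewrite -mx -gx r'r.
  have [->|[k + kx]] := lr x mx; [by left|rewrite inE => /orP[/eqP kg|kl]].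
    left; apply: contrapT => r'x; apply: nBx; rewrite mx; split=> //; split=> //=.
    by rewrite kx kg.
  by right; exists k.
exists E2; have [u2 [u2' [uu2 st2 s2 sE2 cp2]]] := rE2.
exists (u \o u2), (u2' \o u'); split.
- exact: inverse_homeos_comp.
- have [Eu2 ru2] := s _ st2; have [Eu1 ru1] := st; split=> x /=.
    exact: (tw_trans (cp_tower cp) (Eu2 x) (Eu1 _)).
  by rewrite ru1 ru2.
- by move=> w /s2/s.
- by move=> x y /sE2/sE.
- by rewrite -conj_group_comp.
Qed.

Lemma reach_element G H K L h h' r E g : coupled G H K L h h' r E -> G g ->
  exists r1 E1, (forall x, r1 (g x) = r1 x) /\ reach G H K L h h' r E r1 E1.
Proof.
move=> cp Gg; have Gt := gm_tame (mt_left (cp_matched cp)).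
have [r' [r'r' r'G rr' r'r r'g]] := tame_retract Gt (tw_idem (cp_tower cp))
  (tower_locally (cp_tower cp)) Gg.
have [N NG] := uniformly_in r'G.
have [l [lG lr]] := finite_choice NG.
have [|E1 rE1] := reach_retract Gt r'r' r'G lG cp rr' r'r.
  by move=> x _; right; exact: lr.
by exists r', E1.
Qed.

(** * The limit conjugacy *)

Lemma uniformly_continuous (f : X -> X) n : continuous f ->
  exists N, forall x y, agree N x y -> agree n (f x) (f y).
Proof.
move=> /continuous_agree cf; apply: uniform_level => [M N x MN H0 y /(agreeW MN)|x].
  exact: H0.
have [N Nf] := cf x n; exists N => y xy z yz.
by apply: agree_trans (agree_sym (Nf y xy)) (Nf z _); exact: agree_trans xy yz.
Qed.

(** Agreement to depth [n] covers the coordinates below [n], so coordinate [i] is read at stage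
    [i.+1]. *)
Definition pointwise_limit (f : nat -> X -> X) : X -> X := fun x i => f i.+1 x i.

Lemma pointwise_limit_agree (f : nat -> X -> X) :
  (forall m n x, (n <= m)%N -> agree n (f m x) (f n x)) ->
  forall n x, agree n (pointwise_limit f x) (f n x).
Proof. by move=> fC n x i iN; rewrite /pointwise_limit (fC n i.+1 x iN i (ltnSn i)). Qed.

Lemma pointwise_limit_continuous (f : nat -> X -> X) :
  (forall m n x, (n <= m)%N -> agree n (f m x) (f n x)) ->
  (forall n, continuous (f n)) -> continuous (pointwise_limit f).
Proof.
move=> fC cf; apply/continuous_agree => x N.
have fA := pointwise_limit_agree fC.
have [M Mf] := (continuous_agree (f N)).1 (cf N) x N.
exists M => y /Mf xy; apply: agree_trans (fA N x) _; apply: agree_trans xy _.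
exact/agree_sym/fA.
Qed.

Lemma pointwise_limitK (f g : nat -> X -> X) :
  (forall m n x, (n <= m)%N -> agree n (f m x) (f n x)) ->
  (forall m n x, (n <= m)%N -> agree n (g m x) (g n x)) ->
  (forall n, continuous (g n)) -> (forall n, cancel (f n) (g n)) ->
  cancel (pointwise_limit f) (pointwise_limit g).
Proof.
move=> fC gC cg fgK x; apply: agree_all => N.
set F := pointwise_limit f.
have [M Mg] := (continuous_agree (g N)).1 (cg N) (F x) N.
pose m := maxn M N.
have e1 : agree N (g N (F x)) (g N (f m x)).
  by apply: Mg; apply: agreeW (leq_maxl M N) _; exact: pointwise_limit_agree.
have e2 : agree N (g m (f m x)) (g N (f m x)) by apply: gC; exact: leq_maxr.
apply: agree_trans (pointwise_limit_agree gC (n := N) (F x)) _.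
by rewrite fgK in e2; exact: agree_trans e1 (agree_sym e2).
Qed.

Lemma limit_homeos (a a' : nat -> X -> X) :
  (forall n, inverse_homeos (a n) (a' n)) ->
  (forall m n x, (n <= m)%N -> agree n (a m x) (a n x)) ->
  (forall m n x, (n <= m)%N -> agree n (a' m x) (a' n x)) ->
  inverse_homeos (pointwise_limit a) (pointwise_limit a').
Proof.
move=> aa' aC a'C; split.
- by apply: pointwise_limit_continuous => // n; case: (aa' n).
- by apply: pointwise_limit_continuous => // n; case: (aa' n).
- by apply: pointwise_limitK => // n; case: (aa' n).
- by apply: pointwise_limitK => // n; case: (aa' n).
Qed.

Lemma limit_commute (a : nat -> X -> X) s' r M0 :
  (forall m n x, (n <= m)%N -> agree n (a m x) (a n x)) ->
  continuous s' -> continuous r ->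
  (forall m x, (M0 <= m)%N -> r (s' (a m x)) = s' (a m (r x))) ->
  forall x, r (s' (pointwise_limit a x)) = s' (pointwise_limit a (r x)).
Proof.
move=> aC cs cr rs x; apply: agree_all => N.
have aA := pointwise_limit_agree aC.
have [M1 M1P] := (continuous_agree (r \o s')).1
  (fun z => continuous_comp (cs z) (cr (s' z))) (pointwise_limit a x) N.
have [M2 M2P] := (continuous_agree s').1 cs (pointwise_limit a (r x)) N.
pose m := maxn M0 (maxn M1 M2).
have /M1P/= e1 : agree M1 (pointwise_limit a x) (a m x).
  apply: agreeW (aA m x); apply: leq_trans (leq_maxr _ _); exact: leq_maxl.
have /M2P e2 : agree M2 (pointwise_limit a (r x)) (a m (r x)).
  apply: agreeW (aA m (r x)); apply: leq_trans (leq_maxr _ _); exact: leq_maxr.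
apply: agree_trans e1 _; rewrite rs; last exact: leq_maxl.
exact: agree_sym.
Qed.

(** If [t] is [g1] near [x] and [g2] near [f x], invariance forces [f = g2^-1 g1] near [x]. This
    criterion puts the limit conjugates in the other group. *)
Lemma locally_in_invariant (G : set (X -> X)) t f f' : local_group G ->
  locally_in G t -> inverse_homeos f f' -> (forall x, t (f x) = t x) -> G f.
Proof.
move=> Gloc tG [cf _ fK f'K] tf; apply: (local_group_bij Gloc _ fK f'K) => x.
have [N1 [g1 Gg1 tg1]] := tG x; have [N2 [g2 Gg2 tg2]] := tG (f x).
have [k2 Gk2 [_ _ g2K k2K]] := group_inv Gloc.1 Gg2.
have [M Mf] := (continuous_agree f).1 cf x N2.
exists (maxn N1 M), (k2 \o g1); first by case: Gloc.1 => _ _ + _; apply.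
move=> y xy /=; rewrite -tg1; last exact: agreeW (leq_maxl _ _) xy.
by rewrite -tf tg2 ?g2K//; apply: Mf; exact: agreeW (leq_maxr _ _) xy.
Qed.

(* [s_a] and [s_b] are homeomorphisms from an intermediate copy of the Cantor
   space onto the spaces of the two groups; the conjugacy is [s_b \o s_a']. *)
Record state := State { s_a : X -> X ; s_a' : X -> X ; s_b : X -> X ; s_b' : X -> X ;
  s_r : X -> X ; s_E : X -> X -> Prop }.

(** From [s] to [t] both maps are composed on the right with corrections respecting the structure of
    [s]; the inclusion of stabilizers keeps this true over many steps. *)
Definition extends (s t : state) :=
  [/\ stab (s_r s) (s_E s) (s_a' s \o s_a t), stab (s_r s) (s_E s) (s_b' s \o s_b t),
    stab (s_r t) (s_E t) `<=` stab (s_r s) (s_E s) &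
    forall x y, s_E t x y -> s_E s x y].

Section back_and_forth.
Variables (G H : set (X -> X)) (K L : set X) (h h' : X -> X).

Definition good (s : state) :=
  [/\ inverse_homeos (s_a s) (s_a' s), inverse_homeos (s_b s) (s_b' s) &
    coupled (conj_group (s_a' s) (s_a s) G) (conj_group (s_b' s) (s_b s) H)
      (s_a s @^-1` K) (s_b s @^-1` L) (s_b' s \o h \o s_a s) (s_a' s \o h' \o s_b s)
      (s_r s) (s_E s)].

Lemma stab_id s : good s -> stab (s_r s) (s_E s) id.
Proof. by move=> [_ _ cp]; split=> // x; exact: (tw_refl (cp_tower cp)). Qed.

Lemma extends_trans s t w : good s -> extends s t -> inverse_homeos (s_a t) (s_a' t) ->
  inverse_homeos (s_b t) (s_b' t) -> extends t w -> extends s w.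
Proof.
move=> [_ _ cp] [ta tb ts tE] [_ _ _ aK] [_ _ _ bK] [wa wb ws wE]; split.
- have [Ew rw] := ts _ wa; have [Et rt] := ta; split=> x /=.
    by have := tw_trans (cp_tower cp) (Ew x) (Et _); rewrite /= aK.
  by have := rt (s_a' t (s_a w x)); rewrite /= aK => ->; have := rw x => /= ->; rewrite aK.
- have [Ew rw] := ts _ wb; have [Et rt] := tb; split=> x /=.
    by have := tw_trans (cp_tower cp) (Ew x) (Et _); rewrite /= bK.
  by have := rt (s_b' t (s_b w x)); rewrite /= bK => ->; have := rw x => /= ->; rewrite bK.
- by move=> v /ws/ts.
- by move=> x y /wE/tE.
Qed.

(** A correction of [H] is absorbed in [s_b], and the maps towards the space of [G] stay fixed. *)
Lemma good_reach_right s r1 E1 : good s ->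
  reach (conj_group (s_a' s) (s_a s) G) (conj_group (s_b' s) (s_b s) H)
      (s_a s @^-1` K) (s_b s @^-1` L) (s_b' s \o h \o s_a s) (s_a' s \o h' \o s_b s)
      (s_r s) (s_E s) r1 E1 ->
  exists t, [/\ good t, extends s t, s_a t = s_a s /\ s_a' t = s_a' s & s_r t = r1 /\ s_E t = E1].
Proof.
move=> gs [u [u' [uu' st ss sE cp]]]; have [aa' bb' _] := gs.
exists (State (s_a s) (s_a' s) (s_b s \o u) (u' \o s_b' s) r1 E1); split=> //.
  split=> //=; first exact: inverse_homeos_comp.
  by rewrite -conj_group_comp.
have [_ _ aK _] := aa'; have [_ _ bK _] := bb'; split=> //=.
- rewrite (_ : s_a' s \o s_a s = id); first exact: stab_id.
  by apply/funext.
- rewrite (_ : s_b' s \o (s_b s \o u) = u)//.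
  by apply/funext => x /=; rewrite bK.
Qed.

End back_and_forth.

(** Exchanges the two groups, so that back and forth are one argument. *)
Definition flip (s : state) := State (s_b s) (s_b' s) (s_a s) (s_a' s) (s_r s) (s_E s).

Lemma flip_good G H K L h h' s : good G H K L h h' s -> good H G L K h' h (flip s).
Proof. by move=> [aa' bb' cp]; split=> //; exact: coupled_sym. Qed.

Lemma flip_extends s t : extends s t -> extends (flip s) (flip t).
Proof. by case. Qed.

Lemma good_reach_left G H K L h h' s r1 E1 : good G H K L h h' s ->
  reach (conj_group (s_b' s) (s_b s) H) (conj_group (s_a' s) (s_a s) G)
      (s_b s @^-1` L) (s_a s @^-1` K) (s_a' s \o h' \o s_b s) (s_b' s \o h \o s_a s)
      (s_r s) (s_E s) r1 E1 ->
  exists t, [/\ good G H K L h h' t, extends s t, s_b t = s_b s /\ s_b' t = s_b' s &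
    s_r t = r1 /\ s_E t = E1].
Proof.
move=> /flip_good gs /(good_reach_right gs)[t [gt st e1 e2]].
exists (flip t); split=> //; first exact: flip_good.
exact: (@flip_extends (flip s) t st).
Qed.

Lemma good_step_right G H K L h h' s g : good G H K L h h' s -> G g ->
  exists t, [/\ good G H K L h h' t, extends s t &
    forall x, s_r t (s_a' t (g (s_a t x))) = s_r t x].
Proof.
move=> gs Gg; have [aa' bb' cp] := gs.
have [|r1 [E1 [rg rE]]] := reach_element cp (g := s_a' s \o g \o s_a s).
  by exists g.
have [t [gt st [ta ta'] [tr tE]]] := good_reach_right gs rE.
by exists t; split=> // x; rewrite ta ta' tr; exact: rg.
Qed.

Lemma good_step_left G H K L h h' s g : good G H K L h h' s -> H g ->
  exists t, [/\ good G H K L h h' t, extends s t &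
    forall x, s_r t (s_b' t (g (s_b t x))) = s_r t x].
Proof.
move=> /flip_good gs /(good_step_right gs)[t [gt st tr]].
exists (flip t); split=> //; first exact: flip_good.
exact: (@flip_extends (flip s) t st).
Qed.

(** Small atoms make the inverse maps converge; small images of atoms make the maps themselves
    converge. *)
Definition fine_state n (s : state) := forall x y, s_E s x y ->
  [/\ agree n x y, agree n (s_a s x) (s_a s y) & agree n (s_b s x) (s_b s y)].

(** Refining from the right changes [s_b] but not [s_a], and from the left the reverse. So atoms are
    made small for [s_a], then for the new [s_b]. *)
Lemma good_fine G H K L h h' s n : good G H K L h h' s ->
  exists t, [/\ good G H K L h h' t, extends s t & fine_state n t].
Proof.
move=> gs; have [aa' bb' cp] := gs.
have [N Na] : exists N, forall x y, agree N x y -> agree n (s_a s x) (s_a s y).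
  by apply: uniformly_continuous; case: aa'.
have [E1 [E1N E1r]] := reach_fine (maxn n N) cp.
have [t [gt st [ta ta'] [tr tE]]] := good_reach_right gs E1r.
have [aat bbt cpt] := gt.
have [M Mb] : exists M, forall x y, agree M x y -> agree n (s_b t x) (s_b t y).
  by apply: uniformly_continuous; case: bbt.
have [E2 [E2M E2r]] := reach_fine M (coupled_sym cpt).
have [w [gw tw [wb wb'] [wr wE]]] := good_reach_left gt E2r.
exists w; split=> //; first exact: extends_trans gs st aat bbt tw.
move=> x y xy; have [[Ew _] _ _ sE] := tw.
have := E1N; rewrite -tE => E1N'.
split.
- by apply: agreeW (leq_maxl n N) _; apply: E1N'; exact: sE.
(* The second refinement has changed [s_a], but by a correction preserving the atoms of [t], which
   already have small images under [s_a t]. *)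
- have Et := tw_trans (cp_tower cpt); have Es := tw_sym (cp_tower cpt).
  have : s_E t (s_a' t (s_a w x)) (s_a' t (s_a w y)).
    exact: (Et _ _ _ (Es _ _ (Ew x)) (Et _ _ _ (sE _ _ xy) (Ew y))).
  move=> /E1N'/(agreeW (leq_maxr n N))/Na; rewrite -ta.
  by have [_ _ _ aK] := aat; rewrite !aK.
- by rewrite wb; apply: Mb; apply: E2M; rewrite -wE.
Qed.

(** The equation says that [g] preserves the fibres of the retraction of [s]. This [s] is a state
    passed on the way, not necessarily a term of the sequence. *)
Definition absorbs_left G H K L h h' (g : X -> X) (t : nat -> state) :=
  exists s M, [/\ good G H K L h h' s, forall m, (M <= m)%N -> extends s (t m) &
    forall x, s_r s (s_a' s (g (s_a s x))) = s_r s x].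

Record back_and_forth G H K L h h' (t : nat -> state) : Prop := BackAndForth {
  bf_good : forall n, good G H K L h h' (t n) ;
  bf_extends : forall n m, (n <= m)%N -> extends (t n) (t m) ;
  bf_fine : forall n, fine_state n (t n) ;
  bf_left : forall g, G g -> absorbs_left G H K L h h' g t ;
  bf_right : forall g, H g -> absorbs_left H G L K h' h g (flip \o t) }.

Lemma back_and_forth_flip G H K L h h' t :
  back_and_forth G H K L h h' t -> back_and_forth H G L K h' h (flip \o t).
Proof.
move=> [tg te tf tl tr]; split=> //.
- by move=> n; exact: flip_good.
- by move=> n m /te; exact: flip_extends.
- by move=> n x y /tf[].
Qed.

Lemma extends_refl G H K L h h' s : good G H K L h h' s -> extends s s.
Proof.
move=> gs; have [[_ _ aK _] [_ _ bK _] _] := gs; have sid := stab_id gs; split=> //.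
  by rewrite (_ : s_a' s \o _ = id)//; apply/funext.
by rewrite (_ : s_b' s \o _ = id)//; apply/funext.
Qed.

Lemma good_step G H K L h h' s n g k : good G H K L h h' s -> G g -> H k ->
  exists t, [/\ good G H K L h h' t, extends s t, fine_state n t,
    exists s1, [/\ good G H K L h h' s1, extends s1 t &
      forall x, s_r s1 (s_a' s1 (g (s_a s1 x))) = s_r s1 x] &
    exists s2, [/\ good G H K L h h' s2, extends s2 t &
      forall x, s_r s2 (s_b' s2 (k (s_b s2 x))) = s_r s2 x]].
Proof.
move=> gs Gg Hk.
have [s1 [gs1 ss1 s1g]] := good_step_right gs Gg.
have [s2 [gs2 ss2 s2k]] := good_step_left gs1 Hk.
have [t [gt st tf]] := good_fine n gs2.
have [aa1 bb1 _] := gs1; have [aa2 bb2 _] := gs2.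
have s1t := extends_trans gs1 ss2 aa2 bb2 st.
exists t; split=> //; first exact: (extends_trans gs ss1 aa1 bb1 s1t).
  by exists s1.
by exists s2.
Qed.

Lemma back_and_forth_exists G H K L h h' s : good G H K L h h' s ->
  countable G -> countable H -> G idfun -> H idfun ->
  exists t, back_and_forth G H K L h h' t.
Proof.
move=> gs Gcnt Hcnt Gid Hid.
have [eG [GeG eGG]] := countable_enum Gid Gcnt.
have [eH [HeH eHH]] := countable_enum Hid Hcnt.
pose Q n (s t : state) := [/\ good G H K L h h' t, extends s t, fine_state n t,
    exists s1, [/\ good G H K L h h' s1, extends s1 t &
      forall x, s_r s1 (s_a' s1 (eG n (s_a s1 x))) = s_r s1 x] &
    exists s2, [/\ good G H K L h h' s2, extends s2 t &
      forall x, s_r s2 (s_b' s2 (eH n (s_b s2 x))) = s_r s2 x]].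
have /choice[F FP] : forall ns : nat * state, exists t,
    good G H K L h h' ns.2 -> Q ns.1 ns.2 t.
  move=> [n s0]; have [g0|ng0] := pselect (good G H K L h h' s0); last by exists s0.
  by have [t tP] := @good_step _ _ _ _ _ _ s0 n (eG n) (eH n) g0 (GeG n) (HeH n); exists t.
(* The term of index [n] absorbs the elements of index [n] and is fine to depth [n]. *)
pose fix t n := if n is m.+1 then F (m.+1, t m) else F (0%N, s).
have tgood n : good G H K L h h' (t n).
  by elim: n => [|n IH] /=; [have [] := FP (0%N, s) gs|have [] := FP (n.+1, t n) IH].
have tQ n : exists s0, Q n s0 (t n).
  by case: n => [|n] /=; [exists s; exact: (FP (0%N, s) gs)|exists (t n); exact: (FP (n.+1, t n) (tgood n))].
have text n m : (n <= m)%N -> extends (t n) (t m).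
  elim: m => [|m IH].
    by rewrite leqn0 => /eqP ->; exact: extends_refl (tgood 0%N).
  rewrite leq_eqVlt => /orP[/eqP ->|]; first exact: extends_refl (tgood m.+1).
  rewrite ltnS => /IH nm; have [aa bb _] := tgood m.
  apply: (extends_trans (tgood n) nm aa bb).
  by have [] := FP (m.+1, t m) (tgood m).
exists t; split=> //.
- by move=> n; have [s0 []] := tQ n.
- move=> g /eGG[n <-]; have [s0 [_ _ _ [s1 [g1 s1t s1P]] _]] := tQ n.
  exists s1, n; split=> // m nm; have [aa bb _] := tgood n.
  exact: (extends_trans g1 s1t aa bb (text _ _ nm)).
- move=> g /eHH[n <-]; have [s0 [_ _ _ _ [s1 [g1 s1t s1P]]]] := tQ n.
  exists (flip s1), n; split=> //; first exact: flip_good.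
  move=> m nm; have [aa bb _] := tgood n.
  exact: flip_extends (extends_trans g1 s1t aa bb (text _ _ nm)).
Qed.

Section limit_state.
Variables (G H : set (X -> X)) (K L : set X) (h h' : X -> X) (t : nat -> state).
Hypothesis bf : back_and_forth G H K L h h' t.

Let E n := s_E (t n).

Lemma state_cauchy_a m n x : (n <= m)%N -> agree n (s_a (t m) x) (s_a (t n) x).
Proof.
move=> nm; have [[Ew _] _ _ _] := bf_extends bf nm; have [[_ _ _ aK] _ _] := bf_good bf n.
by have [_ + _] := bf_fine bf (Ew x); rewrite /= aK; exact: agree_sym.
Qed.

Lemma state_class_a' m n x : (n <= m)%N -> E n (s_a' (t m) x) (s_a' (t n) x).
Proof.
move=> nm; have [[Ew _] _ _ _] := bf_extends bf nm; have [[_ _ _ aK] _ _] := bf_good bf m.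
by have := Ew (s_a' (t m) x); rewrite /= aK.
Qed.

Lemma state_cauchy_a' m n x : (n <= m)%N -> agree n (s_a' (t m) x) (s_a' (t n) x).
Proof. by move=> /(@state_class_a' _ _ x) /(bf_fine bf)[]. Qed.

Definition limit_a := pointwise_limit (s_a \o t).
Definition limit_a' := pointwise_limit (s_a' \o t).

Lemma limit_a_homeo : inverse_homeos limit_a limit_a'.
Proof.
apply: limit_homeos => [n|m n x|m n x].
- by have [] := bf_good bf n.
- exact: state_cauchy_a.
- exact: state_cauchy_a'.
Qed.

(** Atoms are open, so a late term lies in the atom of the limit, and from index [n] on all terms
    stay in one atom of [E n]. *)
Lemma limit_class n x : E n (limit_a' x) (s_a' (t n) x).
Proof.
have tw := cp_tower (let: And3 _ _ cp := bf_good bf n in cp).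
have [N NE] := tw_open tw; pose m := maxn N n.
apply: (tw_trans tw) (state_class_a' x (leq_maxr N n)).
apply: NE; apply: agreeW (leq_maxl N n) _.
apply: (@pointwise_limit_agree (s_a' \o t)) => k l y.
exact: state_cauchy_a'.
Qed.

Lemma limit_a_commute s M : good G H K L h h' s ->
  (forall m, (M <= m)%N -> extends s (t m)) ->
  forall x, s_r s (s_a' s (limit_a x)) = s_a' s (limit_a (s_r s x)).
Proof.
move=> [[_ ca' _ _] _ cp] st; apply: (@limit_commute (s_a \o t) _ _ M) => //.
- by move=> m n x; exact: state_cauchy_a.
- have Gloc := tame_local (gm_tame (mt_left (cp_matched cp))).
  exact: locally_in_continuous Gloc.1 (tower_locally (cp_tower cp)).
- by move=> m x Mm; have [[_ rw] _ _ _] := st m Mm; exact: rw.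
Qed.

End limit_state.

(** [A' g A] preserves the fibres of [s_r s]: this holds with [s_a s] in place of [A], and the two
    differ by a map commuting with the retraction. The same comparison for [B] shows that the
    conjugate preserves the fibres of a map locally in [H]. *)
Lemma conj_of_commute G H K L h h' s A A' B B' g : local_group H ->
  good G H K L h h' s -> inverse_homeos A A' -> inverse_homeos B B' ->
  (forall x, s_r s (s_a' s (A x)) = s_a' s (A (s_r s x))) ->
  (forall x, s_r s (s_b' s (B x)) = s_b' s (B (s_r s x))) ->
  G g -> (forall x, s_r s (s_a' s (g (s_a s x))) = s_r s x) ->
  H (B \o A' \o g \o (A \o B')).
Proof.
move=> Hloc gs AA BB rA rB Gg sr.
have [_ _ AK A'K] := AA; have [_ _ BK B'K] := BB.
have [[ca ca' aK a'K] bb cp] := gs; have [_ _ bK b'K] := bb.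
have [k gk] : homeomorphism g.
  have Gloc := tame_local (gm_tame (mt_left (cp_matched cp))).
  have : conj_group (s_a' s) (s_a s) G (s_a' s \o g \o s_a s) by exists g.
  case: Gloc.1 => + _ _ _ => /[apply] -[k gk].
  exists (s_a s \o k \o s_a' s).
  rewrite (_ : g = s_a s \o (s_a' s \o g \o s_a s) \o s_a' s).
    exact: inverse_homeos_conj gk.
  by apply/funext => x /=; rewrite !a'K.
apply: (@locally_in_invariant H (s_b s \o s_r s \o s_b' s) _ (B \o A' \o k \o (A \o B')) Hloc).
- rewrite -(conj_groupK bb H); apply: locally_in_conj; first exact: inverse_homeos_sym.
  exact: tower_locally (tower_sym (cp_tower cp)).
- have AB : inverse_homeos (A \o B') (B \o A').
    exact: (inverse_homeos_comp (inverse_homeos_sym BB) AA).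
  exact: (inverse_homeos_conj AB gk).
- have rAg y : s_r s (A' (g (A y))) = s_r s y.
    apply: (can_inj AK); apply: (can_inj a'K); rewrite -rA A'K -rA.
    by rewrite -[in RHS]sr !a'K.
  by move=> x /=; congr (s_b s _); rewrite rB rAg -rB B'K.
Qed.

Lemma limit_conj G H K L h h' t g : local_group H ->
  back_and_forth G H K L h h' t -> G g ->
  H (limit_a (flip \o t) \o limit_a' t \o g \o (limit_a t \o limit_a' (flip \o t))).
Proof.
move=> Hloc bf Gg; have [s [M [gs sM sr]]] := bf_left bf Gg.
have bf' := back_and_forth_flip bf.
have rA := limit_a_commute bf gs sM.
have rB := limit_a_commute bf' (flip_good gs) (fun m Mm => flip_extends (sM m Mm)).
exact: conj_of_commute Hloc gs (limit_a_homeo bf) (limit_a_homeo bf') rA rB Gg sr.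
Qed.

Lemma back_and_forth_limit G H K L h h' t : local_group G -> local_group H ->
  back_and_forth G H K L h h' t ->
  exists f f', [/\ inverse_homeos f f', forall x, K x -> f x = h x & conj_group f f' G = H].
Proof.
move=> Gloc Hloc bf; have bf' := back_and_forth_flip bf.
(* At stage [n] the preimages of [x] and of [h x] share an atom by [cp_h], which also contains
   [limit_a' t x] by [limit_class]; its image under [s_b] is small. *)
have Kh x : K x -> limit_a (flip \o t) (limit_a' t x) = h x.
  move=> Kx; apply: agree_all => n.
  have [[_ _ _ aK] [_ _ _ bK] cp] := bf_good bf n.
  have Kx' : (s_a (t n) @^-1` K) (s_a' (t n) x) by rewrite /preimage /= aK.
  have := cp_h cp Kx'; rewrite /= aK => /(bf_fine bf)[_ _]; rewrite bK => bh.
  apply: agree_trans bh.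
  have [_ _ e] := bf_fine bf (limit_class bf n x).
  apply: agree_trans e; apply: (@pointwise_limit_agree (s_b \o t)) => k l y.
  exact: (state_cauchy_a bf').
have GH g := @limit_conj _ _ _ _ _ _ _ g Hloc bf.
have HG k := @limit_conj _ _ _ _ _ _ _ k Gloc bf'.
have ff : flip \o (flip \o t) = t by apply/funext => n /=; case: (t n).
rewrite ff in HG.
move: (limit_a_homeo bf) (limit_a_homeo bf') Kh GH HG.
move: (limit_a t) (limit_a' t) (limit_a (flip \o t)) (limit_a' (flip \o t)) => A A' B B' AA BB Kh GH HG.
have [_ _ AK A'K] := AA; have [_ _ BK B'K] := BB.
exists (B \o A'), (A \o B').
split=> //; first exact: (inverse_homeos_comp (inverse_homeos_sym AA) BB).
apply/seteqP; split=> [_ [g Gg <-]|k Hk]; first exact: GH.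
by eexists; [exact: HG Hk|apply/funext => x /=; rewrite !AK !B'K].
Qed.

(** The intermediate space starts as the space of [G], with [g] towards the other one: here the
    isomorphism of relations is spent. With a single atom and the identity as retraction, coupling
    only asks that [h] be injective on [K]. *)
Lemma initial_good G H K L h h' g g' : germ_matching G K H h -> germ_matching H L G h' ->
  inverse_homeos g g' ->
  (forall A B, clopen A -> clopen B ->
    clopen_equiv G A B <-> clopen_equiv H (g @` A) (g @` B)) ->
  cancellative G ->
  (forall x, K x -> L (h x) /\ h' (h x) = x) ->
  (forall y, L y -> K (h' y) /\ h (h' y) = y) ->
  good G H K L h h' (State id id g g' id (fun _ _ => True)).
Proof.
move=> hl hr gg' equ can hK hL; have [_ _ gK g'K] := gg'; split=> //=.
  exact: inverse_homeos_id.
rewrite conj_group_id.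
have Gid : G idfun by case: (tame_local (gm_tame hl)).1.
have Hid : H idfun by case: (tame_local (gm_tame hr)).1.
split=> //.
- split=> //.
  + exact: germ_matching_conj_target.
  + exact: germ_matching_conj_source.
  + by move=> A B cA cB; rewrite clopen_equiv_conj// equ.
  + by move=> x Kx; have [Lx e] := hK x Kx; rewrite /preimage /= g'K.
  + by move=> y /= Ly; have [Kx e] := hL _ Ly; rewrite e gK.
- split=> //.
  + by exists 0%N.
  + by move=> x; exists idfun.
  + by move=> x; exists idfun => //; exists idfun => //; apply/funext => y /=; rewrite gK.
  + by move=> x y x' _ _; exists y.
- move=> x y Kx Ky /=; split=> [->//|/(can_inj g'K) e].
  by have [_ <-] := hK x Kx; rewrite e; have [_ ->] := hK y Ky.
Qed.

Lemma set_val_surj (K : set X) x : K x -> exists z : K, set_val z = x.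
Proof. by move=> Kx; exists (SigSub (mem_set Kx)). Qed.

(** The identity off [K] is a mere default, giving a total map of [X]. *)
Definition extend_by_id (K L : set X) (h : K -> L) (x : X) : X :=
  oapp (fun z => set_val (h z)) x (insub x).

Lemma extend_by_idE (K L : set X) (h : K -> L) (z : K) :
  extend_by_id h (set_val z) = set_val (h z).
Proof. by rewrite /extend_by_id set_valE valK. Qed.

Lemma germ_matching_of_trace (R : realType) (G H : set (X -> X)) (K L : set X) (h : K -> L) h' :
  ample_group G -> minimal_group G -> malleable R G K ->
  homeo_subgroup H -> closed L -> etale H L -> inverse_homeos h h' ->
  conj_group h h' (trace_group G K) `<=` trace_group H L ->
  germ_matching G K H (extend_by_id h).
Proof.
move=> Gample Gmin [cK thinK etK] Hgrp cL etL hh' conjh; split=> //.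
- exact: ample_tame.
- exact: thin_small thinK.
- move=> x N /set_val_surj[z <-].
  have [M Mh] := (continuous_set_type h).1 (let: And4 ch _ _ _ := hh' in ch) z N.
  by exists M => y /set_val_surj[w <-] /Mh; rewrite !extend_by_idE.
- move=> g x Gg /set_val_surj[z <-] Kgz.
  have [N [k Hk NP]] := germ_of_trace Gample Hgrp etK cL etL hh' conjh Gg Kgz.
  exists N, k => // y /set_val_surj[w <-] zw.
  have [Kgw _] := NP w w zw; split=> //.
  have [v vgw] := set_val_surj Kgw; have [_ /(_ vgw)] := NP w v zw.
  by rewrite -vgw !extend_by_idE => ->.
Qed.

Theorem theorem4p1 (R : realType)
    (Gamma Lambda : set (cantor_space -> cantor_space))
    (K L : set cantor_space)
    (ampleGamma : ample_group Gamma) (ampleLambda : ample_group Lambda)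
    (minGamma : minimal_group Gamma) (minLambda : minimal_group Lambda)
    (malK : malleable R Gamma K) (malL : malleable R Lambda L)
    (isoGL : isomorphic_clopen_relations Gamma Lambda)
    (h : K -> L) (h' : L -> K) (homeo_h : inverse_homeos h h')
    (conj_h : conj_group h h' (trace_group Gamma K) = trace_group Lambda L) :
  exists f f' : cantor_space -> cantor_space,
    [/\ inverse_homeos f f',
        forall x : K, f (set_val x) = set_val (h x) &
        conj_group f f' Gamma = Lambda].
Proof.
have [[Gfull Gcnt _ _] [Lfull Lcnt _ _]] := (ampleGamma, ampleLambda).
have Gloc := full_local_group Gfull; have Lloc := full_local_group Lfull.
have [[cK _ etK] [cL _ etL]] := (malK, malL).
have [_ _ hK h'K] := homeo_h.
have conj_h' : conj_group h' h (trace_group Lambda L) `<=` trace_group Gamma K.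
  rewrite -conj_h => _ [_ [w Gw <-] <-].
  rewrite (_ : h' \o (h \o w \o h') \o h = w)//.
  by apply/funext => x /=; rewrite !hK.
have conj_h0 : conj_group h h' (trace_group Gamma K) `<=` trace_group Lambda L by rewrite conj_h.
have hl := germ_matching_of_trace ampleGamma minGamma malK Lloc.1 cL etL homeo_h conj_h0.
have hr := germ_matching_of_trace ampleLambda minLambda malL Gloc.1 cK etK
  (inverse_homeos_sym homeo_h) conj_h'.
have [g [g' gg'] equ] := isoGL.
have gs := @initial_good _ _ _ _ _ _ g g' hl hr gg' equ (ample_cancellative ampleGamma).
have [t bf] : exists t, back_and_forth Gamma Lambda K L (extend_by_id h) (extend_by_id h') t.
  apply: back_and_forth_exists Gcnt Lcnt _ _; [|by case: Gloc.1|by case: Lloc.1].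
  apply: gs => x /set_val_surj[z <-]; rewrite !extend_by_idE ?hK ?h'K.
    by split=> //; exact: set_valP.
  by split=> //; exact: set_valP.
have [f [f' [ff' fh fconj]]] := back_and_forth_limit Gloc Lloc bf.
exists f, f'; split=> // z; rewrite fh ?extend_by_idE//; exact: set_valP.
Qed.
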